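(* There is no hypergeometric equation of order $3$ over $\mathbb{C}(z)$ whose differential Galois group over $\mathbb{C}(z)$ is isomorphic to the group $H_{72}^{SL_3}$.
   Context: The group. Let $\varepsilon$ be a primitive $9$th root of unity with $\varepsilon^6+\varepsilon^3+1=0$, let $\omega=-1-\varepsilon^3$ (a primitive $3$rd root of unity), and let $\rho=1/(\omega-\omega^2)$. Put $$S=\begin{pmatrix}1&0&0\\0&\omega&0\\0&0&\omega^2\end{pmatrix},\quad T=\begin{pmatrix}0&1&0\\0&0&1\\1&0&0\end{pmatrix},\quad U=\begin{pmatrix}\varepsilon&0&0\\0&\varepsilon&0\\0&0&\varepsilon\omega\end{pmatrix},\quad V=\rho\begin{pmatrix}1&1&1\\1&\omega&\omega^2\\1&\omega^2&\omega\end{pmatrix}.$$ $H_{72}^{SL_3}$ is the finite subgroup of $SL_3(\mathbb{C})$ generated by $S$, $T$, $V$ and $UVU^{-1}$. It is the preimage in $SL_3(\mathbb{C})$ of the normal subgroup $H_{72}$ of index $3$ in the Hessian group $H_{216}\subseteq PSL_3(\mathbb{C})$. Hypergeometric equation. With $\theta=z\frac{d}{dz}$, a hypergeometric equation of order $3$ is a linear differential equation over $\mathbb{C}(z)$ of the form $$\big[(\theta+\beta_1-1)(\theta+\beta_2-1)(\theta+\beta_3-1)-z(\theta+\alpha_1)(\theta+\alpha_2)(\theta+\alpha_3)\big]y=0,$$ with $\alpha_1,\alpha_2,\alpha_3,\beta_1,\beta_2,\beta_3\in\mathbb{C}$; its singular points are among $0,1,\infty$. *)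

(* Defs.v *)
From HB Require Import structures.
From mathcomp Require Import all_boot all_order all_algebra.
From mathcomp Require Import boolp classical_sets reals.
From mathcomp Require Import complex ring.

Set Implicit Arguments.
Unset Strict Implicit.
Unset Printing Implicit Defensive.

Import GRing.Theory.
Local Open Scope ring_scope.
Local Open Scope classical_set_scope.

Local Notation "x %:F" := (@FracField.tofrac _ x).

HB.mixin Record Field_isDifferential K of GRing.Field K := {
  der : K -> K;
  derD : {morph der : x y / x + y};
  derM : forall x y, der (x * y) = der x * y + x * der y
}.

#[short(type="diffFieldType")]
HB.structure Definition DiffField :=
  {K of Field_isDifferential K & GRing.Field K}.

(* The differential field F(z), with the derivation d/dz. *)
Section RationalFunctions.
Variable F : fieldType.
Local Notation Fz := {fraction {poly F}}.

(* By ratderE below, the quotient rule may be applied to any representative. *)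
Definition ratder (x : Fz) : Fz :=
  let p := \n_(repr x) in let q := \d_(repr x) in
  (p^`() * q - p * q^`())%:F / (q ^+ 2)%:F.

Lemma fracE (x : Fz) : x = (\n_(repr x))%:F / (\d_(repr x))%:F.
Proof.
have dn0 := denom_ratioP (repr x).
have q0 : (\d_(repr x))%:F != 0 by rewrite tofrac_eq0.
apply: (canRL (mulfK q0)).
move: (repr x) (reprK x) dn0 {q0} => r <- dn0; unlock FracField.tofrac.
rewrite -[LHS]FracField.pi_mul.
apply/eqmodP; rewrite /= FracField.equivfE /FracField.mulf.
by rewrite !numden_Ratio ?mulf_neq0 ?oner_eq0 // !mulr1 mulrC.
Qed.

Lemma ratderE (p q : {poly F}) : q != 0 ->
  ratder (p%:F / q%:F) = (p^`() * q - p * q^`())%:F / (q ^+ 2)%:F.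
Proof.
move=> q0; rewrite /ratder; set x := p%:F / q%:F.
have := fracE x; rewrite {1}/x; have := denom_ratioP (repr x).
move: (frac (repr x)) => [a b] /= b0.
move/eqP; rewrite eqr_div ?tofrac_eq0 // -!tofracM tofrac_eq => /eqP pb.
apply/eqP; rewrite eqr_div ?tofrac_eq0 ?expf_neq0 // -!tofracM tofrac_eq.
have := congr1 (@deriv _) pb; rewrite !derivM => dpb.
rewrite -subr_eq0.
have -> : (a^`() * b - a * b^`()) * q ^+ 2 - (p^`() * q - p * q^`()) * b ^+ 2
  = b * q * (a^`() * q + a * q^`() - (p^`() * b + p * b^`()))
    + (p * b - a * q) * (b^`() * q + b * q^`()) by ring.
by rewrite dpb pb !subrr mulr0 mul0r addr0.
Qed.

Lemma ratderD : {morph ratder : x y / x + y}.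
Proof.
move=> x y; rewrite (fracE x) (fracE y).
have := denom_ratioP (repr x); have := denom_ratioP (repr y).
move: (frac (repr x)) (frac (repr y)) => [a b] [c d] /= d0 b0.
rewrite addf_div ?tofrac_eq0 // -!tofracM -tofracD !ratderE ?mulf_neq0 //.
rewrite addf_div ?tofrac_eq0 ?expf_neq0 // -!tofracM -tofracD.
rewrite !derivD !derivM exprMn; congr (_%:F / _%:F); ring.
Qed.

Lemma ratderM x y : ratder (x * y) = ratder x * y + x * ratder y.
Proof.
rewrite (fracE x) (fracE y).
have := denom_ratioP (repr x); have := denom_ratioP (repr y).
move: (frac (repr x)) (frac (repr y)) => [a b] [c d] /= d0 b0.
rewrite mulf_div -!tofracM !ratderE ?mulf_neq0 // !mulf_div -!tofracM.
rewrite addf_div ?tofrac_eq0 ?mulf_neq0 ?expf_neq0 // -!tofracM -tofracD.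
apply/eqP; rewrite eqr_div ?tofrac_eq0 ?mulf_neq0 ?expf_neq0 ?mulf_neq0 //.
rewrite -!tofracM tofrac_eq !derivM; apply/eqP; ring.
Qed.

HB.instance Definition _ :=
  Field_isDifferential.Build {fraction {poly F}} ratderD ratderM.

Definition ratvar : Fz := 'X%:F.
Definition ratcst (c : F) : Fz := c%:P%:F.

Lemma der_ratvar : der ratvar = 1.
Proof.
rewrite /ratvar -['X%:F]divr1 -tofrac1 [LHS]ratderE ?oner_eq0 //.
by rewrite derivX -polyC1 derivC mulr0 subr0 mulr1 expr1n tofrac1 divr1.
Qed.

Lemma der_ratcst c : der (ratcst c) = 0.
Proof.
rewrite /ratcst -[c%:P%:F]divr1 -tofrac1 [LHS]ratderE ?oner_eq0 //.
by rewrite derivC -polyC1 derivC mulr0 mul0r subr0 tofrac0 mul0r.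
Qed.
End RationalFunctions.

(* A differential extension L of K is given by its structure map
   iota : {rmorphism K -> L}, subject to {morph iota : a / der a}. *)
Section DifferentialExtensions.
Variables (K L : diffFieldType) (iota : {rmorphism K -> L}).

Definition diff_subfield (E : set L) : Prop :=
  [/\ E 1, forall x y, E x -> E y -> E (x - y),
      forall x y, E x -> E y -> E (x / y)
    & forall x, E x -> E (der x)].

(* L is a Picard-Vessiot extension of K for the homogeneous linear differential
   equation of order n over K whose set of solutions in L is sol: it has no new
   constants and is generated, as a differential field over K, by a fundamental
   system y of n solutions. *)
Definition picard_vessiot (n : nat) (sol : set L) : Prop :=
  [/\ {morph iota : a / der a},
      forall x : L, der x = 0 -> exists2 a : K, der a = 0 & iota a = x
    & exists y : 'I_n -> L,
      [/\ forall i, sol (y i),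
          forall c : 'I_n -> K, (forall i, der (c i) = 0) ->
            \sum_i iota (c i) * y i = 0 -> forall i, c i = 0
        & smallest diff_subfield (range iota `|` range y) = setT]].

Definition is_diffaut (s : L -> L) : Prop :=
  [/\ zmod_morphism s, GRing.monoid_morphism s, bijective s,
      {morph s : x / der x} & forall a, s (iota a) = iota a].

(* The differential Galois group of L over K. *)
Record diffGal := DiffGal { dgval :> L -> L; dgvalP : is_diffaut dgval }.

HB.instance Definition _ := gen_eqMixin diffGal.
HB.instance Definition _ := gen_choiceMixin diffGal.

Lemma diffGal_eq (s t : diffGal) : s =1 t -> s = t.
Proof.
case: s t => [s sP] [t tP] /= /funext st; case: t / st tP => tP.
by congr DiffGal; apply: Prop_irrelevance.
Qed.

Lemma diffGal_inv_key (s : diffGal) :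
  exists t : L -> L, is_diffaut t /\ (cancel s t /\ cancel t s).
Proof.
case: s => s /= [sB [s1 sM] [t st ts] sd si]; exists t; split=> //.
have sI := can_inj st; split.
- by move=> x y; apply: sI; rewrite sB !ts.
- by split=> [|x y]; apply: sI; rewrite ?sM !ts ?s1.
- by exists s.
- by move=> x; apply: sI; rewrite sd !ts.
- by move=> a; apply: sI; rewrite ts si.
Qed.

Lemma diffGal_one_key : is_diffaut id.
Proof. by split=> //; exists id. Qed.

Lemma diffGal_mul_key (s t : diffGal) : is_diffaut (s \o t).
Proof.
case: s t => s [sB [s1 sM] bs sd si] [t [tB [t1 tM] bt td ti]] /=; split.
- by move=> x y /=; rewrite tB sB.
- by split=> [|x y] /=; rewrite ?t1 ?tM.
- exact: bij_comp.
- by move=> x /=; rewrite td sd.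
- by move=> a /=; rewrite ti.
Qed.

Definition diffGal_one := DiffGal diffGal_one_key.
Definition diffGal_mul s t := DiffGal (diffGal_mul_key s t).
Definition diffGal_inv s := DiffGal (proj1 (projT2 (cid (diffGal_inv_key s)))).

Lemma diffGal_mulA : associative diffGal_mul.
Proof. by move=> s t u; apply: diffGal_eq. Qed.
Lemma diffGal_mul1g : left_id diffGal_one diffGal_mul.
Proof. by move=> s; apply: diffGal_eq. Qed.
Lemma diffGal_mulg1 : right_id diffGal_one diffGal_mul.
Proof. by move=> s; apply: diffGal_eq. Qed.
Lemma diffGal_mulVg : left_inverse diffGal_one diffGal_inv diffGal_mul.
Proof.
move=> s; apply: diffGal_eq => x; rewrite /diffGal_inv /=.
by case: cid => t /= [? [st ts]]; apply: st.
Qed.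
Lemma diffGal_mulgV : right_inverse diffGal_one diffGal_inv diffGal_mul.
Proof.
move=> s; apply: diffGal_eq => x; rewrite /diffGal_inv /=.
by case: cid => t /= [? [st ts]]; apply: ts.
Qed.

HB.instance Definition _ := isGroup.Build diffGal
  diffGal_mulA diffGal_mul1g diffGal_mulg1 diffGal_mulVg diffGal_mulgV.
End DifferentialExtensions.

(* The equation
     [(th+b1-1)(th+b2-1)(th+b3-1) - z(th+a1)(th+a2)(th+a3)] y = 0
   with th = z d/dz, in an extension L of F(z). *)
Section Hypergeometric.
Variables (F : fieldType) (L : diffFieldType).
Variable iota : {rmorphism {fraction {poly F}} -> L}.

Definition theta (y : L) : L := iota (ratvar F) * der y.

Definition theta_add (c : F) (y : L) : L := theta y + iota (ratcst c) * y.

Definition hypergeometric_sol (a1 a2 a3 b1 b2 b3 : F) : set L :=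
  [set y : L |
    theta_add (b1 - 1) (theta_add (b2 - 1) (theta_add (b3 - 1) y))
    - iota (ratvar F) * theta_add a1 (theta_add a2 (theta_add a3 y)) = 0].
End Hypergeometric.

Section SpecialLinearGroup.
Variables (F : fieldType) (n : nat).

Record SL := MkSL { slval :> 'M[F]_n; _ : \det slval == 1 }.

HB.instance Definition _ := [isSub for slval].
HB.instance Definition _ := [Choice of SL by <:].

Lemma SL_det (A : SL) : \det A = 1. Proof. by apply/eqP; case: A. Qed.
Lemma SL_unit (A : SL) : slval A \in unitmx.
Proof. by rewrite unitmxE SL_det unitr1. Qed.

Lemma SL_one_key : \det (1%:M : 'M[F]_n) == 1. Proof. by rewrite det1. Qed.
Lemma SL_mul_key (A B : SL) : \det (slval A *m slval B) == 1.
Proof. by rewrite det_mulmx !SL_det mulr1. Qed.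
Lemma SL_inv_key (A : SL) : \det (invmx A) == 1.
Proof. by rewrite det_inv SL_det invr1. Qed.

Definition SL_one := MkSL SL_one_key.
Definition SL_mul A B := MkSL (SL_mul_key A B).
Definition SL_inv A := MkSL (SL_inv_key A).

Lemma SL_mulA : associative SL_mul.
Proof. by move=> A B C; apply: val_inj; rewrite /= mulmxA. Qed.
Lemma SL_mul1g : left_id SL_one SL_mul.
Proof. by move=> A; apply: val_inj; rewrite /= mul1mx. Qed.
Lemma SL_mulg1 : right_id SL_one SL_mul.
Proof. by move=> A; apply: val_inj; rewrite /= mulmx1. Qed.
Lemma SL_mulVg : left_inverse SL_one SL_inv SL_mul.
Proof. by move=> A; apply: val_inj; rewrite /= mulVmx ?SL_unit. Qed.
Lemma SL_mulgV : right_inverse SL_one SL_inv SL_mul.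
Proof. by move=> A; apply: val_inj; rewrite /= mulmxV ?SL_unit. Qed.

HB.instance Definition _ := isGroup.Build SL
  SL_mulA SL_mul1g SL_mulg1 SL_mulVg SL_mulgV.
End SpecialLinearGroup.

Definition subgroup (G : groupType) (H : set G) : Prop :=
  H 1%g /\ forall x y, H x -> H y -> H (x / y)%g.

(* The abstract group G is isomorphic to the subgroup H of G'. *)
Definition isomorphic_to (G G' : groupType) (H : set G') : Prop :=
  exists f : {multiplicative G -> G'}, injective f /\ range f = H.

Section HessianSubgroup.
Variables (F : fieldType) (eps : F).

Definition mx3 (s : seq (seq F)) : 'M[F]_3 := \matrix_(i, j) (nth [::] s i)`_j.

Definition omega : F := -1 - eps ^+ 3.
Definition rho : F := 1 / (omega - omega ^+ 2).

Definition S_mx : 'M[F]_3 :=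
  mx3 [:: [:: 1; 0; 0]; [:: 0; omega; 0]; [:: 0; 0; omega ^+ 2]].
Definition T_mx : 'M[F]_3 :=
  mx3 [:: [:: 0; 1; 0]; [:: 0; 0; 1]; [:: 1; 0; 0]].
Definition U_mx : 'M[F]_3 :=
  mx3 [:: [:: eps; 0; 0]; [:: 0; eps; 0]; [:: 0; 0; eps * omega]].
Definition V_mx : 'M[F]_3 :=
  rho *: mx3 [:: [:: 1; 1; 1]; [:: 1; omega; omega ^+ 2];
                 [:: 1; omega ^+ 2; omega]].

Definition H72_gens : seq 'M[F]_3 :=
  [:: S_mx; T_mx; V_mx; U_mx *m V_mx *m invmx U_mx].

(* By H72_gens_SL below, all four matrices do lie in SL_3. *)
Definition H72_SL3 : set (SL F 3) :=
  smallest (@subgroup (SL F 3)) [set A | slval A \in H72_gens].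

Lemma det_mx3 (a b c d e f g h k : F) :
  \det (mx3 [:: [:: a; b; c]; [:: d; e; f]; [:: g; h; k]])
  = a * (e * k - f * h) - b * (d * k - f * g) + c * (d * h - e * g).
Proof.
rewrite (expand_det_row _ ord0) !big_ord_recl big_ord0 /cofactor.
rewrite !(expand_det_row _ ord0) !big_ord_recl !big_ord0 /cofactor.
rewrite !det_mx11 /= !mxE /=; ring.
Qed.

Hypothesis eps9 : eps ^+ 6 + eps ^+ 3 + 1 = 0.
Hypothesis three : 3%:R != 0 :> F.

Lemma H72_gens_SL : {in H72_gens, forall A, \det A = 1}.
Proof.
have w2 : omega ^+ 2 = -1 - omega.
  by apply/eqP; rewrite -subr_eq0; apply/eqP; rewrite -[RHS]eps9 /omega; ring.
have w3 : omega ^+ 3 = 1 by rewrite exprS w2; ring: w2.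
have d2 : (omega - omega ^+ 2) ^+ 2 = - 3%:R.
  by rewrite w2; ring: w2.
have d0 : omega - omega ^+ 2 != 0.
  by apply: contraNneq three => E; rewrite -oppr_eq0 -d2 E expr0n.
have e0 : eps != 0.
  by apply: contra_eq_neq eps9 => ->; rewrite !expr0n /= !add0r oner_eq0.
have w0 : omega != 0.
  by apply: contra_eq_neq w3 => ->; rewrite expr0n /= eq_sym oner_eq0.
have dV : \det V_mx = 1.
  rewrite detZ det_mx3 /rho.
  have -> : 1 * (omega * omega - omega ^+ 2 * omega ^+ 2)
     - 1 * (1 * omega - omega ^+ 2 * 1) + 1 * (1 * omega ^+ 2 - omega * 1)
     = (omega - omega ^+ 2) ^+ 3 by rewrite w2; ring: w2.
  by rewrite div1r exprVn mulVf ?expf_neq0.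
have uU : U_mx \in unitmx.
  rewrite unitmxE det_mx3 unitfE.
  have -> : eps * (eps * (eps * omega) - 0 * 0) - 0 * (0 * (eps * omega) - 0 * 0)
    + 0 * (0 * 0 - eps * 0) = eps ^+ 3 * omega by ring.
  by rewrite mulf_neq0 ?expf_neq0.
move=> A; rewrite !inE => /or4P[] /eqP->.
- by rewrite det_mx3; ring: w3.
- by rewrite det_mx3; ring.
- exact: dV.
- rewrite !det_mulmx dV mulr1 det_inv divff //.
  by move: uU; rewrite unitmxE unitfE.
Qed.
End HessianSubgroup.

(* Main.v *)
Require Import Defs.
From HB Require Import structures.
From mathcomp Require Import all_boot all_order all_algebra all_field.
From mathcomp Require Import boolp classical_sets functions cardinality reals complex.
From mathcomp Require Import mpoly ring lra zify.

Set Implicit Arguments.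
Unset Strict Implicit.
Unset Printing Implicit Defensive.

(* Let G be the differential Galois group of a hypergeometric equation, acting
   on the solution space C^3, and suppose it is isomorphic to the group of the
   theorem. G is finite, nonabelian, and a linear character chi of G satisfies
   chi^2 = 1, and chi(g) = 1 whenever g^2 = 1. So no g <> 1 fixes a plane of
   solutions: det g^2 = 1 makes g^2 unipotent, hence g^2 = 1 by finiteness, so
   det g = 1 and g itself is unipotent, hence trivial.
   At z = 1 the equation has two independent power series solutions in
   t = z - 1. As G is finite and K = C(z) is its fixed field, the
   Picard-Vessiot field is L = K(x), with x algebraic over K. If the minimal
   polynomial of x has no root in C((t)), adjoin to C((t)) a root of an
   irreducible factor of it: some g <> 1 of G sends this root to another root
   of the factor, and so fixes every solution in C((t)). These contain a
   plane, which is impossible. Hence L embeds into C((t)).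
   Then, for some p, t^p y has no pole at 1 for all solutions y. With
   th = z d/dz, th^k (t^p y) is a combination of y, th y, th^2 y with
   coefficients t^(-k) a_i, where a_i is a polynomial in t of degree at most
   k + p; the absence of poles makes t^(k-N) divide a_i, with N independent of
   k. The quotients have bounded degree, so P(th) (t^p y) = 0 for some nonzero
   polynomial P with constant coefficients. A commutator of G acts trivially on
   eigenlines of th, hence, by induction on the roots of P and by finiteness of
   G, on all solutions. So G is abelian, a contradiction. *)

Import GRing.Theory.
Local Open Scope ring_scope.
Local Notation "x %:F" := (@FracField.tofrac _ x).

(** * The group *)

(** The isomorphism is one of abstract groups, so the matrices of the theorem say nothing about the
    action on solutions; they enter only through properties stable under isomorphism. These come
    from the structure 3^(1+2) : Q8 of the group: linear characters factor through Q8, whose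
    abelianisation has exponent 2 and whose only involution is a commutator. That K is the fixed
    field is proved without any assumption on the group. For a fundamental matrix Y, every
    invertible constant c such that Y c satisfies all relations of Y over K gives an automorphism.
    If x = a(Y)/b(Y) is invariant, x b(YZ) - a(YZ) vanishes at all these c, and the Nullstellensatz
    leads to x in K. The Nullstellensatz is proved by counting, hence the uncountability of the
    constants. The last step replaces topology: with 1 no longer a branch point, the monodromy would
    come from the cyclic fundamental group of the plane minus 0. An equation P(th) (t^p y) = 0 is
    the algebraic form of this, its solutions being combinations of z^r (log z)^k. *)

Section HessianRelations.
Local Open Scope group_scope.
Variables (G : groupType) (s t z v w : G) (a b : nat).
Hypotheses (zs : z * s = s * z) (zt : z * t = t * z).
Hypotheses (zv : z * v = v * z) (zw : z * w = w * z).
Hypotheses (z3 : z ^+ 3 = 1) (s3 : s ^+ 3 = 1) (t3 : t ^+ 3 = 1).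
Hypotheses (v4 : v ^+ 4 = 1) (ts : t * s = z * s * t).
Hypotheses (vs : v * s = t * v) (vt : v * t = s ^+ 2 * v).
Hypotheses (ws : w * s = z ^+ a * s ^+ 2 * t * w).
Hypotheses (wt : w * t = z ^+ b * s * t * w).
Hypotheses (ww : w ^+ 2 = v ^+ 2) (wv : w * v = v ^+ 3 * w) (z1 : z <> 1).
Hypothesis gen : forall P : set G,
  subgroup P -> P s -> P t -> P v -> P w -> forall g, P g.

(** The subgroup generated by s, t and the central z: the Heisenberg group of order 27 in the
    application. Natural exponents suffice because the generators have finite order. *)
Definition heis_form (h : G) := exists i j k, h = z ^+ i * s ^+ j * t ^+ k.
(** The relations between v and w are those of the quaternion group, which normalizes the Heisenberg
    group. *)
Definition normal_form (g : G) :=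
  exists h i j, heis_form h /\ g = h * v ^+ i * w ^+ j.

Lemma zC g x : commute z g -> z ^+ x * g = g * z ^+ x.
Proof. by move=> c; apply/commute_sym/commuteX/commute_sym. Qed.

Lemma tsX j k : t ^+ k * s ^+ j = z ^+ (j * k) * s ^+ j * t ^+ k.
Proof.
have tsj m : t * s ^+ m = z ^+ m * s ^+ m * t.
  elim: m => [|m IH]; first by rewrite !expg0 !mul1g mulg1.
  rewrite expgSr mulgA IH -!mulgA ts !expgSr -!mulgA; congr (_ * _).
  by rewrite [LHS]mulgA [RHS]mulgA; congr (_ * _); apply/commute_sym/commuteX.
elim: k => [|k IH]; first by rewrite muln0 !expg0 !mul1g mulg1.
rewrite expgS -mulgA IH !mulgA -(zC _ zt) -[z ^+ (j * k) * t * _]mulgA tsj.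
by rewrite mulnS addnC expgnDr !mulgA -!mulgA.
Qed.

Lemma heis1 : heis_form 1.
Proof. by exists 0%N, 0%N, 0%N; rewrite !expg0 !mulg1. Qed.

Lemma heisM h k : heis_form h -> heis_form k -> heis_form (h * k).
Proof.
move=> [i [j [l ->]]] [i' [j' [l' ->]]].
exists (i + i' + j' * l)%N, (j + j')%N, (l + l')%N.
have cz x g : commute z g -> commute g (z ^+ x)
    by move=> c; apply/commute_sym/commute_sym; rewrite /commute zC.
have tz x y : t ^+ x * z ^+ y = z ^+ y * t ^+ x.
  by rewrite zC //; apply: commuteX.
have sz x y : s ^+ x * z ^+ y = z ^+ y * s ^+ x.
  by rewrite zC //; apply: commuteX.
rewrite !expgnDr -!mulgA; congr (_ * _).
rewrite [t ^+ l * (z ^+ i' * _)]mulgA tz -!mulgA.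
rewrite [s ^+ j * (z ^+ i' * _)]mulgA sz -!mulgA; congr (_ * _).
rewrite [t ^+ l * (s ^+ j' * _)]mulgA tsX -!mulgA.
by rewrite [s ^+ j * (z ^+ _ * _)]mulgA sz -!mulgA.
Qed.

Lemma heisX h n : heis_form h -> heis_form (h ^+ n).
Proof.
move=> hh; elim: n => [|n IH]; first by rewrite expg0; apply: heis1.
by rewrite expgS; apply: heisM.
Qed.

Lemma heisz : heis_form z.
Proof. by exists 1%N, 0%N, 0%N; rewrite !expg0 expg1 !mulg1. Qed.
Lemma heiss : heis_form s.
Proof. by exists 0%N, 1%N, 0%N; rewrite !expg0 expg1 mul1g mulg1. Qed.
Lemma heist : heis_form t.
Proof. by exists 0%N, 0%N, 1%N; rewrite !expg0 expg1 !mul1g. Qed.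

Definition normalizes (q : G) :=
  forall h, heis_form h -> exists2 h', heis_form h' & q * h = h' * q.

Lemma normalizesM q r : normalizes q -> normalizes r -> normalizes (q * r).
Proof.
move=> nq nr h /nr[h' /nq[h'' hh'' e'] e]; exists h'' => //.
by rewrite -mulgA e mulgA e' mulgA.
Qed.

Lemma normalizesX q n : normalizes q -> normalizes (q ^+ n).
Proof.
move=> nq; elim: n => [|n IH]; last by rewrite expgS; apply: normalizesM.
by move=> h hh; exists h; rewrite // expg0 mul1g mulg1.
Qed.

Lemma normalizes_gens q : commute z q ->
  (exists2 h', heis_form h' & q * s = h' * q) ->
  (exists2 h', heis_form h' & q * t = h' * q) -> normalizes q.
Proof.
move=> zq qs qt.
have qX h n : (exists2 h', heis_form h' & q * h = h' * q) ->
    exists2 h', heis_form h' & q * h ^+ n = h' * q.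
  case=> h' hh' e; exists (h' ^+ n); first exact: heisX.
  elim: n => [|n IH]; first by rewrite !expg0 mul1g mulg1.
  by rewrite expgSr mulgA IH -mulgA e mulgA -expgSr.
have qz : exists2 h', heis_form h' & q * z = h' * q by exists z => //; exact: heisz.
move=> _ [i [j [k ->]]].
have [x hx ex] := qX _ i qz; have [y hy ey] := qX _ j qs.
have [u hu eu] := qX _ k qt.
exists (x * y * u); first by do 2?apply: heisM.
by rewrite !mulgA ex -[x * q * _]mulgA ey -!mulgA eu !mulgA.
Qed.

Lemma normalizes_v : normalizes v.
Proof.
apply: normalizes_gens => //; first by exists t => //; exact: heist.
by exists (s ^+ 2) => //; apply/heisX/heiss.
Qed.

Lemma normalizes_w : normalizes w.
Proof.
apply: normalizes_gens => //.
  exists (z ^+ a * s ^+ 2 * t) => //.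
  by apply: (heisM (heisM (heisX a heisz) (heisX 2 heiss)) heist).
exists (z ^+ b * s * t) => //.
by apply: (heisM (heisM (heisX b heisz) heiss) heist).
Qed.

Lemma wvX i : w * v ^+ i = v ^+ (3 * i) * w.
Proof.
elim: i => [|i IH]; first by rewrite muln0 !expg0 mul1g mulg1.
by rewrite expgS mulgA wv -mulgA IH mulgA -expgnDr mulnS.
Qed.

(** Left multiplication by a generator preserves normal forms: v and w move past the Heisenberg
    part, and [wvX] restores the order of v and w. *)
Lemma normal_formP g : normal_form g.
Proof.
have Nh h x : heis_form h -> normal_form x -> normal_form (h * x).
  move=> hh [h' [i [j [hh' ->]]]]; exists (h * h'), i, j.
  by split; [exact: heisM | rewrite !mulgA].
have Nv x : normal_form x -> normal_form (v * x).
  move=> [h [i [j [hh ->]]]]; have [h' hh' e] := normalizes_v hh.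
  by exists h', i.+1, j; split=> //; rewrite !mulgA e expgS !mulgA.
have Nw x : normal_form x -> normal_form (w * x).
  move=> [h [i [j [hh ->]]]]; have [h' hh' e] := normalizes_w hh.
  exists h', (3 * i)%N, j.+1; split=> //.
  by rewrite !mulgA e -[h' * w * _]mulgA wvX expgS !mulgA.
have NX q n : (forall x, normal_form x -> normal_form (q * x)) ->
    forall x, normal_form x -> normal_form (q ^+ n * x).
  move=> Nq; elim: n => [|n IH] x Nx; first by rewrite expg0 mul1g.
  by rewrite expgS -mulgA; apply/Nq/IH.
have iX (q : G) n : q ^+ n.+1 = 1 -> q^-1 = q ^+ n.
  by move=> q1; apply: mulg1_eq; rewrite -expgS.
(* Asking this of both x and its inverse makes [P] a subgroup, so that [gen] applies. The inverse of
   a generator is a positive power of it, which is how [PX] treats it. *)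
pose P : set G := fun x => forall y, normal_form y ->
  normal_form (x * y) /\ normal_form (x^-1 * y).
have PX q n : q ^+ n.+1 = 1 ->
    (forall x, normal_form x -> normal_form (q * x)) -> P q.
  move=> /iX qi Nq y Ny; split; first exact: Nq.
  by rewrite qi; apply: NX.
have w4 : w ^+ 4 = 1 by rewrite -[4%N]/(2 + 2)%N expgnDr ww -expgnDr v4.
have: P g.
  apply: (gen (P := P)).
  - split=> [y Ny|x y Px Py u Nu]; first by rewrite invg1 !mul1g.
    rewrite /= invgM invgK -!mulgA; split; first by apply: (Px _ _).1; apply: (Py _ Nu).2.
    by apply: (Py _ _).1; apply: (Px _ Nu).2.
  - by apply: PX s3 _ => x; apply/Nh/heiss.
  - by apply: PX t3 _ => x; apply/Nh/heist.
  - exact: PX v4 Nv.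
  - exact: PX w4 Nw.
have N1 : normal_form 1.
  by exists 1, 0%N, 0%N; split; [exact: heis1 | rewrite !expg0 !mulg1].
by move=> /(_ 1 N1)[]; rewrite mulg1.
Qed.

Lemma hessian_finite : exists l : seq G, forall g, g \in l.
Proof.
pose f (x : 'I_3 * 'I_3 * 'I_3 * 'I_4 * 'I_4) :=
  z ^+ x.1.1.1.1 * s ^+ x.1.1.1.2 * t ^+ x.1.1.2 * v ^+ x.1.2 * w ^+ x.2.
have w4 : w ^+ 4 = 1 by rewrite -[4%N]/(2 + 2)%N expgnDr ww -expgnDr v4.
have m (q : G) n k : q ^+ n = 1 -> q ^+ (k %% n) = q ^+ k.
  by move=> q1; rewrite {2}(divn_eq k n) expgnDr mulnC expgnA q1 expg1n mul1g.
exists (map f (enum {: 'I_3 * 'I_3 * 'I_3 * 'I_4 * 'I_4})) => g.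
have [_ [x [y [[i [j [k ->]]] ->]]]] := normal_formP g.
apply/mapP; exists (inord (i %% 3), inord (j %% 3), inord (k %% 3), inord (x %% 4), inord (y %% 4));
  rewrite ?mem_enum //.
by rewrite /f /= !inordK ?ltn_mod // !m.
Qed.

Section Character.
Local Open Scope ring_scope.
Variables (F : fieldType) (chi : G -> F).
Hypotheses (chi1 : chi 1%g = 1) (chiM : forall g h, chi (g * h)%g = chi g * chi h).

Lemma chi_neq0 g : chi g != 0.
Proof.
apply/negP=> /eqP c0; have := chi1.
by rewrite -(mulgV g) chiM c0 mul0r => /eqP; rewrite eq_sym oner_eq0.
Qed.

Lemma chiX g n : chi (g ^+ n)%g = chi g ^+ n.
Proof. by elim: n => [|n IH]; rewrite ?expg0 ?expgS ?exprS ?chiM ?IH. Qed.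

(** z is a commutator, and conjugation by v sends s to t and t to s^2, so chi s = chi t = chi s ^
    2. *)
Lemma chi_heis h : heis_form h -> chi h = 1.
Proof.
have cz : chi z = 1.
  move: (congr1 chi ts); rewrite !chiM => e.
  apply: (mulIf (chi_neq0 s)); apply: (mulIf (chi_neq0 t)).
  by rewrite -e mul1r mulrC.
have cts : chi t = chi s.
  by move: (congr1 chi vs); rewrite !chiM mulrC => /(mulIf (chi_neq0 v)).
have cs : chi s = 1.
  move: (congr1 chi vt); rewrite !chiM mulrC => /(mulIf (chi_neq0 v)).
  rewrite cts -[LHS]mulr1 => /(mulfI (chi_neq0 s)) <- //.
by move=> [i [j [k ->]]]; rewrite !chiM !chiX cts cs cz !expr1n !mulr1.
Qed.

Lemma chi_v : chi v ^+ 2 = 1.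
Proof.
move: (congr1 chi wv); rewrite (chiM w) (chiM (v ^+ 3)%g) chiX mulrC => /(mulIf (chi_neq0 w)).
by rewrite exprS -[LHS]mulr1 => /(mulfI (chi_neq0 v)) <-.
Qed.

Lemma chi_w : chi w ^+ 2 = 1.
Proof. by rewrite -chiX ww chiX chi_v. Qed.

Lemma hessian_character_sq g : chi g ^+ 2 = 1.
Proof.
have [h [i [j [hh ->]]]] := normal_formP g.
rewrite !chiM !chiX chi_heis // mul1r exprMn -!exprM ![(_ * 2)%N]mulnC !exprM.
by rewrite chi_v chi_w !expr1n mulr1.
Qed.

(** v^2 conjugates s to s^2, whereas a Heisenberg element conjugates s to z^k s. Equality would give
    s = z^k, central, and then t s = z s t forces z = 1. *)
Lemma v2_not_heis : ~ heis_form (v ^+ 2)%g.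
Proof.
move=> [i [j [k e]]].
have vvs : (v ^+ 2 * s = s ^+ 2 * v ^+ 2)%g.
  by rewrite expgS expg1 -mulgA vs mulgA vt -mulgA.
have zz x : (z ^+ x * s = s * z ^+ x)%g by rewrite zC.
have e2 : (v ^+ 2 * s = z ^+ k * s * v ^+ 2)%g.
  rewrite e -!mulgA -[s in (t ^+ k * s)%g]expg1 tsX mul1n expg1.
  rewrite -!mulgA [(s ^+ j * (z ^+ k * _))%g]mulgA.
  rewrite -[(s ^+ j * z ^+ k)%g]zC; last exact: commuteX.
  rewrite !mulgA -expgnDr addnC expgnDr -!mulgA; congr (_ * _)%g.
  rewrite [(s * (z ^+ i * _))%g]mulgA -zz -!mulgA; congr (_ * _)%g.
  by rewrite !mulgA -expgSr -expgS.
move: e2; rewrite vvs => /mulIg; rewrite expgS expg1 => /mulIg sz.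
apply: z1; move: ts; rewrite {1}sz -(zC _ zt) -sz.
by rewrite -[LHS]mul1g -!mulgA => /mulIg.
Qed.

(** Modulo the Heisenberg group g becomes an element of the quaternion group of square 1, hence 1 or
    v^2, and chi is trivial on both. *)
Lemma hessian_character_involution g : (g ^+ 2)%g = 1%g -> chi g = 1.
Proof.
have [h [i [j [hh eg]]]] := normal_formP g.
have w2X n : (w ^+ (n.*2) = v ^+ (n.*2))%g.
  by rewrite -mul2n !expgnA ww.
have v4X n : (v ^+ (4 * n) = 1)%g by rewrite expgnA v4 expg1n.
(* Since w^2 = v^2, even powers of w are absorbed into the power of v. *)
have [i' [j' [j1 {}eg]]] : exists i' j', (j' <= 1)%N /\ g = (h * v ^+ i' * w ^+ j')%g.
  exists (i + (j./2).*2)%N, (odd j : nat); split; first by case: (odd j).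
  rewrite eg -{1}(odd_double_half j) addnC expgnDr w2X expgnDr !mulgA //.
pose q := (v ^+ i' * w ^+ j')%g.
have [h' hh' e'] : exists2 h', heis_form h' & (q * h = h' * q)%g.
  by apply: normalizesM hh; apply: normalizesX; [exact: normalizes_v | exact: normalizes_w].
have gq : g = (h * q)%g by rewrite eg mulgA.
have g2 : (g ^+ 2 = h * h' * q ^+ 2)%g.
  by rewrite gq !expg2 mulgA -[(h * q * h)%g]mulgA e' !mulgA.
(* q^2 = v^2 would put v^2 in the Heisenberg group. Odd powers of v and all v^i w have square v^2,
   so only even powers of v remain. *)
have nq : (g ^+ 2 = 1 -> q ^+ 2 = v ^+ 2 -> False)%g.
  rewrite g2 => e q2; apply: v2_not_heis.
  suff -> : (v ^+ 2 = h * h')%g by apply: heisM.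
  by rewrite -[LHS]mul1g -e q2 -mulgA -expgnDr v4 mulg1.
move=> g21; case: (posnP j') => [j0|j0].
  have: ~~ odd i'.
    apply/negP=> oi; apply: nq => //; rewrite /q j0 expg0 mulg1 -expgnA.
    rewrite -(odd_double_half i') oi -muln2 mulnDl -mulnA expgnDr.
    by rewrite [(_ * (2 * 2))%N]mulnC v4X mulg1.
  move=> /even_halfK ei.
  rewrite eg j0 -ei !chiM !chiX chi_heis // mul1r expr0 mulr1 -muln2 mulnC exprM.
  by rewrite chi_v expr1n.
case: nq => //; have {}j1 : j' = 1%N by lia.
rewrite /q j1 expg1 expg2 -!mulgA [(w * (v ^+ _ * _))%g]mulgA wvX -!mulgA.
rewrite -[(w * w)%g]expg2 ww !mulgA -expgnDr (_ : i' + 3 * i' = 4 * i')%N; last lia.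
by rewrite v4X mul1g.
Qed.
End Character.
End HessianRelations.

(** * Verification of the relations on matrices *)

Section HessianMatrices.
Variables (F : fieldType) (eps : F).
Hypotheses (eps9 : eps ^+ 6 + eps ^+ 3 + 1 = 0) (three : 3%:R != 0 :> F).
Local Notation w := (omega eps).
Local Notation r := (rho eps).

Definition m9 (a b c d e f g h k : F) : 'M[F]_3 :=
  mx3 [:: [:: a; b; c]; [:: d; e; f]; [:: g; h; k]].

Lemma S_mxE : S_mx eps = m9 1 0 0 0 w 0 0 0 (w ^+ 2). Proof. by []. Qed.
Lemma T_mxE : T_mx F = m9 0 1 0 0 0 1 1 0 0. Proof. by []. Qed.
Lemma U_mxE : U_mx eps = m9 eps 0 0 0 eps 0 0 0 (eps * w). Proof. by []. Qed.
Lemma V_mxE : V_mx eps = r *: m9 1 1 1 1 w (w ^+ 2) 1 (w ^+ 2) w. Proof. by []. Qed.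

Lemma mul_mx3 (a b c d e f g h k a' b' c' d' e' f' g' h' k' : F) :
  m9 a b c d e f g h k *m m9 a' b' c' d' e' f' g' h' k' =
  m9 (a * a' + b * d' + c * g') (a * b' + b * e' + c * h') (a * c' + b * f' + c * k')
     (d * a' + e * d' + f * g') (d * b' + e * e' + f * h') (d * c' + e * f' + f * k')
     (g * a' + h * d' + k * g') (g * b' + h * e' + k * h') (g * c' + h * f' + k * k').
Proof.
apply/matrixP=> i j; rewrite !mxE !big_ord_recl big_ord0 !mxE /= addr0 addrA.
by case: i => [[|[|[|//]]] ?]; case: j => [[|[|[|//]]] ?].
Qed.

Lemma scale_mx3 (x a b c d e f g h k : F) : x *: m9 a b c d e f g h k =
  m9 (x * a) (x * b) (x * c) (x * d) (x * e) (x * f) (x * g) (x * h) (x * k).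
Proof.
apply/matrixP=> i j; rewrite !mxE.
by case: i => [[|[|[|//]]] ?]; case: j => [[|[|[|//]]] ?].
Qed.

Lemma eq_mx3 (a b c d e f g h k a' b' c' d' e' f' g' h' k' : F) :
  a = a' -> b = b' -> c = c' -> d = d' -> e = e' -> f = f' ->
  g = g' -> h = h' -> k = k' ->
  m9 a b c d e f g h k = m9 a' b' c' d' e' f' g' h' k'.
Proof. by do 9!move=> ->. Qed.

Lemma omega2 : w ^+ 2 = -1 - w.
Proof. by apply/eqP; rewrite -subr_eq0; apply/eqP; rewrite -[RHS]eps9 /omega; ring. Qed.

Lemma omega_neq1 : w != 1.
Proof.
apply: contraNneq three => e; move: omega2; rewrite e expr1n => /eqP.
by rewrite -subr_eq0 (_ : 1 - (-1 - 1) = 3%:R) //; ring.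
Qed.

Lemma rho2 : r ^+ 2 * 3%:R = -1.
Proof.
have d2 : (w - w ^+ 2) ^+ 2 = - 3%:R by rewrite omega2; ring: omega2.
have d0 : (w - w ^+ 2) ^+ 2 != 0 by rewrite d2 oppr_eq0.
by rewrite /rho div1r exprVn -[3%:R]opprK -d2 mulrN mulVf.
Qed.

Lemma mx3_1 : 1%:M = m9 1 0 0 0 1 0 0 0 1 :> 'M[F]_3.
Proof.
apply/matrixP=> i j; rewrite !mxE.
by case: i => [[|[|[|//]]] ?]; case: j => [[|[|[|//]]] ?].
Qed.

(** The conjugate of V by U: the third row of V is multiplied and the third column divided by omega,
    while eps cancels. *)
Definition W_mx : 'M[F]_3 :=
  r *: m9 1 1 (w ^+ 2) 1 w w w 1 w.

Lemma W_mxE : U_mx eps *m V_mx eps *m invmx (U_mx eps) = W_mx.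
Proof.
have e0 : eps != 0.
  by apply: contra_eq_neq eps9 => ->; rewrite !expr0n /= !add0r oner_eq0.
have w0 : w != 0.
  by apply: contra_eq_neq omega2 => ->; rewrite expr0n subr0 eq_sym oppr_eq0 oner_eq0.
have uU : U_mx eps \in unitmx.
  rewrite unitmxE det_mx3 unitfE (_ : _ + _ = eps ^+ 3 * w); last ring.
  by rewrite mulf_neq0 ?expf_neq0.
rewrite -[RHS](mulmxK uU); congr (_ *m _).
rewrite /W_mx V_mxE U_mxE -scalemxAl -scalemxAr; congr (_ *: _).
by rewrite !mul_mx3; apply: eq_mx3; ring: omega2.
Qed.

Lemma V_mx2 : V_mx eps *m V_mx eps = m9 (-1) 0 0 0 0 (-1) 0 (-1) 0.
Proof.
rewrite V_mxE -scalemxAl -scalemxAr scalerA -expr2 mul_mx3 scale_mx3 -rho2.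
by apply: eq_mx3; ring: omega2.
Qed.

End HessianMatrices.

Section HessianGroup.
Variables (F : fieldType) (eps : F).
Hypotheses (eps9 : eps ^+ 6 + eps ^+ 3 + 1 = 0) (three : 3%:R != 0 :> F).
Variable G : groupType.
Hypothesis iso : isomorphic_to G (H72_SL3 eps).

(** [M] is injective and multiplicative, so every relation can be checked on explicit matrices. *)
Lemma iso_hessian_relations : exists (s t z v w : G) (a b : nat),
  ([/\ z * s = s * z, z * t = t * z, z * v = v * z & z * w = w * z] /\
   [/\ s ^+ 3 = 1, t ^+ 3 = 1, v ^+ 4 = 1 & t * s = z * s * t] /\
   [/\ v * s = t * v, v * t = s ^+ 2 * v, w * s = z ^+ a * s ^+ 2 * t * w
     & w * t = z ^+ b * s * t * w] /\
   [/\ w ^+ 2 = v ^+ 2, w * v = v ^+ 3 * w, z ^+ 3 = 1 & z <> 1])%g /\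
  forall P : set G, subgroup P -> P s -> P t -> P v -> P w -> forall g, P g.
Proof.
case: iso => f [finj frange].
pose M (g : G) : 'M[F]_3 := slval (f g).
have MI g h : M g = M h -> g = h by move=> e; apply/finj/val_inj.
have MM g h : M (g * h)%g = M g *m M h by rewrite /M gmulfM.
have M1 : M 1%g = 1%:M.
  have e : (f 1 * f 1 = f 1)%g by rewrite -gmulfM mulg1.
  by rewrite /M -[f 1%g]mulg1 -(mulgV (f 1%g)) mulgA e mulgV.
have preim A : A \in H72_gens eps -> exists g, M g = A.
  move=> Ag; have dA : \det A == 1 by apply/eqP/(H72_gens_SL eps9 three).
  suff: range f (MkSL dA) by case=> g _ e; exists g; rewrite /M e.
  by rewrite frange => H [_ HA]; apply: HA.
have [s Ms] := preim (S_mx eps) ltac:(by rewrite !inE eqxx).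
have [t Mt] := preim (T_mx F) ltac:(by rewrite !inE eqxx orbT).
have [v Mv] := preim (V_mx eps) ltac:(by rewrite !inE eqxx !orbT).
have [w' Mw'] : exists g, M g = U_mx eps *m V_mx eps *m invmx (U_mx eps).
  by apply: preim; rewrite !inE eqxx !orbT.
rewrite W_mxE // in Mw'.
rewrite S_mxE in Ms; rewrite T_mxE in Mt.
have [w wE] : exists w, w = (s * t * w')%g by exists (s * t * w')%g.
have [z zE] : exists z, (z * s * t = t * s)%g by exists (t * s / t / s)%g; rewrite !mulgVK.
have w2 := omega2 eps9.
have Mz : M z = (omega eps)%:M.
  have e : M z *m (M s *m M t) = omega eps *: (M s *m M t).
    rewrite -!MM mulgA zE !MM Ms Mt !mul_mx3 scale_mx3.
    by apply: eq_mx3; ring: w2.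
  have uu : M s *m M t \in unitmx by rewrite -MM /M SL_unit.
  by rewrite -[LHS](mulmxK uu) e -scalemxAl mulmxV // scalemx1.
have Mw : M w = rho eps *: m9 1 (omega eps) (omega eps) (omega eps ^+ 2)
    (omega eps) (omega eps ^+ 2) (omega eps ^+ 2) (omega eps ^+ 2) (omega eps).
  rewrite wE !MM Ms Mt Mw' /W_mx -scalemxAr !mul_mx3; congr (_ *: _).
  by apply: eq_mx3; ring: w2.
have Mv2 : M (v ^+ 2)%g = m9 (-1) 0 0 0 0 (-1) 0 (-1) 0.
  by rewrite expg2 MM Mv V_mx2.
rewrite V_mxE in Mv.
have Mz' : M z = m9 (omega eps) 0 0 0 (omega eps) 0 0 0 (omega eps).
  by rewrite Mz -[LHS]mulmx1 mul_scalar_mx mx3_1 scale_mx3 !mulr0 !mulr1.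
have zC g : (z * g = g * z)%g by apply: MI; rewrite !MM Mz scalar_mxC.
exists s, t, z, v, w, 1%N, 2%N; split.
  split; [by split | split; [|split]].
  - split; apply: MI.
    + by rewrite !expgS expg0 mulg1 !MM M1 Ms !mul_mx3 mx3_1; apply: eq_mx3; ring: w2.
    + by rewrite !expgS expg0 mulg1 !MM M1 Mt !mul_mx3 mx3_1; apply: eq_mx3; ring: w2.
    + rewrite -[4%N]/(2 + 2)%N expgnDr MM Mv2 M1 mul_mx3 mx3_1.
      by apply: eq_mx3; ring: w2.
    + by rewrite zE.
  - split; apply: MI.
    + rewrite !MM Mv Mt Ms -scalemxAl -scalemxAr !mul_mx3; congr (_ *: _).
      by apply: eq_mx3; ring: w2.
    + rewrite expg2 !MM Mv Mt Ms -scalemxAl -scalemxAr !mul_mx3; congr (_ *: _).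
      by apply: eq_mx3; ring: w2.
    + rewrite expg1 expg2 !MM Mz' Mw Mt Ms -scalemxAl -scalemxAr !mul_mx3; congr (_ *: _).
      by apply: eq_mx3; ring: w2.
    + rewrite expg2 !MM Mz' Mw Mt Ms -scalemxAl -scalemxAr !mul_mx3; congr (_ *: _).
      by apply: eq_mx3; ring: w2.
  - split.
    + apply: MI; rewrite Mv2 expg2 !MM Mw -scalemxAl -scalemxAr scalerA -expr2.
      by rewrite mul_mx3 scale_mx3 -(rho2 eps9 three); apply: eq_mx3; ring: w2.
    + apply: MI; rewrite expgSr (MM w) (MM (v ^+ 2 * v)%g) (MM (v ^+ 2)%g) Mv2 Mw Mv.
      rewrite -!(scalemxAl, scalemxAr) !mul_mx3.
      by rewrite ?scalerA; congr (_ *: _); apply: eq_mx3; ring: w2.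
    + apply: MI; rewrite !expgS expg0 mulg1 !MM M1 Mz' !mul_mx3 mx3_1.
      by apply: eq_mx3; ring: w2.
    + move=> z1; move/eqP: (omega_neq1 eps9 three); apply.
      by move: Mz; rewrite z1 M1 => /matrixP/(_ 0 0); rewrite !mxE /= !mulr1n.
move=> P [P1 PD] Ps Pt Pv Pw g.
have PV x : P x -> P x^-1%g by move=> Px; rewrite -[x^-1%g]mul1g; apply: PD.
have PM x y : P x -> P y -> P (x * y)%g.
  by move=> Px Py; rewrite -[y]invgK; apply: PD => //; apply: PV.
have : range f (f g) by exists g.
(* The image of [P] under [f] is a subgroup containing the four generating matrices, hence contains
   the smallest such subgroup. *)
rewrite frange => /(_ [set x | exists2 h, P h & f h = x]%classic)[|h Ph /finj <- //].
split.
  split=> [|_ _ [x Px <-] [y Py <-]].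
    by exists 1%g => //; apply: val_inj; rewrite /= -M1.
  exists (x / y)%g; first exact: PD.
  have : (f (x / y) * f y = f x)%g by rewrite -gmulfM mulgVK.
  by move=> <-; rewrite mulgK.
move=> A; rewrite /= !inE => /or4P[] /eqP eA.
- by exists s => //; apply: val_inj; exact: etrans Ms (esym eA).
- by exists t => //; apply: val_inj; exact: etrans Mt (esym eA).
- by exists v => //; apply: val_inj; exact: etrans Mv (esym eA).
exists w'; last first.
  by apply: val_inj; apply: (etrans Mw'); rewrite -W_mxE //; exact: esym eA.
have -> : w' = ((s * t)^-1 * w)%g by rewrite wE mulKg.
by apply: (PM) => //; apply: PV; apply: PM.
Qed.

(** The invariants of the abstract group on which the rest of the proof relies. *)
Lemma hessian_group_facts :
  [/\ exists l : seq G, forall g, g \in l,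
      exists s t : G, (t * s)%g <> (s * t)%g
    & forall (E : fieldType) (chi : G -> E), chi 1%g = 1 ->
        (forall g h, chi (g * h)%g = chi g * chi h) ->
        forall g, chi g ^+ 2 = 1 /\ ((g ^+ 2)%g = 1%g -> chi g = 1)].
Proof.
have [s [t [z [v [w [a [b [rel gen]]]]]]]] := iso_hessian_relations.
case: rel => -[zs zt zv zw] [[s3 t3 v4 ts] [[vs vt ws wt] [ww wv z3 z1]]].
split.
- exact: (hessian_finite zs zt zv zw z3 s3 t3 v4 ts vs vt ws wt ww wv gen).
- exists s, t => st; apply: z1; move: ts; rewrite st -mulgA.
  by rewrite -[LHS]mul1g => /mulIg.
move=> E chi chi1 chiM g; split.
  exact: (hessian_character_sq zs zt zv zw s3 t3 v4 ts vs vt ws wt ww wv gen chi1 chiM).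
exact: (hessian_character_involution zs zt zv zw s3 t3 v4 ts vs vt ws wt ww wv z1 gen chi1 chiM).
Qed.
End HessianGroup.

(** * The fixed field of the differential Galois group *)

(** Take r minimal. A nonzero relation b v = 0 over k yields the projector X = 1 - v u with b X = b
    and rank less than r, and factoring X through its rank contradicts minimality. *)
Lemma exists_basis (k L : fieldType) (iota : {rmorphism k -> L}) m (a : 'rV[L]_m) :
  exists r (b : 'rV[L]_r) (Q : 'M[k]_(r, m)), a = b *m map_mx iota Q /\
    forall v : 'cV[k]_r, b *m map_mx iota v = 0 -> v = 0.
Proof.
pose P r := `[< exists (b : 'rV[L]_r) (Q : 'M[k]_(r, m)), a = b *m map_mx iota Q >].
have exP : exists r, P r.
  by exists m; apply/asboolP; exists a, 1%:M; rewrite map_mx1 mulmx1.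
case: (ex_minnP exP) => r /asboolP[b [Q abQ]] rmin.
exists r, b, Q; split=> // v bv; apply/eqP; apply: contraT => /cV0Pn[i vi].
pose u : 'rV[k]_r := (v i 0)^-1 *: delta_mx 0 i.
have uv : u *m v = 1%:M.
  by rewrite /u -scalemxAl -rowE; apply/matrixP=> x y; rewrite !ord1 !mxE eqxx mulVf.
pose X := 1%:M - v *m u.
have Xv : X *m v = 0 by rewrite mulmxBl mul1mx -mulmxA uv mulmx1 subrr.
have bX : b = b *m map_mx iota X.
  by rewrite map_mxB map_mx1 map_mxM mulmxBr mulmx1 mulmxA bv mul0mx subr0.
have rX : (\rank X < r)%N.
  rewrite ltn_neqAle rank_leq_row andbT; apply: contraNneq vi => fX.
  have uX : X \in unitmx by rewrite -row_full_unit /row_full fX.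
  by rewrite -[v](mulKmx uX) Xv mulmx0 mxE.
suff: P (\rank X) by move=> /rmin; rewrite leqNgt rX.
apply/asboolP; exists (b *m map_mx iota (col_base X)), (row_base X *m Q).
by rewrite abQ {1}bX -{1}(mulmx_base X) !map_mxM !mulmxA.
Qed.

Section Descent.
Variables (L : fieldType) (d : L -> L).
Hypotheses (dB : {morph d : x y / x - y}) (dM : forall x y, d (x * y) = d x * y + x * d y).
Variables (r : nat) (N : 'rV[L]_r -> Prop).
Hypotheses (ND : forall u v, N u -> N v -> N (u + v)).
Hypotheses (NZ : forall a v, N v -> N (a *: v)) (Nd : forall v, N v -> N (map_mx d v)).

Lemma derivation0 : d 0 = 0. Proof. by have := dB 0 0; rewrite !subrr. Qed.

Lemma derivation1 : d 1 = 0.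
Proof.
have := dM 1 1; rewrite !mulr1 mul1r => /eqP.
by rewrite -subr_eq0 opprD addNKr oppr_eq0 => /eqP.
Qed.

Let supp (v : 'rV[L]_r) := [set i | v 0 i != 0].

(** Scale l so that one coordinate is 1. The derivative of that vector lies in N and has smaller
    support; either it vanishes, or induction applies to it. *)
Lemma exists_constant_vector l : N l -> l != 0 ->
  exists c, [/\ N c, c != 0, map_mx d c = 0 & forall i, l 0 i = 0 -> c 0 i = 0].
Proof.
have [n] := ubnP #|supp l|; elim: n l => // n IH l /ltnSE ln Nl l0.
have /rV0Pn[i li] := l0.
pose l1 := (l 0 i)^-1 *: l.
have l1s j : l 0 j = 0 -> l1 0 j = 0 by move=> lj; rewrite mxE lj mulr0.
have Nl1 : N l1 by apply: NZ.
have [dl1|dl1] := eqVneq (map_mx d l1) 0.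
  by exists l1; split=> //; rewrite scaler_eq0 negb_or invr_neq0.
have l1i : map_mx d l1 0 i = 0 by rewrite !mxE mulVf // derivation1.
have dl1s j : l 0 j = 0 -> map_mx d l1 0 j = 0.
  by move=> lj; rewrite mxE l1s // derivation0.
have [|c [Nc c0 dc cs]] := IH (map_mx d l1) _ (Nd Nl1) dl1.
  apply: leq_trans ln; apply/proper_card/properP; split.
    by apply/fintype.subsetP=> j; rewrite !inE; apply: contraNneq => /dl1s ->.
  by exists i; rewrite inE // l1i eqxx.
by exists c; split=> // j /dl1s/cs.
Qed.

(** A subspace stable under the derivation is spanned by its constant vectors: subtracting a
    multiple of a constant vector supported within l removes a coordinate of l. *)
Lemma descent_ind (Q : 'rV[L]_r -> Prop) : Q 0 ->
  (forall u v, Q u -> Q v -> Q (u + v)) -> (forall a v, Q v -> Q (a *: v)) ->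
  (forall c, N c -> map_mx d c = 0 -> Q c) -> forall l, N l -> Q l.
Proof.
move=> Q0 QD QZ Qc l; have [n] := ubnP #|supp l|.
elim: n l => // n IH l /ltnSE ln Nl.
have [->//|l0] := eqVneq l 0.
have [c [Nc c0 dc cs]] := exists_constant_vector Nl l0.
have /rV0Pn[i ci] := c0.
pose a := l 0 i / c 0 i.
rewrite -[l](subrK (a *: c)); apply: QD; last exact/QZ/Qc.
apply: IH; last by rewrite -scaleNr; apply/ND/NZ.
apply: leq_trans ln; apply/proper_card/properP; split.
  apply/fintype.subsetP=> j; rewrite !inE; apply: contraNneq => lj.
  by rewrite !mxE lj cs // mulr0 subr0.
exists i; first by rewrite inE; apply: contraNneq ci => /cs ->.
by rewrite inE !mxE /a divfK // subrr eqxx.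
Qed.
End Descent.

(** N is the number of monomials of degree less than d. It depends on n and d only, not on the
    polynomials. *)
Lemma mpoly_bounded_dependent (k : fieldType) n d : exists N : nat,
  forall g : 'I_N.+1 -> {mpoly k[n]}, (forall i, (msize (g i) <= d)%N) ->
  exists2 mu : 'I_N.+1 -> k, (exists i, mu i != 0) & \sum_i mu i *: g i = 0.
Proof.
pose T : finType := 'X_{1..n < d}; exists #|T| => g gd.
pose A : 'M[k]_(#|T|.+1, #|T|) :=
  \matrix_(i, j) (g i)@_(bmnm (enum_val (A := T) j)).
have kA : kermx A != 0.
  rewrite -mxrank_eq0 mxrank_ker -lt0n subn_gt0 ltnS.
  exact: rank_leq_col.
have [i0 ki0] : exists i, row i (kermx A) != 0.
  by apply/existsP; apply: contraR kA; rewrite negb_exists => /forallP h;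
     apply/eqP/row_matrixP=> i; rewrite row0; apply/eqP; have := h i; rewrite negbK.
have kr : row i0 (kermx A) *m A = 0 by rewrite -row_mul mulmx_ker row0.
exists (fun i => row i0 (kermx A) 0 i).
  by apply/rV0Pn.
apply/mpolyP => m; rewrite mcoeff0 raddf_sum /=.
under eq_bigr => i _ do rewrite mcoeffZ.
have [md|md] := ltnP (mdeg m) d.
  pose j := enum_rank (BMultinom md : T).
  have := congr1 (fun B : 'rV[k]_#|T| => B 0 j) kr; rewrite !mxE => e.
  rewrite -[RHS]e; apply: eq_bigr => i _.
  by rewrite [A i j]mxE enum_rankK.
apply: big1 => i _; rewrite memN_msupp_eq0 ?mulr0 //.
apply: contraTN md => /msize_mdeg_lt mg; rewrite -ltnNge.
exact: leq_trans mg (gd i).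
Qed.

Local Open Scope classical_set_scope.

(** The form in which uncountability is used: any map to the natural numbers has a fibre with
    arbitrarily many elements. *)
Definition large_fibers (C : Type) := forall f : C -> nat, exists n,
  forall N, exists2 s : 'I_N -> C, injective s & forall i, f (s i) = n.

(** * Nullstellensatz over an uncountable algebraically closed field *)

Section Nullstellensatz.
Variables (C : closedFieldType) (m : nat).
Hypothesis Cfib : large_fibers C.
Local Notation P := {mpoly C[m]}.

Definition is_ideal (R : comNzRingType) (J : set R) :=
  [/\ J 0, forall a b, J a -> J b -> J (a + b) & forall a b, J b -> J (a * b)].

(** Zorn's lemma gives an ideal I maximal among those containing J and no power of u. For a outside
    I, the larger ideal I + (a) must then contain a power of u. *)
Lemma maximal_avoiding (R : comNzRingType) (J : set R) (u : R) :
  is_ideal J -> (forall n, ~ J (u ^+ n)) ->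
  exists I : set R, [/\ is_ideal I, J `<=` I, forall n, ~ I (u ^+ n)
    & forall a, ~ I a -> exists n g, I (u ^+ n - g * a)].
Proof.
move=> [J0 JD JM] Ju.
(* The condition bears on the union with J, so that the union of the empty chain satisfies it. *)
pose Pr (X : set R) := is_ideal (J `|` X) /\ forall n, ~ (J `|` X) (u ^+ n).
have [|A [[[A0 AD AM] Au] Amax]] := @Zorn_bigcup R Pr.
  move=> F FP Ftot; split; last first.
    move=> n [/Ju//|[X FX Xu]]; have [_ /(_ n)] := FP X FX.
    by apply; right.
  split; first by left.
  - move=> a b [Ja|[X FX Xa]] [Jb|[Y FY Yb]].
    + by left; apply: JD.
    + have [[_ h _] _] := FP Y FY; have [] := h a b; [by left|by right|by left|].
      by move=> ?; right; exists Y.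
    + have [[_ h _] _] := FP X FX; have [] := h a b; [by right|by left|by left|].
      by move=> ?; right; exists X.
    + have [XY|YX] := Ftot _ _ FX FY.
        have [[_ h _] _] := FP Y FY; have [] := h a b; [by right; apply: XY|by right|by left|].
        by move=> ?; right; exists Y.
      have [[_ h _] _] := FP X FX; have [] := h a b; [by right|by right; apply: YX|by left|].
      by move=> ?; right; exists X.
  - move=> a b [Jb|[X FX Xb]]; first by left; apply: JM.
    have [[_ _ h] _] := FP X FX; have [] := h a b; [by right|by left|].
    by move=> ?; right; exists X.
exists (J `|` A); split=> // a Aa.
pose B : set R := [set x | exists2 y, (J `|` A) y & exists g, x = y + g * a].
have AB x : (J `|` A) x -> B x.
  by move=> Ax; exists x => //; exists 0; rewrite mul0r addr0.
have : ~ Pr B.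
  apply: Amax; split; first by move=> x Ax; apply: AB; right.
  move=> BA; apply: Aa; right; apply: BA.
  by exists 0 => //; exists 1; rewrite mul1r add0r.
have JB : J `|` B = B.
  by apply/seteqP; split=> x; [case=> // Jx; apply: AB; left | right].
rewrite /Pr JB; apply: contra_notP => h; split.
  split; first exact: AB.
  - move=> _ _ [x Ax [g ->]] [y Ay [h' ->]]; exists (x + y); first exact: AD.
    by exists (g + h'); ring.
  - move=> b _ [y Ay [g ->]]; exists (b * y); first exact: AM.
    by exists (b * g); ring.
move=> n [y Ay [g e]]; apply: h; exists n, g.
by rewrite e addrK.
Qed.

(** I is prime, and it suffices that each X_k is congruent to a constant modulo I. Otherwise every
    X_k - c divides a power of u modulo I. Infinitely many c share the exponent and the degree of
    the cofactor, so some cofactors are linearly dependent, which gives a nonzero one-variable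
    polynomial in X_k inside I. It splits over C, and primality puts some X_k - c in I. *)
Lemma nullstellensatz (J : set P) (u : P) : is_ideal J ->
  (forall n, ~ J (u ^+ n)) ->
  exists c : 'I_m -> C, (forall q, J q -> q.@[c] = 0) /\ u.@[c] != 0.
Proof.
move=> Jid Ju.
have [I [[I0 ID IM] JI Iu Imax]] := maximal_avoiding Jid Ju.
have IN a : I a -> I (- a) by rewrite -mulN1r; apply: (IM).
have I1 : ~ I 1 by move: (Iu 0%N); rewrite expr0.
have Iprime a b : I (a * b) -> I a \/ I b.
  move=> Iab; apply: contrapT => /not_orP[/Imax[n [g Ig]] /Imax[n' [g' Ig']]].
  apply: (Iu (n + n')%N); rewrite exprD.
  rewrite (_ : _ * _ = u ^+ n' * (u ^+ n - g * a)
     + (g * a) * (u ^+ n' - g' * b) + (g * g') * (a * b)); last ring.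
  by apply: (ID); [apply: (ID)|]; apply: (IM).
have coord k : exists c : C, I ('X_k - c%:MP).
  apply: contrapT => /forallNP noc.
  have /choice[ng hng] : forall c, exists ng : nat * P, I (u ^+ ng.1 - ng.2 * ('X_k - c%:MP)).
    by move=> c; have [n [g ?]] := Imax _ (noc c); exists (n, g).
  (* [pickle] encodes the pair of exponent and size as one number, so that one fibre fixes both. *)
  have [n fibn] := Cfib (fun c => pickle ((ng c).1, msize (ng c).2)).
  have [[n0 d] nd] : exists nd : nat * nat, forall N, exists2 s : 'I_N -> C,
      injective s & forall i, (ng (s i)).1 = nd.1 /\ msize (ng (s i)).2 = nd.2.
    have [s1 _ s1n] := fibn 1%N; exists ((ng (s1 0)).1, msize (ng (s1 0)).2) => N.
    have [s sI sn] := fibn N; exists s => // i.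
    by have := sn i; rewrite -(s1n 0) => /(pcan_inj pickleK)[-> ->].
  have [N dep] := mpoly_bounded_dependent C m d.
  have [s sI sn] := nd N.+1.
  have [|mu [i0 mui0] mug] := dep (fun i => (ng (s i)).2).
    by move=> i; have [_ ->] := sn i.
  (* The numerator of the sum of mu_i / (X - s_i). It is nonzero because only the term of i0
     survives at s_i0. *)
  pose Q : {poly C} := \sum_i mu i *: \prod_(j | j != i) ('X - (s j)%:P).
  pose ev (q : {poly C}) : P := (map_poly (@mpolyC m C) q).['X_k].
  have evE q : ev q = horner_morph (f := @mpolyC m C) (fun x => mulrC ('X_k : P) x%:MP) q by [].
  have evM p q : ev (p * q) = ev p * ev q by rewrite !evE rmorphM.
  have evS (F : 'I_N.+1 -> {poly C}) : ev (\sum_i F i) = \sum_i ev (F i).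
    by rewrite evE raddf_sum.
  have evX c : ev ('X - c%:P) = 'X_k - c%:MP.
    by rewrite evE rmorphB /= horner_morphX horner_morphC.
  have evZ c q : ev (c *: q) = c *: ev q.
    by rewrite !evE -mul_polyC rmorphM /= horner_morphC mul_mpolyC.
  have Q0 : Q != 0.
    apply/eqP => /(congr1 (fun q => q.[s i0])); rewrite horner0 horner_sum.
    rewrite (bigD1 i0) //= [X in _ + X]big1 => [|i ii0]; last first.
      rewrite hornerZ horner_prod (bigD1 i0) 1?eq_sym //=.
      by rewrite hornerXsubC subrr mul0r mulr0.
    rewrite addr0 hornerZ horner_prod => /eqP; rewrite mulf_eq0 (negbTE mui0) /=.
    apply/negP/prodf_neq0 => j ji; rewrite hornerXsubC subr_eq0.
    by apply: contra ji => /eqP/sI ->.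
  have IQ : I (u ^+ n0 * ev Q).
    have -> : u ^+ n0 * ev Q = \sum_i (mu i *: ev (\prod_(j | j != i) ('X - (s j)%:P)))
         * (u ^+ n0 - (ng (s i)).2 * ('X_k - (s i)%:MP)).
      under [RHS]eq_bigr => i _ do rewrite mulrBr.
      rewrite sumrB [X in _ = _ - X](_ : _ = 0) ?subr0.
        rewrite -mulr_suml mulrC; congr (_ * _).
        by rewrite evS; apply: eq_bigr => i _; rewrite evZ.
      transitivity ((\sum_i mu i *: (ng (s i)).2) * ev (\prod_j ('X - (s j)%:P)));
        last by rewrite mug mul0r.
      rewrite mulr_suml; apply: eq_bigr => i _.
      rewrite [\prod_j _](bigD1 i) //= evM evX.
      by rewrite -!scalerAl; congr (_ *: _); ring.
    elim/big_ind: _ => // i _; apply: (IM).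
    by have := hng (s i); have [-> _] := sn i.
  case: (Iprime _ _ IQ) => [/Iu //|].
  have [rs ->] := closed_field_poly_normal Q.
  rewrite evZ -mul_mpolyC => /Iprime[Ic|].
    apply: I1; have := IM (lead_coef Q)^-1%:MP _ Ic.
    by rewrite -mpolyCM mulVf ?mpolyC1 // lead_coef_eq0.
  elim: rs => [|c rs IH]; first by rewrite big_nil evE rmorph1.
  by rewrite big_cons evM evX => /Iprime[/noc|/IH].
have [c hc] := choice coord.
have Iev q : I (q - (q.@[c])%:MP).
  have IM' a b : I (a - (a.@[c])%:MP) -> I (b - (b.@[c])%:MP) ->
      I (a * b - ((a * b).@[c])%:MP).
    move=> Ia Ib; rewrite mevalM mpolyCM.
    rewrite (_ : _ - _ = b * (a - (a.@[c])%:MP) + (a.@[c])%:MP * (b - (b.@[c])%:MP)); last ring.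
    by apply: (ID); apply: (IM).
  have Ic' x : I (x%:MP - ((x%:MP).@[c])%:MP) by rewrite mevalC subrr.
  elim/mpolyind: q => [|x mn q _ _ Iq]; first by rewrite meval0 mpolyC0 subr0.
  rewrite mevalD mpolyCD opprD addrACA; apply: (ID) => //.
  rewrite -mul_mpolyC; apply: (IM'); first exact: Ic'.
  rewrite mpolyXE_id; elim/big_rec: _ => [|i a _ Ia]; first exact: Ic'.
  apply: (IM' _ _ _ Ia); elim: (mn i) => [|e IHe]; first by rewrite expr0; exact: Ic'.
  by rewrite exprS; apply: (IM') => //; rewrite mevalXU.
exists c; split=> [q /JI Iq|].
  apply/eqP; apply: contraT => q0; case: I1.
  have := IM ((q.@[c])^-1)%:MP _ (ID _ _ Iq (IN _ (Iev q))).
  by rewrite opprB addrC subrK -mpolyCM mulVf.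
apply/eqP => u0; apply: (Iu 1%N); rewrite expr1.
by have := Iev u; rewrite u0 mpolyC0 subr0.
Qed.
End Nullstellensatz.

(** * Derivations, coefficientwise derivation and generic matrices *)

Section DerivationFacts.
Variable K : diffFieldType.
Implicit Types x y : K.

Lemma der0 : der (0 : K) = 0.
Proof. by apply: (addIr (der 0)); rewrite -derD !add0r. Qed.

Lemma derN x : der (- x) = - der x.
Proof. by apply/eqP; rewrite -subr_eq0 opprK -derD addNr der0. Qed.

Lemma derB : {morph (@der K) : x y / x - y}.
Proof. by move=> x y; rewrite derD derN. Qed.

HB.instance Definition _ := GRing.isZmodMorphism.Build K K (@der K) derB.

Lemma der1 : der (1 : K) = 0.
Proof. exact: (derivation1 (@derM K)). Qed.

Lemma derV x : der x^-1 = - der x / x ^+ 2.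
Proof.
have [->|x0] := eqVneq x 0; first by rewrite invr0 der0 oppr0 mul0r.
have := derM x x^-1; rewrite divff // der1 => /esym/eqP.
rewrite addr_eq0 => /eqP e; apply: (mulfI x0).
by rewrite -[LHS]opprK -e; field.
Qed.

Lemma der_div x y : y != 0 -> der (x / y) = (der x * y - x * der y) / y ^+ 2.
Proof. by move=> y0; rewrite derM derV; field. Qed.

Lemma der_mulmx (m n p : nat) (A : 'M[K]_(m, n)) (B : 'M[K]_(n, p)) :
  map_mx (@der K) (A *m B) = map_mx (@der K) A *m B + A *m map_mx (@der K) B.
Proof.
apply/matrixP=> i j; rewrite !mxE raddf_sum -big_split; apply: eq_bigr => h _.
by rewrite /= !mxE derM.
Qed.
End DerivationFacts.

Lemma mpoly_ring_ind m (R : comNzRingType) (Q : {mpoly R[m]} -> Prop) :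
  (forall c, Q c%:MP) -> (forall k, Q 'X_k) ->
  (forall p q, Q p -> Q q -> Q (p + q)) -> (forall p q, Q p -> Q q -> Q (p * q)) ->
  forall p, Q p.
Proof.
move=> Qc QX QD QM; elim/mpolyind=> [|c mn p _ _ Qp]; first by rewrite -mpolyC0.
rewrite -mul_mpolyC; apply: (QD) => //; apply: (QM) => //.
rewrite mpolyXE_id; elim/big_rec: _ => [|i a _ Ia]; first by rewrite -mpolyC1.
apply: (QM) => //; elim: (mn i) => [|e IHe]; first by rewrite expr0 -mpolyC1.
by rewrite exprS; apply: (QM).
Qed.

Section CoefficientDerivation.
Variables (L : diffFieldType) (m : nat).
Local Notation ML := {mpoly L[m]}.

(** The extension of the derivation to L[Z] with Z' = 0: the indeterminates stand for the entries of
    a constant matrix. *)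
Definition dcoef (p : ML) : ML := \sum_(mn <- msupp p) der p@_mn *: 'X_[mn].

Lemma mcoeff_dcoef p mn : (dcoef p)@_mn = der p@_mn.
Proof.
rewrite raddf_sum /=; have [pm|pm] := boolP (mn \in msupp p).
  rewrite (big_rem _ pm) /= mcoeffZ mcoeffX eqxx mulr1 big_seq big1 ?addr0 // => k.
  rewrite mcoeffZ mcoeffX mem_rem_uniq ?msupp_uniq // !inE => /andP[/negbTE -> _].
  by rewrite mulr0.
rewrite memN_msupp_eq0 // der0 big_seq big1 // => k kp.
by rewrite mcoeffZ mcoeffX; case: eqP kp pm => [-> -> //|]; rewrite mulr0.
Qed.

Lemma dcoefD p q : dcoef (p + q) = dcoef p + dcoef q.
Proof. by apply/mpolyP=> k; rewrite mcoeffD !mcoeff_dcoef mcoeffD derD. Qed.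

Lemma dcoefM p q : dcoef (p * q) = dcoef p * q + p * dcoef q.
Proof.
apply/mpolyP=> k; rewrite mcoeff_dcoef mcoeffD !mcoeffM raddf_sum -big_split.
by apply: eq_bigr => h _; rewrite /= !mcoeff_dcoef derM.
Qed.

Lemma dcoefC c : dcoef c%:MP = (der c)%:MP.
Proof.
apply/mpolyP=> k; rewrite mcoeff_dcoef !mcoeffC.
by case: (_ == _); rewrite ?mulr1 ?mulr0 ?der0.
Qed.

Lemma dcoefX k : dcoef 'X_k = 0.
Proof.
apply/mpolyP=> h; rewrite mcoeff_dcoef mcoeff0 mcoeffX.
by case: (_ == _); rewrite ?der0 ?der1.
Qed.

Lemma dcoef0 : dcoef 0 = 0.
Proof. by rewrite -mpolyC0 dcoefC der0 mpolyC0. Qed.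

Lemma dcoef_sum (I : Type) (s : seq I) (F : I -> ML) :
  dcoef (\sum_(i <- s) F i) = \sum_(i <- s) dcoef (F i).
Proof. by elim/big_rec2: _ => [|i a b _ <-]; rewrite ?dcoef0 ?dcoefD. Qed.

Lemma dcoefZ c p : dcoef (c *: p) = der c *: p + c *: dcoef p.
Proof. by rewrite -!mul_mpolyC dcoefM dcoefC. Qed.
End CoefficientDerivation.

Section GenericMatrix.
Variables (R : comNzRingType) (n : nat).
Definition gen_mx : 'M[{mpoly R[n * n]}]_n := \matrix_(i, j) 'X_(mxvec_index i j).

Definition evmx (c : 'M[R]_n) (p : {mpoly R[n * n]}) : R := p.@[mxvec c 0].

HB.instance Definition _ c := GRing.RMorphism.copy (evmx c) (meval (mxvec c 0)).

Lemma evmxC c x : evmx c x%:MP = x. Proof. exact: mevalC. Qed.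
Lemma evmxZ c x p : evmx c (x *: p) = x * evmx c p. Proof. exact: mevalZ. Qed.

Lemma evmxD c : {morph evmx c : p q / p + q}. Proof. exact: rmorphD. Qed.
Lemma evmxM c : {morph evmx c : p q / p * q}. Proof. exact: rmorphM. Qed.
Lemma evmxN c p : evmx c (- p) = - evmx c p. Proof. exact: rmorphN. Qed.
Lemma evmx0 c : evmx c 0 = 0. Proof. exact: rmorph0. Qed.
Lemma evmx_sum c (I : Type) (s : seq I) (F : I -> {mpoly R[n * n]}) :
  evmx c (\sum_(i <- s) F i) = \sum_(i <- s) evmx c (F i).
Proof. exact: rmorph_sum. Qed.

Lemma evmx_gen c : map_mx (evmx c) gen_mx = c.
Proof. by apply/matrixP=> i j; rewrite !mxE /evmx mevalXU mxvecE. Qed.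
End GenericMatrix.
Arguments gen_mx {R n}.

Lemma mxvec_ind n (P : 'I_(n * n) -> Prop) :
  (forall i j, P (mxvec_index i j)) -> forall k, P k.
Proof. by move=> h k; case: (mxvec_indexP k). Qed.

Lemma subf_div (F : fieldType) (f g f' g' : F) : g != 0 -> g' != 0 ->
  f / g - f' / g' = (f * g' - f' * g) / (g * g').
Proof. by move=> g0 g'0; rewrite -mulNr addf_div // mulNr. Qed.

Lemma divf_div (F : fieldType) (f g f' g' : F) : f / g / (f' / g') = (f * g') / (g * f').
Proof. by rewrite invf_div mulf_div. Qed.

Section SubstitutionAutomorphism.
Variables (K L : diffFieldType) (iota : {rmorphism K -> L}) (R : comNzRingType).
Variables v w : {rmorphism R -> L}.
Hypothesis vw0 : forall f, w f = 0 <-> v f = 0.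
Hypothesis vw_der : forall f, exists g, der (v f) = v g /\ der (w f) = w g.
Hypothesis vw_iota : forall a, exists f, v f = iota a /\ w f = iota a.
Hypothesis v_gen : forall P : set L, diff_subfield P -> (forall f, P (v f)) -> forall x, P x.
Hypothesis w_gen : forall P : set L, diff_subfield P -> (forall f, P (w f)) -> forall x, P x.

Lemma exists_fraction x : exists fg : R * R, v fg.2 != 0 /\ x = v fg.1 / v fg.2.
Proof.
pose P : set L := fun x => exists fg : R * R, v fg.2 != 0 /\ x = v fg.1 / v fg.2.
apply: (v_gen (P := P)) => {x} [|f]; last first.
  by exists (f, 1); rewrite /= rmorph1 divr1 oner_eq0.
split.
- by exists (1, 1); rewrite /= !rmorph1 divr1 oner_eq0.
- move=> _ _ [[f g] /= [g0 ->]] [[f' g'] /= [g'0 ->]].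
  exists (f * g' - f' * g, g * g'); rewrite /= rmorphB !rmorphM.
  by split; [rewrite mulf_neq0 | rewrite subf_div].
- move=> _ _ [[f g] /= [g0 ->]] [[f' g'] /= [g'0 ->]].
  (* [diff_subfield] also demands closure under division by 0, whose value is 0. *)
  have [f'0|f'0] := eqVneq (v f') 0.
    by exists (0, 1); rewrite /= f'0 rmorph1 rmorph0 oner_eq0 !mul0r invr0 mulr0.
  exists (f * g', g * f'); rewrite /= !rmorphM.
  by split; [rewrite mulf_neq0 | rewrite divf_div].
move=> _ [[f g] /= [g0 ->]].
have [f' [df _]] := vw_der f; have [g' [dg _]] := vw_der g.
exists (f' * g - f * g', g * g); rewrite /= rmorphB !rmorphM.
by split; [rewrite mulf_neq0 | rewrite (der_div _ g0) df dg expr2].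
Qed.

(** L consists of fractions of values of v. As v and w have the same kernel, sending v f / v g to w
    f / w g is well defined and injective; its image is a differential subfield containing the
    values of w, hence all of L. *)
Lemma exists_substitution_automorphism : exists s : diffGal iota, forall f, s (v f) = w f.
Proof.
have [F FP] := choice exists_fraction.
have w0 g : v g != 0 -> w g != 0 by apply: contra => /eqP/vw0 ->.
pose s x := w (F x).1 / w (F x).2.
have sE f g : v g != 0 -> s (v f / v g) = w f / w g.
  move=> g0; rewrite /s; have [] := FP (v f / v g).
  move: (F _) => [f' g'] /= g'0 /eqP; rewrite eqr_div // => /eqP e.
  apply/eqP; rewrite eqr_div ?w0 //.
  have /vw0 : v (f * g' - f' * g) = 0 by rewrite rmorphB !rmorphM e subrr.
  by rewrite rmorphB !rmorphM => /eqP; rewrite subr_eq0 => /eqP ->.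
have sV f : s (v f) = w f.
  by have := sE f 1; rewrite !rmorph1 !divr1; apply; exact: oner_neq0.
have sM x y : s (x * y) = s x * s y.
  have [x0 ->] := FP x; have [y0 ->] := FP y.
  by rewrite mulf_div -!rmorphM !sE ?rmorphM ?mulf_neq0 // mulf_div.
have sB : zmod_morphism s.
  move=> x y; have [x0 ->] := FP x; have [y0 ->] := FP y.
  rewrite (subf_div _ _ x0 y0) -!rmorphM -rmorphB !sE ?rmorphM ?mulf_neq0 //.
  by rewrite rmorphB !rmorphM subf_div ?w0.
have s1 : s 1 = 1 by rewrite -{1}(rmorph1 v) sV rmorph1.
have s0 x : s x = 0 -> x = 0.
  move=> sx0; apply/eqP; apply: contraT => x0.
  by have := sM x x^-1; rewrite divff // sx0 mul0r s1 => /eqP; rewrite oner_eq0.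
have sI : injective s.
  by move=> x y e; apply/eqP; rewrite -subr_eq0; apply/eqP/s0; rewrite sB e subrr.
have si a : s (iota a) = iota a by have [f [<- {2}<-]] := vw_iota a; rewrite sV.
have sd : {morph s : x / der x}.
  move=> x; have [x0 ->] := FP x.
  set f := (F x).1; set g := (F x).2; rewrite -/g in x0.
  have [f' [df df']] := vw_der f; have [g' [dg dg']] := vw_der g.
  rewrite (sE _ _ x0) (der_div _ x0) (der_div _ (w0 _ x0)) df dg df' dg'.
  by rewrite !expr2 -!rmorphM -!rmorphB sE ?rmorphM ?mulf_neq0.
have ssurj : forall y, exists x, s x = y.
  apply: w_gen => [|f]; last by exists (v f).
  split.
  - by exists 1.
  - by move=> _ _ [x <-] [y <-]; exists (x - y).
  - move=> _ _ [x <-] [y <-]; exists (x / y); rewrite sM; congr (_ * _).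
    have [->|y0] := eqVneq y 0.
      have s00 : s 0 = 0 by rewrite -(subrr 1) sB s1 subrr.
      by rewrite invr0 s00 invr0.
    have sy0 : s y != 0 by apply: contra y0 => /eqP/s0 ->.
    by apply: (mulfI sy0); rewrite -sM !divff.
  - by move=> _ [x <-]; exists (der x).
have [t st] := choice ssurj.
have sP : is_diffaut iota s.
  by split=> //; exists t => // x; apply: sI; rewrite st.
by exists (DiffGal sP).
Qed.
End SubstitutionAutomorphism.

(** * Relations of a fundamental matrix and the automorphisms they define *)

Section FixedField.
Variables (C : closedFieldType) (K L : diffFieldType).
Variables (iota : {rmorphism K -> L}) (cK : {rmorphism C -> K}).
Hypothesis iota_der : {morph iota : a / der a}.
Hypothesis cK_der : forall c, der (cK c) = 0.
Hypothesis L_const : forall x : L, der x = 0 -> exists c, x = iota (cK c).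
Variable n' : nat.
Local Notation n := n'.+1.
Variables (Y : 'M[L]_n) (A : 'M[K]_n).
Hypothesis uY : Y \in unitmx.
Hypothesis derY : map_mx der Y = map_mx iota A *m Y.
Hypothesis Lgen : forall P : set L, diff_subfield P -> (forall a, P (iota a)) ->
  (forall i j, P (Y i j)) -> forall x, P x.

Local Notation MK := {mpoly K[n * n]}.
Local Notation ML := {mpoly L[n * n]}.
Local Notation MC := {mpoly C[n * n]}.
Let cL : {rmorphism C -> L} := iota \o cK.

Let mono m (R S : comNzRingType) (f : {rmorphism R -> S}) : {rmorphism R -> {mpoly S[m]}} :=
  @mpolyC m S \o f.
Let liftMx (B : 'M[L]_n) : 'M[ML]_n := map_mx (@mpolyC (n * n) L) B.

(* [emb f] is [f(Y Z)], with [Z] the matrix of indeterminates over [L]. *)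
Definition emb (f : MK) : ML :=
  mmap (mono (n * n) iota) (mxvec (liftMx Y *m gen_mx) 0) f.
Definition back (p : ML) : ML :=
  mmap (@mpolyC (n * n) L) (mxvec (liftMx (invmx Y) *m gen_mx) 0) p.

HB.instance Definition _ := GRing.RMorphism.copy emb
  (mmap (mono (n * n) iota) (mxvec (liftMx Y *m gen_mx) 0)).
HB.instance Definition _ := GRing.RMorphism.copy back
  (mmap (@mpolyC (n * n) L) (mxvec (liftMx (invmx Y) *m gen_mx) 0)).

Lemma embC c : emb c%:MP = (iota c)%:MP. Proof. exact: mmapC. Qed.
Lemma backC c : back c%:MP = c%:MP. Proof. exact: mmapC. Qed.

Lemma embM : {morph emb : f g / f * g}. Proof. exact: rmorphM. Qed.
Lemma embD : {morph emb : f g / f + g}. Proof. exact: rmorphD. Qed.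

Lemma emb0 : emb 0 = 0. Proof. exact: rmorph0. Qed.

Lemma emb_sum (I : Type) (s : seq I) (F : I -> MK) :
  emb (\sum_(i <- s) F i) = \sum_(i <- s) emb (F i).
Proof. exact: rmorph_sum. Qed.

Lemma emb_gen : map_mx emb gen_mx = liftMx Y *m gen_mx.
Proof. by apply/matrixP=> i j; rewrite mxE [gen_mx i j]mxE /emb mmapX mmap1U mxvecE. Qed.

Lemma back_gen : map_mx back gen_mx = liftMx (invmx Y) *m gen_mx.
Proof. by apply/matrixP=> i j; rewrite mxE [gen_mx i j]mxE /back mmapX mmap1U mxvecE. Qed.

Lemma back_lift B : map_mx back (liftMx B) = liftMx B.
Proof. by apply/matrixP=> i j; rewrite !mxE backC. Qed.

Lemma liftMxM B D : liftMx (B *m D) = liftMx B *m liftMx D.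
Proof. exact: map_mxM. Qed.

Lemma back_emb f : back (emb f) = map_mpoly iota f.
Proof.
elim/mpoly_ring_ind: f => [c|k|p q IHp IHq|p q IHp IHq].
- by rewrite embC backC map_mpolyC.
- elim/mxvec_ind: k => i j.
  have -> : 'X_(mxvec_index i j) = gen_mx i j :> MK by rewrite mxE.
  have := congr1 (map_mx back) emb_gen.
  rewrite map_mxM back_gen back_lift mulmxA -liftMxM mulmxV // [liftMx 1%:M]map_mx1 mul1mx.
  by move=> /matrixP/(_ i j); rewrite !mxE => ->; rewrite map_mpolyX.
- by rewrite !rmorphD /= IHp IHq.
- by rewrite !rmorphM /= IHp IHq.
Qed.

Definition rel_ideal : set MK := [set f | evmx 1%:M (emb f) = 0].
(** Its zeros among constant matrices c are those for which Y c satisfies every relation of Y over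
    K. *)
Definition ext_ideal : set ML := [set p | exists s : seq (L * MK),
  (forall x, x \in s -> rel_ideal x.2) /\ p = \sum_(x <- s) x.1 *: emb x.2].
(** The equations with constant coefficients among these; their invertible zeros are to be the
    Galois group, seen inside GL_n(C). *)
Definition const_ideal : set MC := [set u | ext_ideal (map_mpoly cL u)].

Lemma ext_ideal0 : ext_ideal 0.
Proof. by exists [::]; split=> //; rewrite big_nil. Qed.

Lemma ext_idealD p q : ext_ideal p -> ext_ideal q -> ext_ideal (p + q).
Proof.
move=> [s [sI ->]] [s' [s'I ->]]; exists (s ++ s'); split; last by rewrite big_cat.
by move=> x; rewrite mem_cat => /orP[/sI|/s'I].
Qed.

Lemma ext_idealZ a p : ext_ideal p -> ext_ideal (a *: p).
Proof.
move=> [s [sI ->]]; exists [seq (a * x.1, x.2) | x <- s]; split.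
  by move=> _ /mapP[x /sI xI ->].
by rewrite big_map scaler_sumr; apply: eq_bigr => x _; rewrite scalerA.
Qed.

Lemma ext_ideal_sum (T : Type) (s : seq T) (F : T -> ML) :
  (forall i, ext_ideal (F i)) -> ext_ideal (\sum_(i <- s) F i).
Proof.
by move=> h; elim/big_ind: _ => //; [exact: ext_ideal0 | exact: ext_idealD].
Qed.

Lemma ext_ideal_emb f : rel_ideal f -> ext_ideal (emb f).
Proof.
move=> If; exists [:: (1, f)]; split; last by rewrite big_seq1 scale1r.
by move=> x; rewrite inE => /eqP ->.
Qed.

(** Multiplication by [emb g] preserves the span of the relations, and Z = Y^-1 (YZ) expresses the
    indeterminates linearly through the image of [emb]. *)
Lemma ext_idealM q p : ext_ideal p -> ext_ideal (q * p).
Proof.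
have embM g p' : ext_ideal p' -> ext_ideal (emb g * p').
  move=> [s [sI ->]]; exists [seq (x.1, g * x.2) | x <- s]; split.
    by move=> _ /mapP[x /sI xI ->]; rewrite /rel_ideal /= rmorphM rmorphM /= xI mulr0.
  rewrite big_map mulr_sumr; apply: eq_bigr => x _.
  by rewrite rmorphM -scalerAr.
elim/mpoly_ring_ind: q p => [c|k|q r IHq IHr|q r IHq IHr] p Ip.
- by rewrite mul_mpolyC; apply: ext_idealZ.
- elim/mxvec_ind: k => i j.
  have -> : 'X_(mxvec_index i j) = gen_mx i j :> ML by rewrite mxE.
  have -> : gen_mx = liftMx (invmx Y) *m map_mx emb gen_mx.
    by rewrite emb_gen mulmxA -liftMxM mulVmx // [liftMx 1%:M]map_mx1 mul1mx.
  rewrite mxE mulr_suml; apply: ext_ideal_sum => h.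
  by rewrite [liftMx _ _ _]mxE [map_mx emb _ _ _]mxE -mulrA mul_mpolyC; apply/ext_idealZ/embM.
- by rewrite mulrDl; apply: ext_idealD; [apply: IHq | apply: IHr].
- by rewrite -mulrA; apply/IHq/IHr.
Qed.

(** As Z is constant, (YZ)' = A (YZ): the derivation on the image of [emb] is the one of K[X] with
    X' = A X. *)
Lemma dcoef_emb f : exists g, dcoef (emb f) = emb g.
Proof.
elim/mpoly_ring_ind: f => [c|k|p q [p' ep] [q' eq]|p q [p' ep] [q' eq]].
- by exists (der c)%:MP; rewrite !embC dcoefC iota_der.
- elim/mxvec_ind: k => i j.
  exists ((map_mx (@mpolyC (n * n) K) A *m gen_mx) i j).
  have -> : 'X_(mxvec_index i j) = gen_mx i j :> MK by rewrite mxE.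
  have /matrixP/(_ i j) := emb_gen; rewrite mxE => ->.
  rewrite mxE dcoef_sum mxE emb_sum.
  under eq_bigr => h _ do rewrite dcoefM [dcoef (gen_mx _ _)](_ : _ = 0) ?mulr0 ?addr0 ?mxE ?dcoefX //
    dcoefC.
  transitivity ((liftMx (map_mx der Y) *m gen_mx) i j).
    by rewrite mxE; apply: eq_bigr => h _; rewrite !mxE.
  rewrite derY liftMxM -mulmxA -emb_gen mxE; apply: eq_bigr => h _.
  by rewrite embM !mxE embC.
- by exists (p' + q'); rewrite !embD dcoefD ep eq.
- by exists (p' * q + p * q'); rewrite embD !embM dcoefM ep eq.
Qed.

Lemma der_evmx (c : 'M[C]_n) p :
  der (evmx (map_mx cL c) p) = evmx (map_mx cL c) (dcoef p).
Proof.
elim/mpoly_ring_ind: p => [a|k|p q IHp IHq|p q IHp IHq].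
- by rewrite dcoefC !evmxC.
- elim/mxvec_ind: k => i j; rewrite dcoefX /evmx mevalXU mxvecE meval0 mxE.
  by rewrite /= -iota_der cK_der rmorph0.
- by rewrite rmorphD derD dcoefD rmorphD IHp IHq.
- by rewrite rmorphM derM dcoefM rmorphD !rmorphM IHp IHq.
Qed.

Lemma cL1 : 1%:M = map_mx cL (1%:M : 'M[C]_n).
Proof. by rewrite map_mx1. Qed.

Lemma rel_ideal_dcoef f g : rel_ideal f -> dcoef (emb f) = emb g -> rel_ideal g.
Proof. by rewrite /rel_ideal /= => f0 <-; rewrite cL1 -der_evmx -cL1 f0 der0. Qed.

Lemma ext_ideal_dcoef p : ext_ideal p -> ext_ideal (dcoef p).
Proof.
move=> [s [sI ->]]; rewrite dcoef_sum; rewrite big_seq.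
elim/big_ind: _ => [||x /sI xI]; [exact: ext_ideal0 | exact: ext_idealD |].
have [g eg] := dcoef_emb x.2; rewrite dcoefZ eg.
apply: ext_idealD; apply/ext_idealZ/ext_ideal_emb; first exact: xI.
exact: rel_ideal_dcoef xI eg.
Qed.

Lemma const_ideal_is_ideal : is_ideal const_ideal.
Proof.
split=> [|a b|a b]; rewrite /const_ideal /=.
- by rewrite rmorph0; apply: ext_ideal0.
- by rewrite rmorphD; apply: ext_idealD.
- by rewrite rmorphM; apply: ext_idealM.
Qed.

Definition zero_of_ideal (c : 'M[C]_n) := forall u, const_ideal u -> evmx c u = 0.

Lemma evmx_map (c : 'M[C]_n) u : evmx (map_mx cL c) (map_mpoly cL u) = cL (evmx c u).
Proof.
elim/mpoly_ring_ind: u => [a|k|p q IHp IHq|p q IHp IHq].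
- by rewrite map_mpolyC !evmxC.
- elim/mxvec_ind: k => i j; rewrite map_mpolyX.
  by rewrite /evmx !mevalXU !mxvecE mxE.
- by rewrite !rmorphD; congr (_ + _); [exact: IHp | exact: IHq].
- by rewrite !rmorphM; congr (_ * _); [exact: IHp | exact: IHq].
Qed.

(** [ext_ideal] is stable under [dcoef], so by descent it is spanned over L by its members with
    constant coefficients, and these come from [const_ideal]. *)
Lemma ext_ideal_zero c p : zero_of_ideal c -> ext_ideal p -> evmx (map_mx cL c) p = 0.
Proof.
move=> c0 Ip; set s := msupp p.
(* Fixing the monomials of p reduces the descent to a space of finite dimension. *)
pose comb (l : 'rV[L]_(size s)) : ML := \sum_i l 0 i *: 'X_[tnth (in_tuple s) i].
have pE : p = comb (\row_i p@_(tnth (in_tuple s) i)).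
  rewrite {1}[p]mpolyE -/s big_tnth; apply: eq_bigr => i _.
  by rewrite mxE.
move: Ip; rewrite pE; move: (\row_i _) => l.
have combD u v : comb (u + v) = comb u + comb v.
  by rewrite /comb -big_split; apply: eq_bigr => i _; rewrite mxE scalerDl.
have combZ a u : comb (a *: u) = a *: comb u.
  by rewrite /comb scaler_sumr; apply: eq_bigr => i _; rewrite mxE scalerA.
have comb0 : comb 0 = 0 by rewrite -[0](scale0r 0) combZ scale0r.
apply: (descent_ind (d := @der L) (@derB L) (@derM L)
  (N := fun l => ext_ideal (comb l)) _ _ _
  (Q := fun l => evmx (map_mx cL c) (comb l) = 0)) => [u v|a v|v|||a v|v].
- by rewrite combD; apply: ext_idealD.
- by rewrite combZ; apply: ext_idealZ.
- move=> /ext_ideal_dcoef; rewrite /comb dcoef_sum.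
  under eq_bigr => i _.
    rewrite dcoefZ (_ : dcoef 'X_[_] = 0) ?scaler0 ?addr0; first over.
    apply/mpolyP=> k; rewrite mcoeff_dcoef mcoeffX mcoeff0.
    by case: (_ == _); rewrite ?der1 ?der0.
  by under [X in _ -> ext_ideal X]eq_bigr => i _ do rewrite mxE.
- by rewrite comb0 evmx0.
- by move=> u v; rewrite combD evmxD => -> ->; rewrite addr0.
- by rewrite combZ evmxZ => ->; rewrite mulr0.
move=> Iv dv.
have /choice[a av] : forall i, exists a, v 0 i = cL a.
  by move=> i; apply: L_const; have /matrixP/(_ 0 i) := dv; rewrite !mxE.
have cvE : comb v = map_mpoly cL (\sum_i a i *: 'X_[tnth (in_tuple s) i]).
  rewrite rmorph_sum; apply: eq_bigr => i _; rewrite av.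
  by rewrite [RHS]map_mpolyZ map_mpolyX.
by move: Iv; rewrite cvE => Iu; rewrite evmx_map (c0 _ Iu) rmorph0.
Qed.

Definition eval_at (M : 'M[L]_n) (f : MK) : L := evmx M (emb f).

Lemma eval_atE M f : eval_at M f = evmx M (emb f). Proof. by []. Qed.

HB.instance Definition _ M := GRing.RMorphism.copy (eval_at M) (evmx M \o emb).

Lemma eval_atD M : {morph eval_at M : f g / f + g}.
Proof. by move=> f g; rewrite !eval_atE embD evmxD. Qed.
Lemma eval_atM M : {morph eval_at M : f g / f * g}.
Proof. by move=> f g; rewrite !eval_atE embM evmxM. Qed.
Lemma eval_at0 M : eval_at M 0 = 0. Proof. by rewrite eval_atE emb0 evmx0. Qed.
Lemma eval_atC M a : eval_at M a%:MP = iota a. Proof. by rewrite eval_atE embC evmxC. Qed.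
Lemma eval_atZ M a f : eval_at M (a *: f) = iota a * eval_at M f.
Proof. by rewrite -mul_mpolyC eval_atM eval_atC. Qed.
Lemma eval_at_sum M (I : Type) (s : seq I) (F : I -> MK) :
  eval_at M (\sum_(i <- s) F i) = \sum_(i <- s) eval_at M (F i).
Proof. by rewrite eval_atE emb_sum evmx_sum; apply: eq_bigr => i _; rewrite eval_atE. Qed.

Lemma eval_at_gen M : map_mx (eval_at M) gen_mx = Y *m M.
Proof.
have -> : map_mx (eval_at M) gen_mx = map_mx (evmx M) (map_mx emb gen_mx).
  by apply/matrixP=> i j; rewrite mxE eval_atE !mxE.
rewrite emb_gen map_mxM evmx_gen; congr (_ *m _).
by apply/matrixP=> i j; rewrite mxE [liftMx _ _ _]mxE; exact: evmxC.
Qed.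

Lemma der_val f : exists g, forall c : 'M[C]_n,
  der (eval_at (map_mx cL c) f) = eval_at (map_mx cL c) g.
Proof.
by have [g eg] := dcoef_emb f; exists g => c; rewrite !eval_atE der_evmx eg.
Qed.

Definition rmul_subst (B : 'M[C]_n) (f : MK) : MK :=
  mmap (@mpolyC (n * n) K)
    (mxvec (gen_mx *m map_mx (mono (n * n) cK) B) 0) f.

HB.instance Definition _ B := GRing.RMorphism.copy (rmul_subst B)
  (mmap (@mpolyC (n * n) K) (mxvec (gen_mx *m map_mx (mono (n * n) cK) B) 0)).

Lemma eval_at_rmul_subst M B f : eval_at M (rmul_subst B f) = eval_at (M *m map_mx cL B) f.
Proof.
elim/mpoly_ring_ind: f => [c|k|p q IHp IHq|p q IHp IHq].
- by rewrite [rmul_subst _ _]mmapC !eval_atC.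
- elim/mxvec_ind: k => i j; rewrite [rmul_subst _ _]mmapX mmap1U mxvecE.
  have -> : 'X_(mxvec_index i j) = gen_mx i j :> MK by rewrite mxE.
  have /matrixP/(_ i j) := eval_at_gen (M *m map_mx cL B).
  rewrite mulmxA -eval_at_gen mxE => ->; rewrite mxE eval_at_sum.
  rewrite mxE; apply: eq_bigr => h _.
  by rewrite eval_atM ![map_mx _ _ _ _]mxE; congr (_ * _); apply: eval_atC.
- by rewrite [rmul_subst _ _]rmorphD !eval_atD; congr (_ + _).
- by rewrite [rmul_subst _ _]rmorphM !eval_atM; congr (_ * _).
Qed.

Lemma msizeM_le (R : idomainType) m (p q : {mpoly R[m]}) d e :
  (msize p <= d.+1)%N -> (msize q <= e.+1)%N -> (msize (p * q) <= (d + e).+1)%N.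
Proof.
have [->|p0] := eqVneq p 0; first by rewrite mul0r msize0.
have [->|q0] := eqVneq q 0; first by rewrite mulr0 msize0.
by rewrite msizeM // => ? ?; lia.
Qed.

Lemma msize_sum_le (R : idomainType) m (I : eqType) (s : seq I) (F : I -> {mpoly R[m]}) d :
  (forall i, i \in s -> (msize (F i) <= d)%N) -> (msize (\sum_(i <- s) F i) <= d)%N.
Proof.
move=> Fd; rewrite big_seq; elim/big_ind: _ => [|p q pd qd|//]; first by rewrite msize0.
by apply: leq_trans (msizeD_le _ _) _; rewrite geq_max pd qd.
Qed.

(** Linear forms are substituted for the indeterminates. What counts is a bound independent of B,
    hence valid for all powers of a matrix. *)
Lemma msize_rmul_subst B f : (msize (rmul_subst B f) <= (msize f).+1)%N.
Proof.
apply: msize_sum_le => mn mf; rewrite mul_mpolyC.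
apply: leq_trans (msizeZ_le _ _) _.
apply: (@leq_trans (mdeg mn).+1); last by apply: ltnW; rewrite ltnS msize_mdeg_lt.
rewrite /mmap1 mdegE; elim/big_rec2: _ => [|k d p _ pd]; first by rewrite msize1.
apply: msizeM_le => //; elim: (mn k) => [|e IH]; first by rewrite expr0 msize1.
rewrite exprS -[e.+2]/(1 + e).+1; apply: msizeM_le => //.
elim/mxvec_ind: k {p d pd IH} => i j; rewrite mxvecE mxE.
apply: msize_sum_le => h _; rewrite !mxE mulrC mul_mpolyC.
by apply: leq_trans (msizeZ_le _ _) _; rewrite msizeX mdeg1.
Qed.

Section PointAutomorphism.
Variable c : 'M[C]_n.
Hypotheses (cJ : zero_of_ideal c) (uc : c \in unitmx).
Local Notation cc := (map_mx cL c).

Lemma rel_ideal_val_point f : rel_ideal f -> eval_at cc f = 0.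
Proof. by move=> If; rewrite eval_atE; apply: ext_ideal_zero cJ _; apply: ext_ideal_emb. Qed.

(* [f] is K-linearly dependent on the [f(X c^-k)], whose degrees are bounded:
   applying right multiplication by a power of [c] to such a relation leaves
   [f] plus terms vanishing at [Y]. *)
Lemma val_point_rel_ideal f : eval_at cc f = 0 -> rel_ideal f.
Proof.
move=> fc.
have rI g : rel_ideal g <-> eval_at 1%:M g = 0 by rewrite eval_atE.
(* If g(Yc) = 0 then g(Xc) is a relation of Y, so it vanishes at Yc as well, which gives g(Yc^2) =
   0, and so on. *)
have pow k g : eval_at cc g = 0 -> eval_at (cc ^+ k.+1) g = 0.
  elim: k g => [|k IH] g gc; first by rewrite expr1.
  rewrite exprSr -[_ * _]/(_ *m _) -eval_at_rmul_subst; apply: IH.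
  by apply: rel_ideal_val_point; apply/rI; rewrite eval_at_rmul_subst mul1mx.
have [N dep] := mpoly_bounded_dependent K (n * n) (msize f).+1.
have [|mu [i0 mui0] mu0] := dep (fun i => rmul_subst (invmx c ^+ i) f).
  by move=> i; apply: msize_rmul_subst.
case: (@arg_maxnP _ i0 (fun i => mu i != 0) (@nat_of_ord _) mui0) => k muk kmax.
have := congr1 (eval_at (cc ^+ k)) mu0; rewrite eval_at0 eval_at_sum (bigD1 k) //=.
have uX i : cc ^+ i *m map_mx cL (invmx c ^+ i) = 1%:M.
  rewrite rmorphXn /= map_invmx -[_ *m _]/(_ * _) -exprMn_comm; last first.
    by rewrite /GRing.comm -[_ * _]/(_ *m _) -[RHS]/(_ *m _) mulVmx ?mulmxV // map_unitmx.
  by rewrite -[_ * _]/(_ *m _) mulmxV ?map_unitmx // expr1n.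
rewrite big1 ?addr0 => [|i ik]; last first.
  have [mui|mui] := eqVneq (mu i) 0; first by rewrite mui scale0r eval_at0.
  have {}ik : (i < k)%N.
    by rewrite ltn_neqAle; apply/andP; split; [exact: ik | exact: kmax].
  have e : cc ^+ k *m map_mx cL (invmx c ^+ i) = cc ^+ (k - i).
    by rewrite -{1}(subnK (ltnW ik)) exprD -mulmxE -mulmxA uX mulmx1.
  rewrite eval_atZ eval_at_rmul_subst e; case: (k - i)%N (subn_gt0 i k) => [|d _].
    by rewrite ik.
  by rewrite pow // mulr0.
rewrite eval_atZ eval_at_rmul_subst uX => /eqP; rewrite mulf_eq0 fmorph_eq0 (negbTE muk).
by move=> /eqP/rI.
Qed.
End PointAutomorphism.

(** The substitution of Y c for Y. Both evaluations have the relations of Y as kernel, and Y c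
    generates L because c^-1 has entries in K. *)
Lemma exists_point_automorphism (c : 'M[C]_n) : zero_of_ideal c -> c \in unitmx ->
  exists s : diffGal iota, forall f, s (eval_at 1%:M f) = eval_at (map_mx cL c) f.
Proof.
move=> cJ uc; apply: exists_substitution_automorphism.
- move=> f; split=> [fc|]; first exact: (val_point_rel_ideal cJ uc fc).
  exact: rel_ideal_val_point.
- move=> f; have [g dg] := der_val f; exists g; split; last exact: dg.
  by have := dg 1%:M; rewrite -cL1.
- by move=> a; exists a%:MP; split; exact: eval_atC.
- move=> P PS Pv; apply: Lgen => // [a|i j].
    by rewrite -(eval_atC 1%:M); exact: Pv.
  have -> : Y i j = eval_at 1%:M (gen_mx i j); last exact: Pv.
  by have /matrixP/(_ i j) := eval_at_gen 1%:M; rewrite mulmx1 mxE.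
- move=> P PS Pv; have Pi a : P (iota a) by rewrite -(eval_atC (map_mx cL c)); exact: Pv.
  apply: Lgen => // i j; have [P1 PB PV _] := PS.
  have P0 : P 0 by rewrite -(subrr 1); apply: (PB).
  have PN x : P x -> P (- x) by rewrite -sub0r; apply: (PB).
  have PD x y : P x -> P y -> P (x + y).
    by move=> Px Py; rewrite -[y]opprK; apply: (PB) => //; apply: (PN).
  have PM x y : P x -> P y -> P (x * y).
    move=> Px Py; rewrite -[y]invrK; apply: (PV) => //.
    by rewrite -[y^-1]mul1r; apply: (PV).
  have -> : Y = map_mx (eval_at (map_mx cL c)) gen_mx *m map_mx cL (invmx c).
    by rewrite eval_at_gen -mulmxA -map_mxM mulmxV // map_mx1 mulmx1.
  rewrite mxE; elim/big_ind: _ => // h _; apply: (PM).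
    by rewrite mxE; exact: Pv.
  by rewrite mxE; exact: Pi.
Qed.
End FixedField.

Lemma pchar0_natr_neq0 (L : fieldType) k : [pchar L] =i pred0 -> k.+1%:R != 0 :> L.
Proof. by move=> c0; rewrite pcharf0P in c0 *; rewrite c0. Qed.

(* The minimal polynomial of [x] divides [(x - T)^N], hence is a power of
   [T - x]; as it is separable, it is linear. *)
Lemma expr_sub_combination_base (K L : fieldType) (iota : {rmorphism K -> L}) (x : L) N
    r (e : 'I_r -> L) (h : 'I_r -> {poly K}) : [pchar L] =i pred0 ->
  (forall t, root (map_poly iota (h t)) x) ->
  (x%:P - 'X) ^+ N = \sum_t e t *: map_poly iota (h t) -> exists a, x = iota a.
Proof.
move=> ch0 hx hN.
pose Q m := `[< exists q : {poly K}, [/\ q != 0, size q = m & root (map_poly iota q) x] >].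
have exQ : exists m, Q m.
  have [t ht] : exists t, h t != 0.
    apply: contrapT => /forallNP h0.
    have : (x%:P - 'X) ^+ N != 0.
      by rewrite expf_neq0 // -opprB oppr_eq0 polyXsubC_eq0.
    rewrite hN big1 ?eqxx // => t _; have /negP := h0 t.
    by rewrite negbK => /eqP ->; rewrite rmorph0 scaler0.
  by exists (size (h t)); apply/asboolP; exists (h t).
case: (ex_minnP exQ) => m /asboolP[q [q0 sq qx]] qmin.
have small p : root (map_poly iota p) x -> (size p < m)%N -> p = 0.
  move=> px pm; apply/eqP; apply: contraLR pm => p0; rewrite -leqNgt.
  by apply: qmin; apply/asboolP; exists p.
have qh t : map_poly iota q %| map_poly iota (h t).
  rewrite dvdp_map /dvdp; apply/eqP/small; last by rewrite -sq ltn_modp.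
  rewrite /root -[h t %% q](addKr (h t %/ q * q)) -divp_eq addrC rmorphB hornerD.
  by rewrite hornerN rmorphM hornerM (eqP (hx t)) (eqP qx) mulr0 subrr.
have : map_poly iota q %| ('X - x%:P) ^+ N.
  have -> : ('X - x%:P) ^+ N = (-1) ^+ N * (x%:P - 'X) ^+ N.
    by rewrite -exprMn mulN1r opprB.
  rewrite hN dvdp_mull //; elim/big_ind: _ => [|u v|t _].
  - exact: dvdp0.
  - exact: dvdp_add.
  - by rewrite -mul_polyC dvdp_mull.
move=> /dvdp_exp_XsubCP[k _ qk].
have szk : m = k.+1.
  by have := eqp_size qk; rewrite size_map_poly size_exp_XsubC sq.
have lcq : lead_coef q = q`_k by rewrite lead_coefE sq szk.
have qk0 : q`_k != 0 by rewrite -lcq lead_coef_eq0.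
case: k szk qk {lcq} qk0 => [|k] szk qk qk0.
  by move: qx; rewrite (eqp_root qk) expr0 rootE hornerC oner_eq0.
have [k0|k0] := posnP k.
  move: qk0 qx; rewrite {}k0 in szk * => qk0.
  rewrite rootE horner_coef size_map_poly sq szk !big_ord_recl big_ord0 !coef_map.
  rewrite expr0 mulr1 addr0 expr1 addrC addr_eq0 => /eqP e'.
  exists (- q`_0 / q`_1); rewrite rmorphM rmorphN fmorphV -e'.
  by rewrite mulrC mulKf // fmorph_eq0.
have dq0 : q^`()%R = 0.
  apply: small; last by rewrite -sq lt_size_deriv.
  have /eqpP[[c1 c2] /= /andP[c10 c20] ec] := qk.
  have := congr1 (@deriv _) ec; rewrite !derivZ deriv_exp derivXsubC mul1r => ed.
  have := congr1 (horner^~ x) ed; rewrite -deriv_map /= !hornerZ hornerMn.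
  rewrite horner_exp hornerXsubC subrr expr0n gtn_eqF // mul0rn mulr0 => /eqP.
  by rewrite mulf_eq0 (negbTE c10).
have := congr1 (fun p : {poly K} => p`_k) dq0; rewrite coef_deriv coef0 => /eqP.
rewrite -mulr_natr mulf_eq0 (negbTE qk0) /= => /eqP kz.
have := pchar0_natr_neq0 k ch0.
by rewrite -(rmorph_nat iota) kz rmorph0 eqxx.
Qed.

(** * From a nilpotent relation to an element of the base field *)

Section NilpotentRelation.
Variables (K L : fieldType) (iota : {rmorphism K -> L}) (m : nat).
Variable ev : {rmorphism {mpoly K[m]} -> L}.
Hypothesis ch0 : [pchar L] =i pred0.
Hypothesis evZ : forall c f, ev (c *: f) = iota c * ev f.
Local Notation MK := {mpoly K[m]}.
Local Notation io := (@map_mpoly m K L iota).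

(** Expand the N-th power in powers of x and write all coefficients over a K-basis e of their span:
    each basis vector gives a relation over K. Evaluated at Y, where a = x b, it says that a
    polynomial h_t over K vanishes at x, and by construction (x - T)^N is the sum of the e_t h_t. *)
Lemma base_of_nilpotent_relation (x : L) (a b D : MK) N (s : seq (L * MK)) :
  ev b != 0 -> ev D != 0 -> x = ev a / ev b ->
  (forall y, y \in s -> ev y.2 = 0) ->
  (x *: io b - io a) ^+ N * io D ^+ N = \sum_(y <- s) y.1 *: io y.2 ->
  exists k, x = iota k.
Proof.
move=> b0 D0 xab sI eN.
pose G k : MK := b ^+ (N - k) * (- a) ^+ k * D ^+ N *+ 'C(N, k).
have GE : (x *: io b - io a) ^+ N * io D ^+ N = \sum_(i < N.+1) x ^+ (N - i) *: io (G i).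
  rewrite exprDn mulr_suml; apply: eq_bigr => i _.
  have -> : io (G i) = io b ^+ (N - i) * (- io a) ^+ i * io D ^+ N *+ 'C(N, i).
    by rewrite /G raddfMn /= !rmorphM !rmorphXn rmorphN.
  by rewrite exprZn mulrnAl -!scalerAl -scalerMnr.
have {}eN : \sum_(i < N.+1) x ^+ (N - i) *: io (G i)
    + \sum_(i < size s) (- (tnth (in_tuple s) i).1) *: io (tnth (in_tuple s) i).2 = 0.
  rewrite -GE eN big_tnth -big_split big1 // => i _.
  by rewrite /= scaleNr subrr.
pose coef : 'rV[L]_(N.+1 + size s) :=
  row_mx (\row_i x ^+ (N - i)) (\row_i - (tnth (in_tuple s) i).1).
pose g (i : 'I_(N.+1 + size s)) : MK :=
  match fintype.split i with inl j => G j | inr j => (tnth (in_tuple s) j).2 end.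
have gl i : g (lshift _ i) = G i by rewrite /g (fintype.unsplitK (inl _ i)).
have gr i : g (rshift _ i) = (tnth (in_tuple s) i).2 by rewrite /g (fintype.unsplitK (inr _ i)).
have coefg : \sum_i coef 0 i *: io (g i) = 0.
  rewrite big_split_ord; apply: (etrans _ eN); apply: f_equal2; apply: eq_bigr => i _.
    by rewrite row_mxEl mxE gl.
  by rewrite row_mxEr mxE gr.
have [r [e [Q [ceQ eind]]]] := exists_basis iota coef.
have Qg t : \sum_i Q t i *: g i = 0.
  apply/mpolyP => mn; rewrite mcoeff0.
  pose v : 'cV[K]_r := \col_t (\sum_i Q t i *: g i)@_mn.
  suff /eind/matrixP/(_ t 0) : e *m map_mx iota v = 0 by rewrite !mxE.
  apply/matrixP=> i j; rewrite !ord1 mxE [RHS]mxE.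
  have := congr1 (mcoeff mn) coefg; rewrite mcoeff0 raddf_sum /=; apply: etrans.
  under [RHS]eq_bigr => h _ do rewrite mcoeffZ mcoeff_map_mpoly ceQ mxE mulr_suml.
  rewrite [RHS]exchange_big /=; apply: eq_bigr => k _; rewrite !mxE raddf_sum rmorph_sum mulr_sumr.
  by apply: eq_bigr => h _; rewrite /= mcoeffZ rmorphM mulrA mxE.
pose h t : {poly K} := \sum_(i < N.+1) Q t (lshift _ i) *: ((- 'X) ^+ i *+ 'C(N, i)).
have mapX i : map_poly iota ((- 'X) ^+ i) = (- 'X) ^+ i.
  by rewrite rmorphXn rmorphN /= map_polyX.
have mh t : map_poly iota (h t) =
    \sum_(i < N.+1) iota (Q t (lshift _ i)) *: ((- 'X) ^+ i *+ 'C(N, i)).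
  rewrite rmorph_sum; apply: eq_bigr => i _.
  by rewrite /= linearZ_LR /= raddfMn /= mapX.
apply: (@expr_sub_combination_base _ _ iota x N r (fun t => e 0 t) h) => // [t|].
  rewrite /root mh horner_sum.
  have := congr1 ev (Qg t); rewrite rmorph_sum rmorph0 big_split_ord /=.
  rewrite [X in _ + X]big1 ?addr0 => [|i _]; last first.
    have : ev (tnth (in_tuple s) i).2 = 0 by apply: sI; exact: mem_tnth.
    by rewrite evZ gr => ->; rewrite mulr0.
  have a0 : ev a = x * ev b by rewrite xab divfK.
  have bD0 : ev b ^+ N * ev D ^+ N != 0 by rewrite mulf_neq0 ?expf_neq0.
  move=> E; rewrite -(mulrI_eq0 _ (mulfI bD0)) -[X in _ == X]E mulr_sumr; apply/eqP.
  apply: eq_bigr => i _; rewrite evZ gl hornerZ hornerMn horner_exp hornerN hornerX.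
  have -> : ev (G i) = ev b ^+ (N - i) * (- (x * ev b)) ^+ i * ev D ^+ N *+ 'C(N, i).
    by rewrite /G rmorphMn !rmorphM !rmorphXn rmorphN a0.
  have -> : ev b ^+ N = ev b ^+ (N - i) * ev b ^+ i by rewrite -exprD subnK // -ltnS.
  rewrite -mulNr exprMn -[X in _ * (_ * X)]mulr_natr -[X in _ = _ * X]mulr_natr.
  ring.
rewrite exprDn.
under [RHS]eq_bigr => t _ do rewrite mh scaler_sumr.
rewrite exchange_big; apply: eq_bigr => i _ /=.
have := congr1 (fun B : 'rV[L]_(N.+1 + size s) => B 0 (lshift _ i)) ceQ.
rewrite row_mxEl !mxE => xi.
under [RHS]eq_bigr => t _ do rewrite scalerA.
rewrite -scaler_suml -scalerMnr -mul_polyC -rmorphXn xi; congr (_%:P * _ *+ _).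
by apply: eq_bigr => t _; rewrite mxE.
Qed.
End NilpotentRelation.

Lemma radical_sum (R : comNzRingType) (J : set R) (I : Type) (s : seq I) (F : I -> R) :
  is_ideal J -> (forall i, exists k, J (F i ^+ k)) -> exists k, J ((\sum_(i <- s) F i) ^+ k).
Proof.
move=> [J0 JD JM] JF; elim: s => [|i s [k IH]].
  by exists 1%N; rewrite big_nil expr1.
have [l Fl] := JF i; exists (l + k)%N; rewrite big_cons exprDn.
apply: (big_ind J) => // h _; rewrite -mulr_natl; apply: (JM).
have [hk|hk] := leqP k h.
  by rewrite -(subnK hk) exprD mulrA; apply: (JM).
rewrite mulrC (_ : l + k - h = (k - h) + l)%N; last by lia.
by rewrite exprD mulrA; apply: (JM).
Qed.

Section FixedFieldTheorem.
Variables (C : closedFieldType) (K L : diffFieldType).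
Variables (iota : {rmorphism K -> L}) (cK : {rmorphism C -> K}).
Hypothesis Cfib : large_fibers C.
Hypothesis ch0 : [pchar L] =i pred0.
Hypothesis iota_der : {morph iota : a / der a}.
Hypothesis cK_der : forall c, der (cK c) = 0.
Hypothesis L_const : forall x : L, der x = 0 -> exists c, x = iota (cK c).
Variable n' : nat.
Local Notation n := n'.+1.
Variables (Y : 'M[L]_n) (A : 'M[K]_n).
Hypothesis uY : Y \in unitmx.
Hypothesis derY : map_mx der Y = map_mx iota A *m Y.
Hypothesis Lgen : forall P : set L, diff_subfield P -> (forall a, P (iota a)) ->
  (forall i j, P (Y i j)) -> forall x, P x.

Local Notation MK := {mpoly K[n * n]}.
Local Notation ML := {mpoly L[n * n]}.
Local Notation MC := {mpoly C[n * n]}.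
Let cL : {rmorphism C -> L} := iota \o cK.
Local Notation ev1 := (eval_at iota Y 1%:M).
Local Notation io := (@map_mpoly (n * n) K L iota).

Lemma exists_eval_at_fraction x : exists fg : MK * MK, ev1 fg.2 != 0 /\ x = ev1 fg.1 / ev1 fg.2.
Proof.
apply: (exists_fraction (w := ev1)).
- move=> f; have [g dg] := der_val iota_der cK_der derY f; exists g.
  by have := dg 1%:M; rewrite -cL1.
- move=> P PS Pv; apply: Lgen => // [a|i j].
    by rewrite -(eval_atC iota Y 1%:M); exact: Pv.
  have -> : Y i j = ev1 (gen_mx i j); last exact: Pv.
  by have /matrixP/(_ i j) := eval_at_gen iota Y 1%:M; rewrite mulmx1 mxE.
Qed.

(** Vanishing of w at a constant point becomes vanishing of every u_j there, a statement over C open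
    to the Nullstellensatz. *)
Lemma decompose_over_constants (w : ML) : exists r (e : 'rV[L]_r) (u : 'I_r -> MC),
  w = \sum_j e 0 j *: map_mpoly cL (u j) /\
  forall v : 'I_r -> C, \sum_j e 0 j * cL (v j) = 0 -> forall j, v j = 0.
Proof.
pose s := msupp w; pose mon i := tnth (in_tuple s) i.
have [r [e [Q [eQ eind]]]] := exists_basis cL (\row_i w@_(mon i)).
exists r, e, (fun j => \sum_i Q j i *: 'X_[mon i]); split.
  rewrite {1}[w]mpolyE -/s big_tnth.
  have mu j : map_mpoly cL (\sum_i Q j i *: 'X_[mon i]) = \sum_i cL (Q j i) *: 'X_[mon i].
    by rewrite raddf_sum; apply: eq_bigr => i _; rewrite [LHS]map_mpolyZ map_mpolyX.
  under [RHS]eq_bigr => j _ do rewrite mu scaler_sumr.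
  rewrite exchange_big; apply: eq_bigr => i _.
  have /matrixP/(_ 0 i) := eQ; rewrite mxE => ->; rewrite mxE scaler_suml.
  by apply: eq_bigr => j _; rewrite scalerA mxE.
move=> v ev0 j; have : (\col_j v j) j 0 = 0.
  rewrite (eind (\col_j v j)) ?mxE //; apply/matrixP=> i h; rewrite !ord1 !mxE -[RHS]ev0.
  by apply: eq_bigr => k _; rewrite !mxE.
by rewrite mxE.
Qed.

Lemma evmx_det (R : comNzRingType) (c : 'M[R]_n) : evmx c (\det gen_mx) = \det c.
Proof. by rewrite -[in RHS](evmx_gen c) det_map_mx. Qed.

(** The polynomial w = x b(YZ) - a(YZ) vanishes at each point c defining an automorphism s, since
    its value there is x s(b(Y)) - s(a(Y)) = 0. The factor det Z restricts the Nullstellensatz to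
    invertible zeros. *)
Lemma invariant_in_radical (x : L) a b : (forall s : diffGal iota, s x = x) ->
  ev1 a = x * ev1 b -> exists N, ext_ideal iota Y
    ((x *: emb iota Y b - emb iota Y a) ^+ N * map_mpoly cL (\det gen_mx) ^+ N).
Proof.
move=> xfix axb; set w := _ - _.
have [r [e [u [wE eind]]]] := decompose_over_constants w.
have uN j : exists k, const_ideal iota cK Y ((u j * \det gen_mx) ^+ k).
  apply: contrapT => /forallNP nk.
  have [c [cJ]] := nullstellensatz Cfib (const_ideal_is_ideal iota cK uY) nk.
  pose c0 : 'M[C]_n := vec_mx (\row_k c k).
  have evc p : p.@[c] = evmx c0 p.
    by apply: meval_eq => k; rewrite vec_mxK mxE.
  rewrite evc evmxM evmx_det mulf_eq0 negb_or => /andP[uc0 dc0].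
  have c0J : zero_of_ideal iota cK Y c0 by move=> q Jq; rewrite -evc; exact: cJ.
  have uc : c0 \in unitmx by rewrite unitmxE unitfE.
  have [s sE] := exists_point_automorphism iota_der cK_der L_const uY derY Lgen c0J uc.
  have [_ [_ sM] _ _ _] := dgvalP s.
  have w0 : evmx (map_mx cL c0) w = 0.
    rewrite evmxD evmxN evmxZ -[evmx _ (emb _ _ a)]sE -[evmx _ (emb _ _ b)]sE.
    by rewrite axb sM xfix subrr.
  move: w0; rewrite wE evmx_sum.
  under eq_bigr => h _ do rewrite evmxZ evmx_map.
  by move=> /eind/(_ j) u0; rewrite u0 eqxx in uc0.
have IE : is_ideal (ext_ideal iota Y).
  by split; [exact: ext_ideal0 | exact: ext_idealD | exact: ext_idealM].
have [j|N] := @radical_sum _ _ _ (index_enum _) (fun j => e 0 j *: map_mpoly cL (u j * \det gen_mx)) IE.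
  have [k Jk] := uN j; exists k; rewrite exprZn; apply: ext_idealZ.
  by move: Jk; rewrite /const_ideal /= rmorphXn.
move=> IN; exists N; rewrite -exprMn.
suff <- : \sum_j e 0 j *: map_mpoly cL (u j * \det gen_mx) = w * map_mpoly cL (\det gen_mx) by [].
by rewrite wE mulr_suml; apply: eq_bigr => j _; rewrite rmorphM scalerAl.
Qed.

(** Substituting Y^-1 Z turns the relation in L[Z] into one between x b - a and the relations
    themselves. The determinant of Y^-1 that appears is a unit, absorbed into the coefficients. *)
Theorem fixed_field (x : L) : (forall s : diffGal iota, s x = x) -> exists a, x = iota a.
Proof.
move=> xfix; have [[a b] /= [b0 xab]] := exists_eval_at_fraction x.
have axb : ev1 a = x * ev1 b by rewrite xab divfK.
have [N [s [sI sE]]] := invariant_in_radical xfix axb.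
pose d := \det (invmx Y).
have d0 : d != 0 by rewrite -unitfE -unitmxE unitmx_inv.
have backD : back Y (map_mpoly cL (\det gen_mx)) = d%:MP * io (\det gen_mx).
  have mg (R S : comNzRingType) (f : {rmorphism R -> S}) :
      map_mpoly f (\det (gen_mx : 'M[{mpoly R[n * n]}]_n)) = \det gen_mx.
    rewrite -det_map_mx; congr (\det _).
    by apply/matrixP=> i j; rewrite !mxE; exact: map_mpolyX.
  rewrite !mg -det_map_mx back_gen det_mulmx; congr (_ * _).
  by rewrite det_map_mx.
have bw : back Y (x *: emb iota Y b - emb iota Y a) = x *: io b - io a.
  by rewrite rmorphB -mul_mpolyC rmorphM /= backC !back_emb // mul_mpolyC.
have bs : back Y (\sum_(y <- s) y.1 *: emb iota Y y.2) = \sum_(y <- s) y.1 *: io y.2.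
  rewrite rmorph_sum; apply: eq_bigr => y _.
  by rewrite -mul_mpolyC rmorphM /= backC back_emb // mul_mpolyC.
have := congr1 (back Y) sE; rewrite rmorphM !rmorphXn /= backD bw bs => E.
have D0 : ev1 (\det gen_mx) != 0.
  have -> : ev1 (\det gen_mx) = \det (map_mx ev1 gen_mx) by rewrite det_map_mx.
  by rewrite eval_at_gen mulmx1 -unitfE -unitmxE.
have sI' y : y \in [seq (d ^- N * y.1, y.2) | y <- s] -> ev1 y.2 = 0.
  by move=> /mapP[z zs ->]; exact: (sI z zs).
apply: (@base_of_nilpotent_relation K L iota _ ev1 ch0 (eval_atZ iota Y 1%:M)
  x a b (\det gen_mx) N _ b0 D0 xab sI').
rewrite big_map; under eq_bigr => y _ do rewrite -scalerA.
have dN : d%:MP ^+ N = (d ^+ N)%:MP :> ML by rewrite rmorphXn.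
rewrite -scaler_sumr -E exprMn dN mulrCA mul_mpolyC scalerA mulVf.
  by rewrite scale1r.
exact: expf_neq0.
Qed.
End FixedFieldTheorem.

(** * Laurent series at 1 *)

Section Fractions.
Variable D : idomainType.

Lemma frac_numden (x : {fraction D}) :
  exists pq : D * D, pq.2 != 0 /\ x = pq.1%:F / pq.2%:F.
Proof.
exists (frac (repr x)); have d0 := denom_ratioP (repr x); split=> //.
have F0 : (\d_(repr x))%:F != 0 by rewrite tofrac_eq0.
apply: (canRL (mulfK F0)); move: (repr x) (reprK x) d0 {F0} => r <- d0.
unlock FracField.tofrac; rewrite -[LHS]FracField.pi_mul.
apply/eqmodP; rewrite /= FracField.equivfE /FracField.mulf.
by rewrite !numden_Ratio ?mulf_neq0 ?oner_eq0 // !mulr1 mulrC.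
Qed.

Definition num (x : {fraction D}) := (projT1 (cid (frac_numden x))).1.
Definition den (x : {fraction D}) := (projT1 (cid (frac_numden x))).2.

Lemma den_neq0 x : den x != 0.
Proof. by rewrite /den; case: (cid _) => ? []. Qed.

Lemma num_den x : x = (num x)%:F / (den x)%:F.
Proof. by rewrite /num /den; case: (cid _) => ? []. Qed.

Lemma num_den_eq p q : q != 0 -> num (p%:F / q%:F) * q = p * den (p%:F / q%:F).
Proof.
move=> q0; have := num_den (p%:F / q%:F); have := den_neq0 (p%:F / q%:F).
move: (num _) (den _) => a b b0 /eqP.
by rewrite eqr_div ?tofrac_eq0 // -!tofracM tofrac_eq => /eqP.
Qed.
End Fractions.

Section FractionExtension.
Variables (D : idomainType) (E : fieldType) (phi : {rmorphism D -> E}).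
Hypothesis phi_inj : injective phi.

Definition frac_ext (x : {fraction D}) : E := phi (num x) / phi (den x).

Lemma phi_neq0 p : p != 0 -> phi p != 0.
Proof. by rewrite -(inj_eq phi_inj) rmorph0. Qed.

Lemma frac_extE p q : q != 0 -> frac_ext (p%:F / q%:F) = phi p / phi q.
Proof.
move=> q0; rewrite /frac_ext; apply/eqP; rewrite eqr_div ?phi_neq0 ?den_neq0 //.
by rewrite -!rmorphM num_den_eq.
Qed.

Lemma frac_ext_tofrac p : frac_ext p%:F = phi p.
Proof. by have := @frac_extE p 1 (oner_neq0 _); rewrite tofrac1 rmorph1 !divr1. Qed.

Lemma frac_ext_zmod_morphism : zmod_morphism frac_ext.
Proof.
move=> x y; rewrite [x]num_den [y]num_den.
have := den_neq0 x; have := den_neq0 y.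
move: (num x) (den x) (num y) (den y) => a b c d d0 b0.
rewrite subf_div ?tofrac_eq0 // -!tofracM -tofracB !frac_extE ?mulf_neq0 //.
by rewrite subf_div ?phi_neq0 // rmorphB !rmorphM.
Qed.

Lemma frac_ext_monoid_morphism : monoid_morphism frac_ext.
Proof.
split; first by rewrite -tofrac1 frac_ext_tofrac rmorph1.
move=> x y; rewrite [x]num_den [y]num_den.
have := den_neq0 x; have := den_neq0 y.
move: (num x) (den x) (num y) (den y) => a b c d d0 b0.
by rewrite mulf_div -!tofracM !frac_extE ?mulf_neq0 // mulf_div !rmorphM.
Qed.
End FractionExtension.

Section FractionDerivation.
Variables (D : idomainType) (d : D -> D).
Hypotheses (dD : {morph d : x y / x + y}) (dM : forall x y, d (x * y) = d x * y + x * d y).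

Definition frac_der (x : {fraction D}) : {fraction D} :=
  (d (num x) * den x - num x * d (den x))%:F / (den x ^+ 2)%:F.

Lemma frac_derE p q : q != 0 ->
  frac_der (p%:F / q%:F) = (d p * q - p * d q)%:F / (q ^+ 2)%:F.
Proof.
move=> q0; rewrite /frac_der; have := num_den_eq p q0; have := den_neq0 (p%:F / q%:F).
move: (num _) (den _) => a b b0 e; have de := congr1 d e; rewrite !dM in de.
apply/eqP; rewrite eqr_div ?tofrac_eq0 ?expf_neq0 // -!tofracM tofrac_eq -subr_eq0.
have -> : (d a * b - a * d b) * q ^+ 2 - (d p * q - p * d q) * b ^+ 2 =
  b * q * (d a * q + a * d q - (d p * b + p * d b))
  + (p * b - a * q) * (d b * q + b * d q) by ring.
by rewrite de e !subrr mulr0 mul0r addr0.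
Qed.

Lemma frac_derD : {morph frac_der : x y / x + y}.
Proof.
move=> x y; rewrite [x]num_den [y]num_den.
have := den_neq0 x; have := den_neq0 y.
move: (num x) (den x) (num y) (den y) => p q r s s0 q0.
rewrite addf_div ?tofrac_eq0 // -!tofracM -tofracD !frac_derE ?mulf_neq0 //.
rewrite addf_div ?tofrac_eq0 ?expf_neq0 // -!tofracM -tofracD.
by rewrite !dD !dM exprMn; congr (_%:F / _); ring.
Qed.

Lemma frac_derM x y : frac_der (x * y) = frac_der x * y + x * frac_der y.
Proof.
rewrite [x]num_den [y]num_den.
have := den_neq0 x; have := den_neq0 y.
move: (num x) (den x) (num y) (den y) => p q r s s0 q0.
rewrite mulf_div -!tofracM !frac_derE ?mulf_neq0 // !mulf_div -!tofracM.
rewrite addf_div ?tofrac_eq0 ?mulf_neq0 ?expf_neq0 // -!tofracM -tofracD.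
apply/eqP; rewrite eqr_div ?tofrac_eq0 ?mulf_neq0 ?expf_neq0 ?mulf_neq0 //.
by rewrite -!tofracM tofrac_eq !dM; apply/eqP; ring.
Qed.
End FractionDerivation.

(** A separate type, because the product wanted here is the Cauchy product and not the pointwise one
    of functions. *)
Record fps (C : Type) := Fps { coefs :> nat -> C }.

HB.instance Definition _ C := gen_eqMixin (fps C).
HB.instance Definition _ C := gen_choiceMixin (fps C).

Section PowerSeries.
Variable C : fieldType.
Local Notation P := (fps C).
Implicit Types a b c : P.

Lemma fps_ext a b : a =1 b -> a = b.
Proof. by case: a b => [a] [b] /= /funext ->. Qed.

Definition fps_add a b : P := Fps (fun n => a n + b n).
Definition fps_opp a : P := Fps (fun n => - a n).
Definition fps_mul a b : P := Fps (fun n => \sum_(i < n.+1) a i * b (n - i)%N).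
Definition fps_poly (p : {poly C}) : P := Fps (fun n => p`_n).
Definition trunc n a : {poly C} := \poly_(i < n) a i.

Lemma fps_addA : associative fps_add.
Proof. by move=> a b c; apply: fps_ext => n /=; rewrite addrA. Qed.
Lemma fps_addC : commutative fps_add.
Proof. by move=> a b; apply: fps_ext => n /=; rewrite addrC. Qed.
Lemma fps_add0 : left_id (Fps (fun=> 0)) fps_add.
Proof. by move=> a; apply: fps_ext => n /=; rewrite add0r. Qed.
Lemma fps_addN : left_inverse (Fps (fun=> 0)) fps_opp fps_add.
Proof. by move=> a; apply: fps_ext => n /=; rewrite addNr. Qed.

HB.instance Definition _ :=
  GRing.isZmodule.Build P fps_addA fps_addC fps_add0 fps_addN.

Lemma fpsD a b n : (a + b) n = a n + b n. Proof. by []. Qed.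
Lemma fpsN a n : (- a) n = - a n. Proof. by []. Qed.
Lemma fps0 n : (0 : P) n = 0. Proof. by []. Qed.

(** Coefficients of a product below N only see truncations, so ring identities are inherited from
    polynomials. *)
Lemma trunc_mul N n a b : (n < N)%N -> fps_mul a b n = (trunc N a * trunc N b)`_n.
Proof.
move=> nN; rewrite coefM; apply: eq_bigr => i _; rewrite !coef_poly.
by rewrite (leq_ltn_trans _ nN) ?(leq_ltn_trans (leq_subr _ _) nN) // -ltnS.
Qed.

Lemma coef_trunc N n a : (n < N)%N -> (trunc N a)`_n = a n.
Proof. by move=> nN; rewrite coef_poly nN. Qed.

Lemma fps_mulC : commutative fps_mul.
Proof.
by move=> a b; apply: fps_ext => n; rewrite !(@trunc_mul n.+1) // mulrC.
Qed.

Lemma fps_mulA : associative fps_mul.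
Proof.
have h a b c n : fps_mul a (fps_mul b c) n =
    (trunc n.+1 a * (trunc n.+1 b * trunc n.+1 c))`_n.
  rewrite coefM; apply: eq_bigr => i _; rewrite coef_trunc //.
  by rewrite (@trunc_mul n.+1) // ltnS leq_subr.
move=> a b c; apply: fps_ext => n; rewrite (fps_mulC (fps_mul a b)) !h.
by rewrite [_ * (trunc _ a * _)]mulrC mulrA.
Qed.

Lemma fps_mul1 : left_id (fps_poly 1) fps_mul.
Proof.
move=> a; apply: fps_ext => n; rewrite /= big_ord_recl coefC eqxx mul1r subn0.
by rewrite big1 ?addr0 // => i _; rewrite coefC mul0r.
Qed.

Lemma fps_mulDl : left_distributive fps_mul fps_add.
Proof.
move=> a b c; apply: fps_ext => n /=; rewrite -big_split.
by apply: eq_bigr => i _; rewrite mulrDl.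
Qed.

Lemma fps_1neq0 : fps_poly 1 != 0.
Proof.
apply/eqP => /(congr1 (fun a : P => a 0%N)); rewrite /= coefC eqxx => /eqP.
by rewrite oner_eq0.
Qed.

HB.instance Definition _ := GRing.Zmodule_isComNzRing.Build P
  fps_mulA fps_mulC fps_mul1 fps_mulDl fps_1neq0.

Lemma fpsM a b n : (a * b) n = \sum_(i < n.+1) a i * b (n - i)%N.
Proof. by []. Qed.

Lemma fps_order a : a != 0 -> exists m, a m != 0 /\ forall i, (i < m)%N -> a i = 0.
Proof.
move=> a0; have exa : exists m, a m != 0.
  apply: contrapT => /forallNP an; move/eqP: a0; apply; apply: fps_ext => m.
  by apply/eqP; have /negP := an m; rewrite negbK.
exists (ex_minn exa); case: ex_minnP => m am mmin; split=> // i im.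
by apply/eqP; apply: contraLR im => /mmin; rewrite -leqNgt.
Qed.

Lemma fpsM_order a b m n : (forall i, (i < m)%N -> a i = 0) ->
  (forall i, (i < n)%N -> b i = 0) ->
  (forall i, (i < m + n)%N -> (a * b) i = 0) /\ (a * b) (m + n)%N = a m * b n.
Proof.
move=> am bn; have z i j : (i < m)%N || (j < n)%N -> a i * b j = 0.
  by case/orP => [/am|/bn] ->; rewrite ?mul0r ?mulr0.
split=> [i imn|]; first by rewrite fpsM big1 // => j _; rewrite z //; have := ltn_ord j; lia.
have mlt : (m < (m + n).+1)%N by lia.
rewrite fpsM (bigD1 (Ordinal mlt)) //= addKn big1 ?addr0 // => j jm.
by rewrite z //; have := ltn_ord j; move: jm; rewrite -val_eqE /=; lia.
Qed.

Lemma fpsM_neq0 a b : a != 0 -> b != 0 -> a * b != 0.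
Proof.
move=> /fps_order[m [am ma]] /fps_order[n [bn nb]].
apply/eqP => /(congr1 (fun c : P => c (m + n)%N)).
by have [_ ->] := fpsM_order ma nb; move=> /eqP; rewrite mulf_eq0 (negbTE am) (negbTE bn).
Qed.

(** Units are declared by existence of an inverse; the criterion by the constant term is
    [fps_inverse]. *)
Definition fps_unit : pred P := fun a => `[< exists b, b * a = 1 >].
Definition fps_inv a : P :=
  if pselect (exists b, b * a = 1) is left h then projT1 (cid h) else a.

Lemma fps_mulV : {in fps_unit, left_inverse 1 fps_inv *%R}.
Proof.
move=> a /asboolP ha; rewrite /fps_inv; case: pselect => // h.
by case: (cid h).
Qed.

Lemma fps_unitPl a b : b * a = 1 -> fps_unit a.
Proof. by move=> ba; apply/asboolP; exists b. Qed.

Lemma fps_inv_out : {in [predC fps_unit], fps_inv =1 id}.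
Proof.
by move=> a; rewrite inE => /asboolP ha; rewrite /fps_inv; case: pselect.
Qed.

HB.instance Definition _ := GRing.ComNzRing_hasMulInverse.Build P
  fps_mulV fps_unitPl fps_inv_out.

Lemma fps_integral a b : a * b = 0 -> (a == 0) || (b == 0).
Proof.
move=> ab; apply: contraT; rewrite negb_or => /andP[a0 b0].
by have := fpsM_neq0 a0 b0; rewrite ab eqxx.
Qed.

HB.instance Definition _ := GRing.ComUnitRing_isIntegral.Build P fps_integral.

Definition fps_der a : P := Fps (fun n => a n.+1 *+ n.+1).

Lemma fps_derD : {morph fps_der : a b / a + b}.
Proof. by move=> a b; apply: fps_ext => n /=; rewrite mulrnDl. Qed.

Lemma fps_derM a b : fps_der (a * b) = fps_der a * b + a * fps_der b.
Proof.
apply: fps_ext => n; rewrite fpsD.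
(* Coefficient n of a derivative involves coefficient n + 1, hence the truncation at n + 2. *)
have tE c i : (i <= n)%N -> (trunc n.+2 c)^`()`_i = fps_der c i.
  by move=> ? /=; rewrite coef_deriv coef_trunc.
transitivity ((trunc n.+2 a * trunc n.+2 b)^`()`_n).
  by rewrite coef_deriv -trunc_mul.
rewrite derivM coefD !coefM.
congr (_ + _); apply: eq_bigr => i _; have := ltn_ord i => ilt.
  by rewrite tE ?coef_trunc //; lia.
by rewrite tE ?coef_trunc //; lia.
Qed.
End PowerSeries.

Section FpsConstants.
Variable C : fieldType.
Hypothesis ch0 : [pchar C] =i pred0.
Local Notation P := (fps C).

Definition fpsC (c : C) : P := fps_poly c%:P.

Lemma fpsCM c (a : P) n : (fpsC c * a) n = c * a n.
Proof.
rewrite fpsM big_ord_recl /= coefC eqxx subn0 big1 ?addr0 // => i _.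
by rewrite coefC mul0r.
Qed.

Definition fpsX : P := fps_poly 'X.

Lemma fpsXM (a : P) n : (fpsX * a) n = if n is m.+1 then a m else 0.
Proof.
rewrite fpsM; case: n => [|m]; first by rewrite big_ord1 /= coefX mul0r.
rewrite big_ord_recl big_ord_recl /= !coefX mul0r add0r mul1r subSS subn0.
by rewrite big1 ?addr0 // => i _; rewrite coefX mul0r.
Qed.

Lemma fpsX_der (a : P) n : (fpsX * fps_der a) n = a n *+ n.
Proof. by rewrite fpsXM; case: n. Qed.

Lemma natr_inj m n : m%:R = n%:R :> C -> m = n.
Proof.
wlog mn : m n / (m <= n)%N => [wl e|e].
  by have [/wl/(_ e)|/ltnW/wl/(_ (esym e))] := leqP m n.
move/eqP: e; rewrite eq_sym -subr_eq0 -natrB // -(subnK mn); case: (n - m)%N => // k.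
by rewrite addnK (negbTE (pchar0_natr_neq0 k ch0)).
Qed.

(* With [E = t d/dt], leading terms in [E a * b = a * E b] force equal orders;
   subtracting a constant multiple of [b] from [a] would raise the order. *)
Lemma fps_wronskian_eq0 (a b : P) : b != 0 -> fps_der a * b = a * fps_der b ->
  exists c, a = fpsC c * b.
Proof.
have order_eq (x y : P) m n : fps_der x * y = x * fps_der y ->
    x m != 0 -> (forall i, (i < m)%N -> x i = 0) ->
    y n != 0 -> (forall i, (i < n)%N -> y i = 0) -> m = n.
  move=> e xm mx yn ny.
  have Ex i : (i < m)%N -> (fpsX * fps_der x) i = 0.
    by move=> /mx xi; rewrite fpsX_der xi mul0rn.
  have Ey i : (i < n)%N -> (fpsX * fps_der y) i = 0.
    by move=> /ny yi; rewrite fpsX_der yi mul0rn.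
  have [_] := fpsM_order Ex ny; rewrite -mulrA e mulrCA.
  have [_ ->] := fpsM_order mx Ey; rewrite !fpsX_der mulrnAr mulrnAl => /eqP.
  rewrite -[_ *+ n]mulr_natr -[_ *+ m]mulr_natr -subr_eq0 -mulrBr mulf_eq0
    mulf_eq0 (negbTE xm) (negbTE yn) /=.
  by rewrite subr_eq0 eq_sym => /eqP/natr_inj.
move=> b0 e; have [n [bn nb]] := fps_order b0.
have [->|a0] := eqVneq a 0.
  by exists 0; apply: fps_ext => i; rewrite fpsCM mul0r.
have [m [am ma]] := fps_order a0.
have mn := order_eq _ _ _ _ e am ma bn nb; subst m.
pose c := a n / b n; exists c; apply/eqP; rewrite -subr_eq0; apply: contraT.
have dc : fps_der (fpsC c * b) = fpsC c * fps_der b.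
  apply: fps_ext => i; rewrite fpsCM [LHS](_ : _ = (fpsC c * b) i.+1 *+ i.+1) //.
  by rewrite fpsCM mulrnAr.
have dN (x : P) : fps_der (- x) = - fps_der x.
  by apply: fps_ext => i; rewrite /= mulNrn.
move=> /fps_order[k [gk kg]].
have eg : fps_der (a - fpsC c * b) * b = (a - fpsC c * b) * fps_der b.
  by rewrite fps_derD dN dc mulrBl e mulrBl -!mulrA [b * _]mulrC.
have kn := order_eq _ _ _ _ eg gk kg bn nb.
by move: gk; rewrite kn fpsD fpsN fpsCM /c divfK // subrr eqxx.
Qed.
End FpsConstants.

Definition laurent (C : fieldType) := {fraction (fps C)}.
HB.instance Definition _ C := GRing.Field.on (laurent C).
HB.instance Definition _ C := Field_isDifferential.Build (laurent C)
  (frac_derD (@fps_derD C) (@fps_derM C)) (frac_derM (@fps_derM C)).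

Section Laurent.
Variable C : fieldType.
Local Notation F := (laurent C).

(* The expansion at [z = 1] of rational functions, [z = 1 + t]. *)
Definition taylor1 (p : {poly C}) : F := (fps_poly (p \Po ('X + 1%:P)))%:F.

Lemma fps_poly_zmod_morphism : zmod_morphism (@fps_poly C).
Proof. by move=> p q; apply: fps_ext => n /=; rewrite coefB. Qed.

Lemma fps_poly_monoid_morphism : monoid_morphism (@fps_poly C).
Proof. by split=> // p q; apply: fps_ext => n /=; rewrite coefM. Qed.

HB.instance Definition _ := GRing.isZmodMorphism.Build _ _ (@fps_poly C) fps_poly_zmod_morphism.
HB.instance Definition _ := GRing.isMonoidMorphism.Build _ _ (@fps_poly C) fps_poly_monoid_morphism.

Lemma taylor1_zmod_morphism : zmod_morphism taylor1.
Proof. by move=> p q; rewrite /taylor1 comp_polyB !rmorphB. Qed.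

Lemma taylor1_monoid_morphism : monoid_morphism taylor1.
Proof.
split; first by rewrite /taylor1 comp_polyC !rmorph1.
by move=> p q; rewrite /taylor1 comp_polyM !rmorphM.
Qed.

HB.instance Definition _ := GRing.isZmodMorphism.Build _ _ taylor1 taylor1_zmod_morphism.
HB.instance Definition _ := GRing.isMonoidMorphism.Build _ _ taylor1 taylor1_monoid_morphism.

Lemma fps_poly_inj : injective (@fps_poly C).
Proof. by move=> p q e; apply/polyP => n; have := congr1 (fun a : fps C => a n) e. Qed.

Lemma taylor1_inj : injective taylor1.
Proof.
move=> p q /eqP; rewrite tofrac_eq => /eqP/fps_poly_inj/(congr1 (fun r => r \Po ('X - 1%:P))).
by rewrite -!comp_polyA comp_polyD comp_polyX comp_polyC subrK !comp_polyXr.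
Qed.

Definition kappa (x : {fraction {poly C}}) : F := frac_ext taylor1 x.

HB.instance Definition _ := GRing.isZmodMorphism.Build _ _ kappa
  (frac_ext_zmod_morphism taylor1_inj).
HB.instance Definition _ := GRing.isMonoidMorphism.Build _ _ kappa
  (frac_ext_monoid_morphism taylor1_inj).

Lemma kappaE p q : q != 0 -> kappa (p%:F / q%:F) = taylor1 p / taylor1 q.
Proof. exact: (frac_extE taylor1_inj). Qed.

Lemma kappa_tofrac p : kappa p%:F = taylor1 p.
Proof. exact: (frac_ext_tofrac taylor1_inj). Qed.

Lemma der_laurent (a b : fps C) : b != 0 ->
  der (a%:F / b%:F : F) = (fps_der a * b - a * fps_der b)%:F / (b ^+ 2)%:F.
Proof. exact: (frac_derE (@fps_derM C)). Qed.

Lemma fps_der1 : fps_der 1 = 0 :> fps C.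
Proof. by apply: fps_ext => n /=; rewrite coefC mul0rn. Qed.

Lemma der_tofrac (a : fps C) : der (a%:F : F) = (fps_der a)%:F.
Proof.
have := @der_laurent a 1 (oner_neq0 _); rewrite tofrac1 divr1 => ->.
by rewrite fps_der1 mulr0 subr0 mulr1 expr1n tofrac1 divr1.
Qed.

Lemma fps_der_poly (p : {poly C}) : fps_der (fps_poly p) = fps_poly p^`().
Proof. by apply: fps_ext => n /=; rewrite coef_deriv. Qed.

Lemma der_taylor1 p : der (taylor1 p) = taylor1 p^`().
Proof.
rewrite [LHS]der_tofrac fps_der_poly deriv_comp derivD derivX derivC addr0 mulr1.
by [].
Qed.

Lemma kappa_der : {morph kappa : x / der x}.
Proof.
move=> x; rewrite [x]num_den; have := den_neq0 x; move: (num x) (den x) => p q q0.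
have tq0 : taylor1 q != 0 by rewrite -(inj_eq taylor1_inj) rmorph0 in q0 *.
rewrite [der _]ratderE // !kappaE ?expf_neq0 // der_div // !der_taylor1.
by rewrite rmorphB !rmorphM.
Qed.

Lemma kappa_cst c : kappa (ratcst c) = (fpsC c)%:F.
Proof. by rewrite [LHS]kappa_tofrac /taylor1 comp_polyC. Qed.

Hypothesis ch0 : [pchar C] =i pred0.

Lemma laurent_constant (x : F) : der x = 0 -> exists c, x = kappa (ratcst c).
Proof.
rewrite [x]num_den; have := den_neq0 x; move: (num x) (den x) => a b b0.
rewrite der_laurent // => /eqP; rewrite mulf_eq0 invr_eq0 !tofrac_eq0 expf_eq0 (negbTE b0) orbF.
rewrite subr_eq0 => /eqP/(fps_wronskian_eq0 ch0 b0)[c ->]; exists c.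
by rewrite kappa_cst tofracM mulfK // tofrac_eq0.
Qed.

Lemma ratfun_constant (x : {fraction {poly C}}) : der x = 0 -> exists c, x = ratcst c.
Proof.
move=> dx; have [|c e] := @laurent_constant (kappa x); last by exists c; apply: fmorph_inj e.
by rewrite -kappa_der dx rmorph0.
Qed.
End Laurent.

(** * Power series solutions at z = 1 *)

Section TriangularOperator.
Variable C : fieldType.
Local Notation P := (fps C).
Variables (D : P -> P) (l : nat -> C) (N : nat).
Hypothesis DD : forall a b : P, D (a + b) = D a + D b.
Hypothesis DZ : forall c (a : P), D (fpsC c * a) = fpsC c * D a.
Hypothesis D_leading : forall n (a : P), (forall i, (i < n.+2)%N -> a i = 0) -> D a n = l n * a n.+2.
Hypothesis l_neq0 : forall n, (N <= n)%N -> l n != 0.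

Let mono c k : P := fpsC c * fps_poly 'X^k.

Let monoE c k n : mono c k n = c * (n == k)%:R.
Proof. by rewrite fpsCM /= coefXn. Qed.

(** Stage k adds a multiple of t^(N + k + 2) to cancel coefficient N + k of the image under D;
    earlier coefficients of the image do not change. *)
Fixpoint correction (y : P) k : P :=
  if k is k'.+1 then
    let y' := correction y k' in y' + mono (- D y' (N + k')%N / l (N + k')%N) (N + k').+2
  else y.

Lemma correctionS y k : correction y k.+1 = correction y k
  + mono (- D (correction y k) (N + k)%N / l (N + k)%N) (N + k).+2.
Proof. by []. Qed.

Lemma correction_coef (y : P) k i : (i < (N + k).+2)%N ->
  forall m, (k <= m)%N -> correction y m i = correction y k i.
Proof.
move=> ik m /subnK <-; elim: (m - k)%N => // d IH.
rewrite addSn correctionS fpsD monoE IH (_ : (i == _) = false) ?mulr0 ?addr0 //.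
by apply/eqP; lia.
Qed.

(** The stages stabilise coefficientwise, and y' is their limit. The difference between y' and stage
    k + 1 is of order too high to affect coefficient N + k of the image. *)
Lemma exists_tail_solution (y : P) : exists y' : P,
  (forall i, (i < N.+2)%N -> y' i = y i) /\ forall n, (N <= n)%N -> D y' n = 0.
Proof.
pose y' : P := Fps (fun n => correction y n n).
have y'E k i : (i < (N + k).+2)%N -> y' i = correction y k i.
  move=> ik; rewrite /=; have [ki|ik'] := leqP k i.
    exact: correction_coef ik _ ki.
  by apply/esym/correction_coef; [lia | exact: ltnW].
exists y'; split=> [i iN|n Nn]; first by rewrite (y'E 0%N) // addn0.
rewrite -(subnKC Nn); set k := (n - N)%N.
pose z := correction y k.+1.
rewrite -[y'](subrK z) DD fpsD [X in X + _]D_leading; last first.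
  by move=> i ik; rewrite fpsD fpsN (y'E k.+1) ?subrr //; lia.
rewrite fpsD fpsN (y'E k.+1) ?subrr ?mulr0 ?add0r; last by lia.
rewrite /z correctionS DD fpsD [X in _ + X]D_leading; last first.
  by move=> i ik; rewrite monoE (_ : (i == _) = false) ?mulr0 //; apply/eqP; lia.
by rewrite monoE eqxx mulr1 mulrC divfK ?addrN // l_neq0 // leq_addr.
Qed.

(** The first N + 2 coefficients are free, and only the N conditions on coefficients below N remain,
    so at least two dimensions of solutions are left. *)
Lemma two_solutions : exists f1 f2 : P, [/\ D f1 = 0, D f2 = 0
  & forall c1 c2, fpsC c1 * f1 + fpsC c2 * f2 = 0 -> c1 = 0 /\ c2 = 0].
Proof.
have /choice[y yP] : forall i : 'I_N.+2, exists y' : P,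
    (forall k, (k < N.+2)%N -> y' k = (k == i)%:R) /\ forall n, (N <= n)%N -> D y' n = 0.
  move=> i; have [y' [y'E y'D]] := exists_tail_solution (fps_poly 'X^i).
  by exists y'; split=> // k kN; rewrite y'E //= coefXn.
pose Q : 'M[C]_(N.+2, N) := \matrix_(i, n) D (y i) n.
have [R [RQ Rfree]] : exists R : 'M[C]_(2, N.+2), R *m Q = 0 /\ row_free R.
  have rk : (2 <= \rank (kermx Q))%N.
    by rewrite mxrank_ker leq_subRL; have := rank_leq_col Q; lia.
  exists (pid_mx 2 *m row_base (kermx Q)); split.
    have e : row_base (kermx Q) *m Q = 0 by apply/sub_kermxP; rewrite eq_row_base.
    by rewrite -mulmxA e mulmx0.
  by rewrite /row_free mxrankMfree ?row_base_free // rank_pid_mx.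
pose f j : P := \sum_i fpsC (R j i) * y i.
have D0 : D 0 = 0 by apply: (addrI (D 0)); rewrite -DD !addr0.
have Dsum (I : Type) (s : seq I) (g : I -> P) : D (\sum_(i <- s) g i) = \sum_(i <- s) D (g i).
  by elim/big_rec2: _ => // i a b _ <-; rewrite DD.
have sumE (I : Type) (s : seq I) (g : I -> P) n : (\sum_(i <- s) g i : P) n = \sum_(i <- s) g i n.
  by elim/big_rec2: _ => // i a b _ <-.
have Df j : D (f j) = 0.
  apply: fps_ext => n; rewrite Dsum sumE fps0.
  under eq_bigr => i _ do rewrite DZ fpsCM.
  have [Nn|nN] := leqP N n.
    by rewrite big1 // => i _; have [_ ->] := yP i; rewrite ?mulr0.
  have /matrixP/(_ j (Ordinal nN)) := RQ; rewrite !mxE => e; rewrite -[RHS]e.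
  by apply: eq_bigr => i _; rewrite mxE.
have fE j (k : 'I_N.+2) : f j k = R j k.
  rewrite sumE (bigD1 k) // big1 => [|i ik].
    by apply: etrans (addr0 _) _; rewrite fpsCM (yP k).1 // eqxx mulr1.
  by rewrite fpsCM (yP i).1 // eq_sym -val_eqE in ik *; rewrite (negbTE ik) mulr0.
exists (f 0), (f 1); split=> // c1 c2 fc.
pose c : 'rV[C]_2 := \row_j (if j == 0 then c1 else c2).
have cR : c *m R = 0.
  apply/matrixP=> i k; rewrite !mxE !big_ord_recl big_ord0 addr0 !mxE /=.
  have := congr1 (fun a : P => a k) fc; rewrite fps0 fpsD !fpsCM !fE => e.
  by rewrite -[RHS]e; congr (_ + _ * R _ _); apply: val_inj.
have c0 : c = 0 by apply: (row_free_inj Rfree); rewrite cR mul0mx.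
split; first by have /matrixP/(_ 0 0) := c0; rewrite !mxE.
by have /matrixP/(_ 0 1) := c0; rewrite !mxE.
Qed.
End TriangularOperator.

Section HypergeometricSeries.
Variable C : fieldType.
Hypothesis ch0 : [pchar C] =i pred0.
Local Notation P := (fps C).

Definition fpsZ : P := fps_poly ('X + 1%:P).
Definition fth (a : P) : P := fpsZ * fps_der a.

Lemma fpsZE : fpsZ = fpsX C + 1.
Proof. exact: (rmorphD (@fps_poly C) 'X 1%:P). Qed.

Lemma fthE (a : P) n : fth a n = a n.+1 *+ n.+1 + a n *+ n.
Proof. by rewrite /fth fpsZE mulrDl mul1r fpsD fpsX_der addrC. Qed.

Lemma fthD (a b : P) : fth (a + b) = fth a + fth b.
Proof. by rewrite /fth fps_derD mulrDr. Qed.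

Lemma fthC c (a : P) : fth (fpsC c * a) = fpsC c * fth a.
Proof.
apply: fps_ext => n; rewrite fpsCM !fthE !fpsCM.
by rewrite -!mulrnAr -mulrDr.
Qed.

Definition fth_add c (a : P) : P := fth a + fpsC c * a.

Definition fps_hyper a1 a2 a3 b1 b2 b3 (a : P) : P :=
  fth_add (b1 - 1) (fth_add (b2 - 1) (fth_add (b3 - 1) a))
  - fpsZ * fth_add a1 (fth_add a2 (fth_add a3 a)).

Lemma fth_add3 c1 c2 c3 (a : P) : fth_add c1 (fth_add c2 (fth_add c3 a)) =
  fth (fth (fth a)) + (fpsC c1 + fpsC c2 + fpsC c3) * fth (fth a)
  + (fpsC c1 * fpsC c2 + fpsC c1 * fpsC c3 + fpsC c2 * fpsC c3) * fth a
  + fpsC c1 * fpsC c2 * fpsC c3 * a.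
Proof. by rewrite /fth_add !(fthD, fthC); ring. Qed.

Lemma fps_hyperD a1 a2 a3 b1 b2 b3 (a b : P) : fps_hyper a1 a2 a3 b1 b2 b3 (a + b) =
  fps_hyper a1 a2 a3 b1 b2 b3 a + fps_hyper a1 a2 a3 b1 b2 b3 b.
Proof. by rewrite /fps_hyper !fth_add3 !fthD; ring. Qed.

Lemma fps_hyperZ a1 a2 a3 b1 b2 b3 c (a : P) : fps_hyper a1 a2 a3 b1 b2 b3 (fpsC c * a) =
  fpsC c * fps_hyper a1 a2 a3 b1 b2 b3 a.
Proof. by rewrite /fps_hyper !fth_add3 !fthC; ring. Qed.

(** Minus the indicial polynomial at z = 1, taken at n + 2. Its roots are the local exponents 0, 1
    and (b1 + b2 + b3) - (a1 + a2 + a3) - 1. *)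
Definition hyper_leading a1 a2 a3 b1 b2 b3 n : C :=
  (((b1 - 1) + (b2 - 1) + (b3 - 1)) - (a1 + a2 + a3) - n%:R) * (n.+2%:R * n.+1%:R).

(** The coefficient 1 - z = -t of the third power of theta regains one order, so the operator lowers
    orders by two and not by three. *)
Lemma fps_hyper_leading a1 a2 a3 b1 b2 b3 n (a : P) : (forall i, (i < n.+2)%N -> a i = 0) ->
  fps_hyper a1 a2 a3 b1 b2 b3 a n = hyper_leading a1 a2 a3 b1 b2 b3 n * a n.+2.
Proof.
move=> av.
have t1v i : (i < n.+1)%N -> fth a i = 0.
  by move=> ?; rewrite fthE !av ?mul0rn ?addr0 //; lia.
have t1n : fth a n.+1 = a n.+2 *+ n.+2 by rewrite fthE [a n.+1]av // mul0rn addr0.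
have t2v i : (i < n)%N -> fth (fth a) i = 0.
  by move=> ?; rewrite fthE !t1v ?mul0rn ?addr0 //; lia.
have t2n : fth (fth a) n = a n.+2 *+ n.+2 *+ n.+1.
  by rewrite fthE [fth a n]t1v // mul0rn addr0 t1n.
have t3n : (fpsX C * fth (fth (fth a))) n = fth (fth a) n *+ n.
  rewrite fpsXM; case: (n) t2v => [|m] t2v; first by rewrite mulr0n.
  by rewrite fthE [fth (fth a) m]t2v // mul0rn addr0.
have Xv (b : P) : (forall i, (i < n)%N -> b i = 0) -> (fpsX C * b) n = 0.
  by rewrite fpsXM; case: (n) => // m; apply.
have fpsCD c c' : fpsC c + fpsC c' = fpsC (c + c') :> P.
  by rewrite /fpsC -(rmorphD (@fps_poly C)) -polyCD.
have fpsCMC c c' : fpsC c * fpsC c' = fpsC (c * c') :> P.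
  by rewrite /fpsC -(rmorphM (@fps_poly C)) -polyCM.
rewrite /fps_hyper !fth_add3 !(fpsCD, fpsCMC) fpsZE.
set A2 := a1 + a2 + a3; set B2 := b1 - 1 + (b2 - 1) + (b3 - 1).
set B1 := _ + (b2 - 1) * (b3 - 1); set B0 := _ * (b3 - 1).
set A1 := _ + a2 * a3; set A0 := a1 * a2 * a3.
have XA : (fpsX C * (fpsC A2 * fth (fth a) + fpsC A1 * fth a + fpsC A0 * a)) n = 0.
  apply: Xv => i ni; rewrite !fpsD !fpsCM t2v // t1v ?av; try lia.
  by rewrite !mulr0 !addr0.
rewrite (_ : _ - _ = - (fpsX C * fth (fth (fth a)))
  + (fpsC B2 * fth (fth a) - fpsC A2 * fth (fth a)) + (fpsC B1 * fth a - fpsC A1 * fth a)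
  + (fpsC B0 * a - fpsC A0 * a)
  - fpsX C * (fpsC A2 * fth (fth a) + fpsC A1 * fth a + fpsC A0 * a)); last by ring.
rewrite !(fpsD, fpsN) XA t3n !fpsCM t1v // [a n]av; last by lia.
by rewrite t2n /hyper_leading -/A2 -/B2; ring.
Qed.

Lemma hyper_leading_neq0 a1 a2 a3 b1 b2 b3 :
  exists N, forall n, (N <= n)%N -> hyper_leading a1 a2 a3 b1 b2 b3 n != 0.
Proof.
rewrite /hyper_leading; set x := _ - (a1 + a2 + a3).
have nz n : x != n%:R -> (x - n%:R) * (n.+2%:R * n.+1%:R) != 0.
  by move=> xn; rewrite !mulf_neq0 ?subr_eq0 // pchar0_natr_neq0.
have [[n0 xn0]|xn] := pselect (exists n, x = n%:R).
  exists n0.+1 => n nn0; apply: nz; rewrite xn0; apply/eqP => /(natr_inj ch0).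
  by move=> e; rewrite e ltnn in nn0.
by exists 0%N => n _; apply: nz; apply/eqP => e; apply: xn; exists n.
Qed.

Lemma kappa_ratvar : kappa (ratvar C) = fpsZ%:F.
Proof. by rewrite [LHS]kappa_tofrac /taylor1 comp_polyX. Qed.

Lemma theta_tofrac (a : P) : theta (kappa (C := C)) a%:F = (fth a)%:F.
Proof.
rewrite /theta der_tofrac [RHS]tofracM; congr (_ * _); exact: kappa_ratvar.
Qed.

Lemma theta_add_tofrac c (a : P) :
  theta_add (kappa (C := C)) c a%:F = (fth_add c a)%:F.
Proof.
rewrite /theta_add theta_tofrac [RHS]tofracD [(fpsC c * a)%:F]tofracM.
by congr (_ + _ * _); exact: kappa_cst.
Qed.

Lemma two_power_series_solutions a1 a2 a3 b1 b2 b3 : exists f1 f2 : P,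
  [/\ hypergeometric_sol (kappa (C := C)) a1 a2 a3 b1 b2 b3 f1%:F,
      hypergeometric_sol (kappa (C := C)) a1 a2 a3 b1 b2 b3 f2%:F
    & forall c1 c2, kappa (ratcst c1) * f1%:F + kappa (ratcst c2) * f2%:F = 0 ->
        c1 = 0 /\ c2 = 0].
Proof.
have [N lN] := hyper_leading_neq0 a1 a2 a3 b1 b2 b3.
have [f1 [f2 [f1P f2P f12]]] := two_solutions (fps_hyperD a1 a2 a3 b1 b2 b3)
  (fps_hyperZ a1 a2 a3 b1 b2 b3) (fps_hyper_leading a1 a2 a3 b1 b2 b3) lN.
have sol (f : P) : fps_hyper a1 a2 a3 b1 b2 b3 f = 0 ->
    hypergeometric_sol (kappa (C := C)) a1 a2 a3 b1 b2 b3 f%:F.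
  move=> fP; rewrite /hypergeometric_sol /= !theta_add_tofrac.
  rewrite -[RHS]tofrac0 -fP tofracB [(fpsZ * _)%:F]tofracM; congr (_ - _ * _).
  exact: kappa_ratvar.
exists f1, f2; split; [exact: sol | exact: sol | move=> c1 c2].
rewrite !kappa_cst -!tofracM -tofracD => /eqP; rewrite tofrac_eq0 => /eqP.
exact: f12.
Qed.
End HypergeometricSeries.

(** * Local embeddings and inertia *)

Section PolynomialDerivation.
Variables (K E : diffFieldType) (j : {rmorphism K -> E}).
Hypothesis j_der : {morph j : a / der a}.

Lemma coef_map_der (p : {poly K}) i : (map_poly (@der K) p)`_i = der p`_i.
Proof. by rewrite coef_map_id0 ?der0. Qed.

Lemma map_derD (p q : {poly K}) :
  map_poly (@der K) (p + q) = map_poly (@der K) p + map_poly (@der K) q.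
Proof. by apply/polyP => i; rewrite coefD !coef_map_der coefD derD. Qed.

Lemma map_derM (p q : {poly K}) :
  map_poly (@der K) (p * q) = map_poly (@der K) p * q + p * map_poly (@der K) q.
Proof.
apply/polyP => i; rewrite coefD !coef_map_der !coefM raddf_sum -big_split.
by apply: eq_bigr => h _; rewrite /= derM !coef_map_der.
Qed.

Lemma der_horner (p : {poly K}) (z : E) : der (map_poly j p).[z] =
  (map_poly j (map_poly (@der K) p)).[z] + (map_poly j p^`()).[z] * der z.
Proof.
elim/poly_ind: p => [|p c IH].
  by rewrite deriv0 !rmorph0 map_poly0 rmorph0 horner0 der0 mul0r addr0.
have mX : map_poly (@der K) 'X = 0.
  apply/polyP => i; rewrite coef_map_der coefX coef0.
  by case: (_ == _); rewrite ?der0 ?der1.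
have mC : map_poly (@der K) c%:P = (der c)%:P.
  by apply/polyP => i; rewrite coef_map_der !coefC; case: (_ == _); rewrite ?der0.
rewrite derivD derivC addr0 derivM derivX mulr1 map_derD map_derM mX mC mulr0 addr0.
rewrite !rmorphD !rmorphM /= !map_polyX !map_polyC /= !hornerE derD derM IH j_der.
by ring.
Qed.
End PolynomialDerivation.

Lemma irreducible_dvd_root (F E : fieldType) (j : {rmorphism F -> E}) (q : {poly F}) (z : E) :
  irreducible_poly q -> root (map_poly j q) z ->
  forall r, root (map_poly j r) z -> q %| r.
Proof.
move=> qirr qz r rz; have [co|] := boolP (coprimep q r).
  have /coprimep_root/(_ qz) : coprimep (map_poly j q) (map_poly j r).
    by rewrite coprimep_map.
  by rewrite (eqP rz) eqxx.
rewrite irreducible_poly_coprime // negbK; exact.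
Qed.

Lemma irreducible_deriv_neq0 (F E : fieldType) (j : {rmorphism F -> E}) (q : {poly F}) (z : E) :
  [pchar F] =i pred0 -> irreducible_poly q -> root (map_poly j q) z ->
  (map_poly j q^`()).[z] != 0.
Proof.
move=> ch0 qirr qz; apply/negP => dz.
have q0 : q != 0 by rewrite -size_poly_gt0; apply: ltnW; case: qirr.
have dq : q^`() = 0.
  apply/eqP; apply: contraT => d0.
  by have := dvdp_leq d0 (irreducible_dvd_root qirr qz dz); rewrite leqNgt lt_size_deriv.
case: qirr => sq _; have := congr1 (fun p : {poly F} => p`_(size q).-2) dq.
rewrite coef_deriv coef0 => /eqP; rewrite -mulr_natr mulf_eq0 (negbTE (pchar0_natr_neq0 _ ch0)) orbF.
rewrite prednK; last by move: sq; case: (size q) => [|[]].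
by rewrite -lead_coefE lead_coef_eq0 (negbTE q0).
Qed.

Section AlgebraicExtension.
Variables (F : diffFieldType) (q : {poly F}).
Hypotheses (ch0 : [pchar F] =i pred0) (qirr : irreducible_poly q).

(** Only one derivation is possible on F(z): q(z) = 0 determines z', since q'(z) is nonzero in
    characteristic 0. It is well defined because it sends multiples of q to 0. *)
Lemma exists_differential_extension : exists (E : diffFieldType) (j : {rmorphism F -> E}) (z : E),
  [/\ {morph j : a / der a}, root (map_poly j q) z &
      forall e : E, exists2 p : {poly F}, p != 0 & root (map_poly j p) e].
Proof.
have [E _ [z qz zgen]] := irredp_FAdjoin qirr.
pose j : {rmorphism F -> E} := GRing.in_alg E.
pose ev (r : {poly F}) : E := (map_poly j r).[z].
have evD r1 r2 : ev (r1 + r2) = ev r1 + ev r2 by rewrite /ev rmorphD hornerD.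
have evM r1 r2 : ev (r1 * r2) = ev r1 * ev r2 by rewrite /ev rmorphM hornerM.
have ev0 r : ev r = 0 -> q %| r.
  by move=> rz; apply: (irreducible_dvd_root (j := j) qirr qz); apply/eqP.
have evq : ev q = 0 by apply/eqP.
have dq0 := irreducible_deriv_neq0 (j := j) ch0 qirr qz.
pose s := - ev (map_poly (@der F) q) / ev q^`().
pose Del r := ev (map_poly (@der F) r) + ev r^`() * s.
have DelD r1 r2 : Del (r1 + r2) = Del r1 + Del r2.
  by rewrite /Del map_derD derivD !evD; ring.
have DelM r1 r2 : Del (r1 * r2) = Del r1 * ev r2 + ev r1 * Del r2.
  by rewrite /Del map_derM derivM !(evD, evM); ring.
have Delq : Del q = 0.
  by rewrite /Del /s mulrC divfK ?addrN.
have Del_wd r1 r2 : ev r1 = ev r2 -> Del r1 = Del r2.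
  move=> e; rewrite -[r1](subrK r2) DelD.
  have /ev0/dvdpP[h ->] : ev (r1 - r2) = 0.
    by rewrite /ev rmorphB hornerD hornerN -/(ev _) -/(ev r2) e subrr.
  by rewrite DelM Delq evq !mulr0 addr0 add0r.
have /choice[S SP] : forall e : E, exists r, ev r = e.
  move=> e; have : e \in <<1; z>>%VS by rewrite zgen memvf.
  move=> /Fadjoin_polyP[p /polyOver1P[r ->] ->].
  by exists r.
pose dE e := Del (S e).
have dED : {morph dE : x y / x + y}.
  by move=> x y; rewrite /dE -DelD; apply: Del_wd; rewrite evD !SP.
have dEM x y : dE (x * y) = dE x * y + x * dE y.
  have -> : dE x * y + x * dE y = Del (S x) * ev (S y) + ev (S x) * Del (S y).
    by rewrite !SP.
  by rewrite -DelM; apply: Del_wd; rewrite evM !SP.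
pose E0 : fieldType := E.
pose E' : diffFieldType := HB.pack E0 (Field_isDifferential.Build E0 dED dEM).
pose j' : {rmorphism F -> E'} := j.
exists E', j', z; split=> [a||e].
- have -> : der (j' a) = dE (j a) by [].
  have -> : j a = ev a%:P by rewrite /ev map_polyC hornerC.
  rewrite /dE (Del_wd _ a%:P) ?SP // /Del derivC.
  have -> : map_poly (@der F) a%:P = (der a)%:P.
    by apply/polyP => i; rewrite coef_map_der !coefC; case: (_ == _); rewrite ?der0.
  by rewrite /ev map_polyC hornerC rmorph0 horner0 mul0r addr0.
- exact: qz.
have /polyOver1P[p pE] := minPolyOver 1 e.
exists p; last by have := root_minPoly 1 e; rewrite pE.
by have := monic_neq0 (monic_minPoly 1 e); rewrite pE map_poly_eq0.
Qed.
End AlgebraicExtension.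

(** Deriving the coefficients of the monic minimal polynomial of e gives a polynomial of smaller
    degree vanishing at e, hence 0. So the coefficients come from C, where the polynomial splits. *)
Lemma constant_of_algebraic (C : closedFieldType) (F E : diffFieldType)
    (c : {rmorphism C -> F}) (j : {rmorphism F -> E}) :
  {morph j : a / der a} -> (forall x : F, der x = 0 -> exists a, x = c a) ->
  forall (p : {poly F}) (e : E), p != 0 -> root (map_poly j p) e -> der e = 0 ->
  exists a, e = j (c a).
Proof.
move=> jd Fconst p e p0 pe de.
pose Q m := `[< exists r : {poly F}, [/\ r \is monic, size r = m & root (map_poly j r) e] >].
have exQ : exists m, Q m.
  exists (size ((lead_coef p)^-1 *: p)); apply/asboolP; exists ((lead_coef p)^-1 *: p).
  split=> //; first by rewrite monicE lead_coefZ mulVf // lead_coef_eq0.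
  by rewrite /root map_polyZ hornerZ (eqP pe) mulr0.
case: (ex_minnP exQ) => m /asboolP[r [rmon sr re]] rmin.
have small s : root (map_poly j s) e -> (size s < m)%N -> s = 0.
  move=> se sm; apply/eqP; apply: contraLR sm => s0; rewrite -leqNgt.
  rewrite -(size_scale s (_ : (lead_coef s)^-1 != 0)) ?invr_neq0 ?lead_coef_eq0 //.
  apply: rmin; apply/asboolP; exists ((lead_coef s)^-1 *: s).
  split=> //; first by rewrite monicE lead_coefZ mulVf // lead_coef_eq0.
  by rewrite /root map_polyZ hornerZ (eqP se) mulr0.
have r0 : r != 0 by apply: monic_neq0.
have dr : map_poly (@der F) r = 0.
  apply: small.
    have := der_horner jd r e; rewrite de mulr0 addr0 (eqP re) der0 => e0.
    by rewrite /root -e0.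
  rewrite -sr; apply: (@leq_ltn_trans (size r).-1); last by rewrite ltn_predL size_poly_gt0.
  apply/leq_sizeP => i ri; rewrite coef_map_der.
  move: ri; rewrite leq_eqVlt => /orP[/eqP <-|ri].
    by rewrite -lead_coefE (monicP rmon) der1.
  by rewrite nth_default ?der0 //; move: ri; case: (size r).
have /choice[a ra] : forall i, exists a, r`_i = c a.
  by move=> i; apply: Fconst; rewrite -coef_map_der dr coef0.
pose r' : {poly C} := \poly_(i < size r) a i.
have rE : r = map_poly c r'.
  apply/polyP => i; rewrite coef_map coef_poly ra; case: ltnP => // ri.
  by rewrite -ra nth_default //; apply/esym/(rmorph0 c).
have [rs rsE] := closed_field_poly_normal r'.
have r'0 : r' != 0 by apply: contraNneq r0 => e0; rewrite rE e0 rmorph0.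
move: re; rewrite rE rsE -map_poly_comp map_polyZ rootZ ?fmorph_eq0 ?lead_coef_eq0 //.
rewrite rmorph_prod /root horner_prod prodf_seq_eq0 => /hasP[x _ /=].
rewrite rmorphB /= map_polyX map_polyC hornerXsubC subr_eq0 => /eqP ->.
by exists x.
Qed.

Section DiffGalMorphism.
Variables (K L : diffFieldType) (iota : {rmorphism K -> L}) (s : diffGal iota).

Lemma diffGal_zmod_morphism : zmod_morphism s.
Proof. by have [] := dgvalP s. Qed.
Lemma diffGal_monoid_morphism : GRing.monoid_morphism s.
Proof. by have [] := dgvalP s. Qed.

HB.instance Definition _ := GRing.isZmodMorphism.Build L L (dgval s) diffGal_zmod_morphism.
HB.instance Definition _ := GRing.isMonoidMorphism.Build L L (dgval s) diffGal_monoid_morphism.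

Lemma diffGal_der : {morph s : x / der x}.
Proof. by have [] := dgvalP s. Qed.
Lemma diffGal_base a : s (iota a) = iota a.
Proof. by have [] := dgvalP s. Qed.

Lemma diffGal_horner (p : {poly K}) x : s (map_poly iota p).[x] = (map_poly iota p).[s x].
Proof.
rewrite -horner_map -map_poly_comp; congr _.[_].
by apply/polyP => i; rewrite !coef_map; exact: diffGal_base.
Qed.
End DiffGalMorphism.

Section GaloisData.
Variables (K L : diffFieldType) (iota : {rmorphism K -> L}).
Local Notation G := (diffGal iota).
Variable l : seq G.
Hypotheses (ch0 : [pchar L] =i pred0) (lall : forall g, g \in l) (luniq : uniq l).
Hypothesis fixed : forall x : L, (forall s : G, s x = x) -> exists a, x = iota a.

Lemma diffGal_perm (k : G) : perm_eq [seq (k * g)%g | g <- l] l.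
Proof.
apply: uniq_perm => //.
  by rewrite map_inj_uniq // => g h; apply: mulgI.
move=> g; rewrite lall; apply/mapP; exists (k^-1 * g)%g => //.
by rewrite mulgA mulgV mul1g.
Qed.

Lemma fixed_poly (p : {poly L}) : (forall s : G, map_poly s p = p) ->
  exists q, p = map_poly iota q.
Proof.
move=> pfix; have /choice[a pa] : forall i, exists a, p`_i = iota a.
  by move=> i; apply: fixed => s; rewrite -{2}(pfix s) coef_map.
exists (\poly_(i < size p) a i); apply/polyP => i.
rewrite coef_map coef_poly; case: ltnP => [_|ip]; first exact: pa.
by rewrite nth_default //; apply/esym/(rmorph0 iota).
Qed.

(** A primitive element: x is the sum of the y_j m^j, with m a natural number avoiding the roots of
    the nonzero polynomials with coefficients g(y_j) - y_j, for g other than 1. *)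
Lemma exists_distinct_conjugates n (y : 'I_n -> L) :
  (forall g : G, (forall j, g (y j) = y j) -> g = 1%g) ->
  exists x : L, injective (fun g : G => g x).
Proof.
move=> yfaith.
pose P (g : G) : {poly L} := \sum_j (g (y j) - y j) *: 'X^j.
have P0 g : g != 1%g -> P g != 0.
  move=> g1; apply: contraNneq g1 => Pg; apply/eqP/yfaith => j; apply/eqP.
  rewrite -subr_eq0; have := congr1 (fun p : {poly L} => p`_j) Pg; rewrite coef0 => <-.
  rewrite coef_sum (bigD1 j) //= coefZ coefXn eqxx mulr1 big1 ?addr0 // => i ij.
  by move: ij; rewrite -val_eqE /= eq_sym coefZ coefXn => /negbTE ->; rewrite mulr0.
pose Q := \prod_(g <- l | g != 1%g) P g.
have Q0 : Q != 0 by rewrite prodf_seq_neq0; apply/allP => g _; apply/implyP/P0.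
have [m Qm] : exists m : nat, Q.[m%:R] != 0.
  apply: contrapT => /forallNP noroot.
  have := @max_poly_roots _ Q [seq m%:R | m <- seq.iota 0 (size Q)] Q0.
  rewrite size_map size_iota ltnn => h; suff: false by []; apply: h.
    apply/allP => _ /mapP[m _ ->]; have := noroot m; rewrite /root.
    by move=> /negP; rewrite negbK.
  by rewrite map_inj_uniq ?iota_uniq // => i j; apply: natr_inj.
pose x := \sum_j y j * m%:R ^+ j.
have gx (g : G) : g x - x = (P g).[m%:R].
  rewrite /x rmorph_sum horner_sum -sumrB; apply: eq_bigr => j _.
  by rewrite /= rmorphM rmorphXn rmorph_nat hornerZ hornerXn mulrBl.
have x1 (g : G) : g x = x -> g = 1%g.
  move=> gxx; apply/eqP; apply: contraT => g1; case/negP: Qm.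
  rewrite horner_prod prodf_seq_eq0; apply/hasP; exists g => //.
  by rewrite g1 -gx gxx subrr /=.
exists x => g h /= e; have : (h^-1 * g)%g x = x.
  have -> : (h^-1 * g)%g x = (h^-1)%g (g x) by [].
  by rewrite e -[LHS]/((h^-1 * h)%g x) mulVg.
by move=> /x1 e1; rewrite -[g]mul1g -(mulgV h) -mulgA e1 mulg1.
Qed.

Variable x : L.
Hypothesis x_inj : injective (fun g : G => g x).

Lemma exists_conjugates_poly : exists p : {poly K},
  map_poly iota p = \prod_(g <- l) ('X - (g x)%:P).
Proof.
have [|p pE] := @fixed_poly (\prod_(g <- l) ('X - (g x)%:P)); last by exists p.
move=> s; rewrite rmorph_prod /= -[RHS](perm_big _ (diffGal_perm s)) big_map.
by apply: eq_bigr => g _; rewrite rmorphB /= map_polyX map_polyC.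
Qed.

(** The Lagrange polynomial sending each g x to g u is invariant under the group, so its
    coefficients lie in K. *)
Lemma exists_interpolation u : exists s : {poly K}, u = (map_poly iota s).[x].
Proof.
pose F (g h : G) : {poly L} := (g x - h x)^-1 *: ('X - (h x)%:P).
pose T (g : G) : {poly L} := (g u) *: \prod_(h <- l | h != g) F g h.
have [k|s sE] := @fixed_poly (\sum_(g <- l) T g).
  rewrite raddf_sum /= -[RHS](perm_big _ (diffGal_perm k)) big_map.
  apply: eq_bigr => g _; rewrite /T -[LHS]/(map_poly k (T g)) [LHS]map_polyZ; congr (_ *: _).
  rewrite rmorph_prod -[RHS](perm_big _ (diffGal_perm k)) big_map.
  apply: eq_big => h; first by rewrite (inj_eq (@mulgI _ k)).
  move=> _; rewrite -[LHS]/(map_poly k (F g h)) [LHS]map_polyZ fmorphV rmorphB.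
  by rewrite rmorphB /= map_polyX map_polyC.
exists s; rewrite -sE horner_sum (bigD1_seq 1%g) //= [X in _ + X]big1 => [|g g1].
  rewrite addr0 hornerZ horner_prod big1 ?mulr1 // => h h1.
  rewrite hornerZ hornerXsubC mulVf // subr_eq0.
  by apply: contra h1 => /eqP/x_inj ->.
rewrite hornerZ horner_prod; apply/eqP; rewrite mulf_eq0 prodf_seq_eq0.
apply/orP; right; apply/hasP; exists 1%g => //.
by rewrite eq_sym g1 hornerZ hornerXsubC subrr mulr0 eqxx.
Qed.
End GaloisData.

Lemma solution_coordinates_constant (E : diffFieldType) n k (A U : 'M[E]_n) (f : 'M[E]_(n, k)) :
  U \in unitmx -> map_mx der U = A *m U -> map_mx der f = A *m f ->
  map_mx der (invmx U *m f) = 0.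
Proof.
move=> uU dU df; rewrite -[LHS](mulKmx uU).
have -> : U *m map_mx der (invmx U *m f) = 0; last by rewrite mulmx0.
have := der_mulmx U (invmx U *m f); rewrite mulKVmx // df dU.
by rewrite -[A *m U *m _]mulmxA mulKVmx // -[X in X = _]addr0 => /addrI.
Qed.

Lemma exists_irreducible_factor (F : fieldType) (P : {poly F}) : (1 < size P)%N ->
  exists2 q, irreducible_poly q & q %| P.
Proof.
move=> sP; pose Q m := `[< exists q : {poly F}, [/\ (1 < size q)%N, size q = m & q %| P] >].
have exQ : exists m, Q m by exists (size P); apply/asboolP; exists P.
case: (ex_minnP exQ) => m /asboolP[q [q1 sq qP]] qmin.
exists q => //; split=> // d d1 dq.
have q0 : q != 0 by rewrite -size_poly_gt0; apply: ltnW.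
have d0 : d != 0 by apply: contraTneq dq => ->; rewrite dvd0p.
rewrite -dvdp_size_eqp //; apply/eqP/anti_leq; rewrite dvdp_leq //= sq.
apply: qmin; apply/asboolP; exists d; split=> //; last exact: dvdp_trans qP.
by rewrite ltn_neqAle eq_sym d1 size_poly_gt0.
Qed.

Section Embedding.
Variables (K L : diffFieldType) (iota : {rmorphism K -> L}).
Local Notation G := (diffGal iota).
Variable l : seq G.
Hypotheses (lall : forall g, g \in l) (luniq : uniq l).
Hypothesis iota_der : {morph iota : a / der a}.
Variables (x : L) (p : {poly K}).
Hypothesis x_inj : injective (fun g : G => g x).
Hypothesis pE : map_poly iota p = \prod_(g <- l) ('X - (g x)%:P).
Hypothesis interp : forall u, exists s : {poly K}, u = (map_poly iota s).[x].

(** The group fixes the coefficients of s, so s vanishes at all the g x, which are distinct. *)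
Lemma conjugates_poly_dvd s : (map_poly iota s).[x] = 0 -> p %| s.
Proof.
move=> sx; rewrite -(dvdp_map iota) pE -(big_map (fun g : G => g x) xpredT (fun a => 'X - a%:P)).
apply/dvdpP; have [||q ->] := @uniq_roots_prod_XsubC _ (map_poly iota s) [seq g x | g : G <- l].
- apply/allP => _ /mapP[g _ ->]; rewrite /root -diffGal_horner sx.
  by apply/eqP; exact: (rmorph0 g).
- by rewrite uniq_rootsE map_inj_uniq.
by exists q.
Qed.

Lemma conjugates_poly_deriv : (map_poly iota p^`()).[x] != 0.
Proof.
rewrite -deriv_map pE (bigD1_seq 1%g) //= derivM derivXsubC mul1r hornerD hornerM.
rewrite hornerXsubC subrr mul0r addr0 horner_prod prodf_seq_neq0.
apply/allP => g _; apply/implyP => g1; rewrite hornerXsubC subr_eq0.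
by apply: contra g1 => /eqP e; apply/eqP/x_inj.
Qed.

(** L is K[x] and p divides every polynomial vanishing at x, so x may be sent to any root z.
    Deriving p(x) = 0 and p(z) = 0 gives the same formula for x' and z', as p'(x) is nonzero. *)
Lemma exists_embedding (E : diffFieldType) (j : {rmorphism K -> E}) (z : E) :
  {morph j : a / der a} -> root (map_poly j p) z ->
  exists tau : {rmorphism L -> E},
    [/\ forall a, tau (iota a) = j a, {morph tau : u / der u} & tau x = z].
Proof.
move=> jd pz; have [S SE] := choice interp.
pose ev s := (map_poly iota s).[x]; pose ev' s := (map_poly j s).[z].
have wd0 s : ev s = 0 -> ev' s = 0.
  by move=> /conjugates_poly_dvd/dvdpP[h ->]; rewrite /ev' rmorphM hornerM (eqP pz) mulr0.
have wd s s' : ev s = ev s' -> ev' s = ev' s'.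
  move=> e; apply/eqP; rewrite -subr_eq0 -hornerN -hornerD -rmorphB; apply/eqP/wd0.
  by rewrite /ev rmorphB hornerD hornerN -/(ev s) e subrr.
pose tau u := ev' (S u).
have evS u : ev (S u) = u by rewrite /ev -SE.
have tauE s : tau (ev s) = ev' s by apply: wd; rewrite evS.
have tauB : zmod_morphism tau.
  move=> u v; rewrite -{1}(evS u) -{1}(evS v) -hornerN -hornerD -rmorphB [LHS]tauE.
  by rewrite /ev' rmorphB hornerD hornerN.
have tauM : GRing.monoid_morphism tau.
  split.
    have {1}-> : 1 = ev 1 by rewrite /ev rmorph1 hornerC.
    by rewrite tauE /ev' rmorph1 hornerC.
  move=> u v; rewrite -{1}(evS u) -{1}(evS v) -hornerM -rmorphM [LHS]tauE.
  by rewrite /ev' rmorphM hornerM.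
pose tau' : {rmorphism L -> E} := HB.pack tau
  (GRing.isZmodMorphism.Build _ _ tau tauB) (GRing.isMonoidMorphism.Build _ _ tau tauM).
have ti a : tau' (iota a) = j a.
  have -> : iota a = ev a%:P by rewrite /ev map_polyC hornerC.
  by rewrite [LHS]tauE /ev' map_polyC hornerC.
have tx : tau' x = z.
  have -> : x = ev 'X by rewrite /ev map_polyX hornerX.
  by rewrite [LHS]tauE /ev' map_polyX hornerX.
have tev s u : tau' (map_poly iota s).[u] = (map_poly j s).[tau' u].
  rewrite -horner_map -map_poly_comp; congr _.[_].
  by apply/polyP => i; rewrite !coef_map; exact: ti.
have tdx : tau' (der x) = der z.
  have p0 : (map_poly iota p).[x] = 0.
    apply/eqP; rewrite pE horner_prod prodf_seq_eq0; apply/hasP; exists 1%g => //.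
    by rewrite hornerXsubC subrr eqxx.
  have := der_horner iota_der p x; rewrite p0 der0 => /(congr1 tau').
  rewrite rmorph0 rmorphD rmorphM !tev tx => e1.
  have := der_horner jd p z; rewrite (eqP pz) der0 e1 => /addrI/mulfI; apply.
  by have := conjugates_poly_deriv; rewrite -(fmorph_eq0 tau') tev tx.
exists tau'; split=> // u; have [s ->] := interp u.
by rewrite tev der_horner // rmorphD rmorphM !tev tx tdx der_horner.
Qed.

Variables (C : closedFieldType) (cK : {rmorphism C -> K}).
Variables (F : diffFieldType) (kap : {rmorphism K -> F}).
Hypothesis chF : [pchar F] =i pred0.
Hypothesis kap_der : {morph kap : a / der a}.
Hypothesis F_const : forall y : F, der y = 0 -> exists c, y = kap (cK c).
Variables (n : nat) (A : 'M[K]_n) (Y : 'M[L]_n).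
Hypotheses (uY : Y \in unitmx) (dY : map_mx der Y = map_mx iota A *m Y).

(** B holds the coordinates of the local solutions f in the basis Y, after both are sent to a common
    extension E. The final clause carries linear independence of the columns of f over to those of
    B. *)
Lemma embedding_or_inertia :
  (exists tau : {rmorphism L -> F},
     (forall a, tau (iota a) = kap a) /\ {morph tau : u / der u}) \/
  exists2 g : G, g <> 1%g & forall k (f : 'M[F]_(n, k)), map_mx der f = map_mx kap A *m f ->
    exists B : 'M[C]_(n, k),
      let M := Y *m map_mx (iota \o cK) B in map_mx g M = M /\
      forall v : 'cV[C]_k, B *m v = 0 -> f *m map_mx (kap \o cK) v = 0.
Proof.
pose P := map_poly kap p.
have [[z Pz]|noroot] := pselect (exists z, root P z).
  by left; have [tau [ti td _]] := exists_embedding kap_der Pz; exists tau.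
right; have sP : (1 < size P)%N.
  rewrite size_map_poly -(size_map_poly iota) pE.
  rewrite -(big_map (fun g : G => g x) xpredT (fun a => 'X - a%:P)) size_prod_XsubC size_map.
  by case: (l) (lall 1%g).
have [q qirr qP] := exists_irreducible_factor sP.
(* A factor of degree 1 would give p a root in F. *)
have sq : (2 < size q)%N.
  have [sq _] := qirr; rewrite ltn_neqAle sq andbT eq_sym; apply/eqP => /poly2_root[r qr].
  by apply: noroot; exists r; apply: root_dvdp qr.
have [E [j [z [jd qz Ealg]]]] := exists_differential_extension chF qirr.
have jkd : {morph j \o kap : a / der a} by move=> a /=; rewrite kap_der jd.
have jkE s : map_poly (j \o kap) s = map_poly j (map_poly kap s) by rewrite map_poly_comp.
have pz : root (map_poly (j \o kap) p) z.
  by rewrite jkE; apply: root_dvdp qz; rewrite dvdp_map.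
have [tau [ti td tx]] := exists_embedding (j := j \o kap) jkd pz.
have tev s u : tau (map_poly iota s).[u] = (map_poly (j \o kap) s).[tau u].
  rewrite -horner_map -map_poly_comp; congr _.[_].
  by apply/polyP => i; rewrite !coef_map; exact: ti.
(* Over E, q divides the product of all X - tau (g x). Once X - z, the factor of g = 1, is removed
   from both, the nonconstant cofactor of q still has a root among the others. *)
have [g g1 qg] : exists2 g : G, g != 1%g & root (map_poly j q) (tau (g x)).
  have [q1 q1E] := factor_theorem _ _ qz.
  have sq1 : (1 < size q1)%N.
    have q10 : q1 != 0.
      apply: contraTneq sq => q10; move: q1E; rewrite q10 mul0r => /eqP.
      by rewrite map_poly_eq0 => /eqP ->; rewrite size_poly0.
    have := size_map_poly j q; rewrite q1E size_mul ?polyXsubC_eq0 // size_XsubC addn2 => e.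
    by move: sq; rewrite -e.
  have q1d : q1 %| \prod_(g <- [seq tau (g x) | g : G <- l & g != 1%g]) ('X - g%:P).
    have : map_poly j q %| map_poly (j \o kap) p by rewrite jkE dvdp_map.
    have -> : map_poly (j \o kap) p = map_poly tau (map_poly iota p).
      by rewrite -map_poly_comp; apply/polyP => i; rewrite !coef_map; apply/esym/ti.
    rewrite pE (bigD1_seq 1%g) //= rmorphM rmorphB /= map_polyX map_polyC /= tx.
    rewrite q1E mulrC dvdp_mul2l ?polyXsubC_eq0 // rmorph_prod big_map big_filter.
    by under eq_bigr => g _ do rewrite rmorphB /= map_polyX map_polyC.
  have [m mE] := dvdp_prod_XsubC q1d.
  move: sq1; rewrite (eqp_size mE) size_prod_XsubC ltnS.
  case emask : (mask _ _) => [//|r rs] _.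
  have : r \in [seq tau (g x) | g : G <- l & g != 1%g].
    by apply: (mem_mask (m := m)); rewrite emask mem_head.
  move=> /mapP[g]; rewrite mem_filter => /andP[g1 _] rE; exists g => //.
  rewrite q1E rootM; apply/orP; left; rewrite -rE (eqp_root mE) emask.
  by rewrite root_prod_XsubC mem_head.
exists g; first exact/eqP.
move=> k f df.
pose U := map_mx tau Y; pose f' := map_mx j f.
have uU : U \in unitmx by rewrite map_unitmx.
have dU : map_mx der U = map_mx (j \o kap) A *m U.
  have -> : map_mx der U = map_mx tau (map_mx der Y).
    by apply/matrixP=> a b; rewrite !mxE td.
  rewrite dY map_mxM; congr (_ *m _).
  by apply/matrixP=> a b; rewrite !mxE; exact: ti.
have df' : map_mx der f' = map_mx (j \o kap) A *m f'.
  have -> : map_mx der f' = map_mx j (map_mx der f).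
    by apply/matrixP=> a b; rewrite !mxE jd.
  by rewrite df map_mxM; congr (_ *m _); apply/matrixP=> a b; rewrite !mxE.
have db := solution_coordinates_constant uU dU df'.
have /choice[B' B'E] : forall ab : 'I_n * 'I_k, exists c, (invmx U *m f') ab.1 ab.2 = j (kap (cK c)).
  move=> ab; have [r r0 rr] := Ealg ((invmx U *m f') ab.1 ab.2).
  apply: (constant_of_algebraic (c := kap \o cK) jd F_const r0 rr).
  by have /matrixP/(_ ab.1 ab.2) := db; rewrite !mxE.
pose B : 'M[C]_(n, k) := \matrix_(a, b) B' (a, b).
have BE : invmx U *m f' = map_mx (j \o kap \o cK) B.
  by apply/matrixP=> a b; rewrite [LHS](B'E (a, b)) !mxE.
exists B => M.
have tM : map_mx tau M = map_mx j f.
  rewrite map_mxM -/U -[RHS](mulKVmx uU) -/f' BE; congr (_ *m _).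
  by apply/matrixP=> a b; rewrite !mxE; exact: ti.
split.
  apply/matrixP=> a b; rewrite mxE; apply: (fmorph_inj tau).
  have tMab : tau (M a b) = j (f a b) by have /matrixP/(_ a b) := tM; rewrite !mxE.
  rewrite tMab; have [s sE] := interp (M a b); rewrite sE diffGal_horner tev.
  (* An entry s(x) of M is mapped to f a b, which lies in F, so s - f a b vanishes at z, hence at
     every root of q, in particular at tau (g x). Thus g fixes the entry. *)
  have : q %| map_poly kap s - (f a b)%:P.
    apply: (irreducible_dvd_root (j := j) qirr qz).
    rewrite /root rmorphB /= hornerD hornerN map_polyC /= hornerC -jkE -tx -tev -sE tMab.
    by rewrite subrr.
  move=> /dvdpP[h]; move/(congr1 (fun r => (map_poly j r).[tau (g x)])).
  rewrite rmorphB rmorphM /= hornerM (eqP qg) mulr0 hornerD hornerN map_polyC /= hornerC -jkE.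
  by move=> /eqP; rewrite subr_eq0 => /eqP.
move=> v Bv.
have e : map_mx j (f *m map_mx (kap \o cK) v) = 0.
  have -> : map_mx j (f *m map_mx (kap \o cK) v) = U *m map_mx (j \o kap \o cK) (B *m v).
    rewrite !map_mxM -BE mulmxA mulKVmx //; congr (_ *m _).
    by apply/matrixP=> a b; rewrite !mxE.
  by rewrite Bv map_mx0 mulmx0.
apply/matrixP=> a b; apply: (fmorph_inj j).
by have /matrixP/(_ a b) := e; rewrite mxE => ->; rewrite !mxE rmorph0.
Qed.
End Embedding.

(** * Monodromy matrices and pseudoreflections *)

Lemma det_one_add_mul (R : comNzRingType) m r (u : 'M[R]_(m, r)) (v : 'M[R]_(r, m)) :
  \det (1%:M + u *m v) = \det (1%:M + v *m u).
Proof.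
have e : block_mx 1%:M 0 v 1%:M *m block_mx 1%:M (- u) 0 (1%:M + v *m u)
   = block_mx (1%:M + u *m v) (- u) 0 1%:M *m block_mx 1%:M 0 v 1%:M.
  rewrite !mulmx_block !mul1mx !mulmx1 !mul0mx !mulmx0 !addr0 !add0r mulNmx.
  by rewrite mulmxN (addrC _ (v *m u)) addKr addrK.
have := congr1 determinant e; rewrite !det_mulmx !det_lblock !det_ublock !det1.
by rewrite !mul1r !mulr1 => <-.
Qed.

(** A - 1 kills a plane, so it equals u v with u a column and v a row. Then det A = 1 + v u, hence v
    u = 0 and (u v)^2 = 0. *)
Lemma unipotent_of_fixed_hyperplane (F : fieldType) (A : 'M[F]_3) (B : 'M[F]_(3, 2)) :
  (forall v : 'cV_2, B *m v = 0 -> v = 0) -> A *m B = B -> \det A = 1 ->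
  (A - 1) * (A - 1) = 0.
Proof.
move=> Binj AB dA; set N := A - 1.
have NB : N *m B = 0 by rewrite mulmxBl AB mul1mx subrr.
have rB : \rank B = 2%N.
  apply/eqP; rewrite -mxrank_tr -[_ == _]/(row_free B^T); apply/inj_row_free => v vB.
  apply: trmx_inj; rewrite trmx0; apply: Binj.
  by rewrite -[LHS]trmxK trmx_mul trmxK vB trmx0.
have rN : (\rank N <= 1)%N.
  by have := mulmx0_rank_max NB; rewrite rB; lia.
have [u [v NE]] : exists (u : 'cV[F]_3) (v : 'rV[F]_3), N = u *m v.
  move: (col_base N) (row_base N) (mulmx_base N) rN.
  case: (\rank N) => [|[|//]] u v e _; last by exists u, v.
  by exists 0, 0; rewrite mulmx0 -e thinmx0 mul0mx.
have dvu : v *m u = 0.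
  have : \det (1%:M + u *m v) = 1 by rewrite -NE addrC subrK.
  rewrite det_one_add_mul det_mx11 mxE mxE eqxx -[RHS]addr0 => /addrI e.
  by apply/matrixP=> i j; rewrite !ord1 e mxE.
by rewrite NE -[_ * _]/(_ *m _) mulmxA -[u *m v *m u]mulmxA dvu mulmx0 mul0mx.
Qed.

Section Monodromy.
Variables (C : closedFieldType) (K L : diffFieldType).
Variables (iota : {rmorphism K -> L}) (cK : {rmorphism C -> K}).
Local Notation cL := (iota \o cK).
Hypothesis L_const : forall x : L, der x = 0 -> exists c, x = iota (cK c).
Variable n' : nat.
Local Notation n := n'.+1.
Variables (Y : 'M[L]_n) (A : 'M[K]_n).
Hypothesis uY : Y \in unitmx.
Hypothesis derY : map_mx der Y = map_mx iota A *m Y.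
Hypothesis Lgen : forall P : set L, diff_subfield P -> (forall a, P (iota a)) ->
  (forall i j, P (Y i j)) -> forall x, P x.
Local Notation G := (diffGal iota).

Lemma exists_monodromy (g : G) : exists R : 'M[C]_n, map_mx g Y = Y *m map_mx cL R.
Proof.
have dgY : map_mx der (map_mx g Y) = map_mx iota A *m map_mx g Y.
  have -> : map_mx der (map_mx g Y) = map_mx g (map_mx der Y).
    by apply/matrixP=> i j; rewrite !mxE diffGal_der.
  rewrite derY map_mxM; congr (_ *m _).
  by apply/matrixP=> i j; rewrite !mxE; exact: diffGal_base.
have db := solution_coordinates_constant uY derY dgY.
have /choice[R' R'E] : forall ab : 'I_n * 'I_n,
    exists c, (invmx Y *m map_mx g Y) ab.1 ab.2 = iota (cK c).
  by move=> ab; apply: L_const; have /matrixP/(_ ab.1 ab.2) := db; rewrite !mxE.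
exists (\matrix_(a, b) R' (a, b)); rewrite -[LHS](mulKVmx uY); congr (_ *m _).
by apply/matrixP=> a b; rewrite [LHS](R'E (a, b)) !mxE.
Qed.

Definition monodromy (g : G) : 'M[C]_n := projT1 (cid (exists_monodromy g)).

Lemma monodromyE (g : G) : map_mx g Y = Y *m map_mx cL (monodromy g).
Proof. by rewrite /monodromy; case: cid. Qed.

Lemma coordinates_inj k : injective (fun B : 'M[C]_(n, k) => Y *m map_mx cL B).
Proof.
move=> B B' /(congr1 (mulmx (invmx Y))); rewrite !mulKmx // => e.
apply/matrixP=> i j; have /matrixP/(_ i j) := e; rewrite !mxE.
by move=> /(fmorph_inj iota)/(fmorph_inj cK).
Qed.

Lemma diffGal_map_const (g : G) k m (B : 'M[C]_(k, m)) : map_mx g (map_mx cL B) = map_mx cL B.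
Proof. by apply/matrixP=> i j; rewrite !mxE; exact: diffGal_base. Qed.

Lemma monodromyM (g h : G) : monodromy (g * h)%g = monodromy g * monodromy h.
Proof.
apply: coordinates_inj; rewrite -monodromyE.
have -> : map_mx (g * h)%g Y = map_mx g (map_mx h Y) by apply/matrixP=> i j; rewrite !mxE.
by rewrite monodromyE map_mxM diffGal_map_const monodromyE -mulmxA -map_mxM.
Qed.

Lemma monodromy1 : monodromy 1%g = 1.
Proof.
apply: coordinates_inj; rewrite -monodromyE map_mx1 mulmx1.
by apply/matrixP=> i j; rewrite !mxE.
Qed.

Lemma monodromyX (g : G) k : monodromy (g ^+ k)%g = monodromy g ^+ k.
Proof. by elim: k => [|k IH]; rewrite ?expg0 ?monodromy1 // expgS monodromyM IH exprS. Qed.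

Lemma diffGal_eq1 (g : G) : map_mx g Y = Y -> g = 1%g.
Proof.
move=> gY; apply: diffGal_eq; apply: (Lgen (P := [set x | g x = x])) => /= [|a|i j].
- split.
  + exact: (rmorph1 g).
  + by move=> x y gx gy; apply: etrans (rmorphB g x y) _; congr (_ - _).
  + by move=> x y gx gy; apply: etrans (fmorph_div g x y) _; congr (_ / _).
  + by move=> x gx; apply: etrans (diffGal_der g x) _; congr der.
- exact: diffGal_base.
- by have /matrixP/(_ i j) := gY; rewrite mxE.
Qed.

Lemma monodromy_eq1 (g : G) : monodromy g = 1 -> g = 1%g.
Proof. by move=> m1; apply: diffGal_eq1; rewrite monodromyE m1 map_mx1 mulmx1. Qed.

(** With N = R - 1 and N^2 = 0, the powers of R are 1 + k N, pairwise distinct in characteristic 0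
    unless N = 0. *)
Lemma unipotent_monodromy (l : seq G) (g : G) : (forall h, h \in l) -> [pchar C] =i pred0 ->
  (monodromy g - 1) * (monodromy g - 1) = 0 -> g = 1%g.
Proof.
move=> lall ch0 NN; apply: monodromy_eq1; apply/eqP; rewrite -subr_eq0; set N := _ - 1.
have RX k : monodromy (g ^+ k)%g = 1 + N *+ k.
  rewrite monodromyX; elim: k => [|k IH]; first by rewrite expr0 mulr0n addr0.
  have gN : monodromy g = N + 1 by rewrite subrK.
  rewrite exprS IH gN mulrDl mul1r mulrDr mulr1 mulrnAr NN mul0rn addr0.
  by rewrite addrCA -mulrS.
apply: contraT => /eqP N0; have ginj : injective (fun k => g ^+ k)%g.
  move=> i j /(congr1 monodromy); rewrite !RX => /addrI e; apply: (natr_inj ch0).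
  have [a [b Nab]] : exists a b, N a b != 0.
    apply: contrapT => /forallNP h; apply: N0; apply/matrixP=> a b; rewrite [RHS]mxE.
    by have /forallNP/(_ b)/negP := h a; rewrite negbK => /eqP.
  have := congr1 (fun B : 'M[C]_n => B a b) e; rewrite !mulmxnE.
  by rewrite -[_ *+ i]mulr_natr -[_ *+ j]mulr_natr => /(mulfI Nab).
have := @uniq_leq_size _ [seq (g ^+ k)%g | k <- seq.iota 0 (size l).+1] l.
rewrite map_inj_uniq ?iota_uniq // size_map size_iota ltnn => h.
by suff: false by []; apply: h => // ? _; exact: lall.
Qed.
End Monodromy.

Section NoPseudoreflection.
Variables (C : closedFieldType) (K L : diffFieldType).
Variables (iota : {rmorphism K -> L}) (cK : {rmorphism C -> K}).
Local Notation cL := (iota \o cK).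
Hypothesis L_const : forall x : L, der x = 0 -> exists c, x = iota (cK c).
Variables (Y : 'M[L]_3) (A : 'M[K]_3).
Hypothesis uY : Y \in unitmx.
Hypothesis derY : map_mx der Y = map_mx iota A *m Y.
Hypothesis Lgen : forall P : set L, diff_subfield P -> (forall a, P (iota a)) ->
  (forall i j, P (Y i j)) -> forall x, P x.
Local Notation G := (diffGal iota).
Hypothesis ch0 : [pchar C] =i pred0.
Variable l : seq G.
Hypothesis lall : forall h, h \in l.
Hypothesis characters : forall chi : G -> C, chi 1%g = 1 ->
  (forall g h, chi (g * h)%g = chi g * chi h) ->
  forall g, chi g ^+ 2 = 1 /\ ((g ^+ 2)%g = 1%g -> chi g = 1).

Lemma no_pseudoreflection (g : G) (B : 'M[C]_(3, 2)) :
  (forall v : 'cV_2, B *m v = 0 -> v = 0) ->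
  map_mx g (Y *m map_mx cL B) = Y *m map_mx cL B -> g = 1%g.
Proof.
move=> Binj gB; pose rho := monodromy L_const uY derY.
have RB : rho g *m B = B.
  apply: (coordinates_inj (iota := iota) (cK := cK) uY).
  by rewrite -[RHS]gB map_mxM map_mxM mulmxA -monodromyE diffGal_map_const.
have [g2 ginv] : \det (rho g) ^+ 2 = 1 /\ ((g ^+ 2)%g = 1%g -> \det (rho g) = 1).
  apply: (characters (chi := fun g => \det (rho g))).
    by rewrite /rho monodromy1 det1.
  by move=> h k; rewrite /rho monodromyM det_mulmx.
have uni h : rho h *m B = B -> \det (rho h) = 1 -> h = 1%g.
  move=> hB dh; apply: (unipotent_monodromy (L_const := L_const) (derY := derY) Lgen lall ch0).
  exact: unipotent_of_fixed_hyperplane Binj hB dh.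
apply: (uni) => //; apply: ginv; apply: uni.
  by rewrite /rho monodromyX expr2 -[_ * _]/(_ *m _) -mulmxA !RB.
by rewrite /rho monodromyX expr2 -[_ * _]/(_ *m _) det_mulmx -expr2.
Qed.
End NoPseudoreflection.

(** * Hypergeometric equations *)

Section RationalConstants.
Variable C : fieldType.

Lemma ratcst_zmod_morphism : zmod_morphism (@ratcst C).
Proof. by move=> a b; rewrite /ratcst polyCB tofracB. Qed.
Lemma ratcst_monoid_morphism : GRing.monoid_morphism (@ratcst C).
Proof. by split=> [|a b]; rewrite /ratcst ?polyCM ?tofracM // tofrac1. Qed.

HB.instance Definition _ := GRing.isZmodMorphism.Build _ _ (@ratcst C) ratcst_zmod_morphism.
HB.instance Definition _ := GRing.isMonoidMorphism.Build _ _ (@ratcst C) ratcst_monoid_morphism.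

Lemma ratvar_neq0 : ratvar C != 0.
Proof. by rewrite tofrac_eq0 polyX_eq0. Qed.

Lemma ratvar_sub1_neq0 : ratvar C - 1 != 0.
Proof. by rewrite -tofrac1 -tofracB tofrac_eq0 -polyC1 polyXsubC_eq0. Qed.
End RationalConstants.

Section HypergeometricSystem.
Variables (C : fieldType) (E : diffFieldType) (j : {rmorphism {fraction {poly C}} -> E}).
Hypothesis j_der : {morph j : a / der a}.
Local Notation z := (j (ratvar C)).
Local Notation cst c := (j (ratcst c)).

Lemma thetaD x y : theta j (x + y) = theta j x + theta j y.
Proof. by rewrite /theta derD mulrDr. Qed.
Lemma thetaM x y : theta j (x * y) = theta j x * y + x * theta j y.
Proof. by rewrite /theta derM; ring. Qed.
Lemma der_cst c : der (cst c) = 0.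
Proof. by rewrite -j_der der_ratcst rmorph0. Qed.
Lemma theta_cst c : theta j (cst c) = 0.
Proof. by rewrite /theta der_cst mulr0. Qed.
Lemma thetaC c y : theta j (cst c * y) = cst c * theta j y.
Proof. by rewrite thetaM theta_cst mul0r add0r. Qed.

Variables a1 a2 a3 b1 b2 b3 : C.

(** The coefficients of theta^0, theta^1 and theta^2 in the product of the theta + a_i; [beta_coef]
    does the same for the theta + b_i - 1. *)
Definition alpha_coef : seq C := [:: a1 * a2 * a3; a1 * a2 + a1 * a3 + a2 * a3; a1 + a2 + a3].
Definition beta_coef : seq C := let c1 := b1 - 1 in let c2 := b2 - 1 in let c3 := b3 - 1 in
  [:: c1 * c2 * c3; c1 * c2 + c1 * c3 + c2 * c3; c1 + c2 + c3].
Local Notation A := (nth 0 alpha_coef).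
Local Notation B := (nth 0 beta_coef).

Lemma theta_add3 c1 c2 c3 y : theta_add j c1 (theta_add j c2 (theta_add j c3 y)) =
  theta j (theta j (theta j y)) + cst (c1 + c2 + c3) * theta j (theta j y)
  + cst (c1 * c2 + c1 * c3 + c2 * c3) * theta j y + cst (c1 * c2 * c3) * y.
Proof.
rewrite /theta_add !(thetaD, thetaC, rmorphD, rmorphM) /=; ring.
Qed.

Lemma hypergeometric_theta3 y : hypergeometric_sol j a1 a2 a3 b1 b2 b3 y ->
  (z - 1) * theta j (theta j (theta j y)) =
  - \sum_(i < 3) (z * cst (A i) - cst (B i)) * iter i (theta j) y.
Proof.
rewrite /hypergeometric_sol /= !theta_add3 !big_ord_recl big_ord0 /= => e.
rewrite -[LHS]addr0 -[X in _ + X]e.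
have gen (x A0 A1 A2 B0 B1 B2 t0 t1 t2 t3 : E) : (x - 1) * t3 +
  (t3 + B2 * t2 + B1 * t1 + B0 * t0 - x * (t3 + A2 * t2 + A1 * t1 + A0 * t0)) =
  - ((x * A0 - B0) * t0 + ((x * A1 - B1) * t1 + ((x * A2 - B2) * t2 + 0))) by ring.
exact: gen.
Qed.

(** The companion matrix for (y, theta y, theta^2 y), with the equation solved for theta^3 y. The
    factor 1/z converts theta into d/dz. *)
Definition hyper_mx : 'M[{fraction {poly C}}]_3 := \matrix_(i, k)
  ((ratvar C)^-1 * (if (i < 2)%N then (k == i.+1 :> nat)%:R
   else - (ratvar C * ratcst (A k) - ratcst (B k)) / (ratvar C - 1))).

Lemma hypergeometric_system y : hypergeometric_sol j a1 a2 a3 b1 b2 b3 y ->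
  map_mx der (\col_(i < 3) iter i (theta j) y) =
  map_mx j hyper_mx *m \col_(i < 3) iter i (theta j) y.
Proof.
move=> /hypergeometric_theta3 e.
have z0 : z != 0 by rewrite fmorph_eq0 ratvar_neq0.
have z1 : z - 1 != 0.
  by rewrite -(rmorph1 j) -rmorphB fmorph_eq0 ratvar_sub1_neq0.
have dth x : der x = z^-1 * theta j x by rewrite /theta mulKf.
apply/matrixP=> i k; rewrite !mxE dth !big_ord_recl big_ord0 !mxE /=.
case: i => [[|[|[|//]]] i3] /=; rewrite ?(mulr0, mulr1, rmorph0, mul0r, add0r, addr0, fmorphV) //.
have -> : theta j (theta j (theta j y)) = (z - 1)^-1 *
   - \sum_(i < 3) (z * cst (A i) - cst (B i)) * iter i (theta j) y.
  by rewrite -e mulKf.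
have jE x y' : j (ratvar C * x - y') = z * j x - j y' by rewrite rmorphB rmorphM.
have jV : j (ratvar C - 1) = z - 1 by rewrite rmorphB rmorph1.
rewrite !big_ord_recl big_ord0 /= !(rmorphM j _^-1) !(rmorphM j (- _)) !fmorphV !rmorphN !jV !jE.
have gen (x x' c0 c1 c2 t0 t1 t2 : E) : x * (x' * - (c0 * t0 + (c1 * t1 + (c2 * t2 + 0)))) =
  x * (- c0 * x') * t0 + (x * (- c1 * x') * t1 + x * (- c2 * x') * t2) by ring.
exact: gen.
Qed.
End HypergeometricSystem.

Section FundamentalMatrix.
Variables (C : fieldType) (L : diffFieldType) (iota : {rmorphism {fraction {poly C}} -> L}).
Hypothesis ch0 : [pchar C] =i pred0.
Variables a1 a2 a3 b1 b2 b3 : C.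
Hypothesis iota_der : {morph iota : a / der a}.
Hypothesis const : forall x : L, der x = 0 -> exists2 a : {fraction {poly C}}, der a = 0 & iota a = x.
Variable y : 'I_3 -> L.
Hypothesis sol : forall i, hypergeometric_sol iota a1 a2 a3 b1 b2 b3 (y i).
Hypothesis indep : forall c : 'I_3 -> {fraction {poly C}}, (forall i, der (c i) = 0) ->
  \sum_i iota (c i) * y i = 0 -> forall i, c i = 0.
Hypothesis gen : smallest (@diff_subfield L) (range iota `|` range y) = setT.

Definition fundamental_mx : 'M[L]_3 := \matrix_(i, j) iter i (theta iota) (y j).
Local Notation Y := fundamental_mx.

Lemma pv_constant x : der x = 0 -> exists c, x = iota (ratcst c).
Proof. by move=> /const [a /(ratfun_constant ch0) [c ->] <-]; exists c. Qed.

Lemma der_fundamental_mx :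
  map_mx der Y = map_mx iota (hyper_mx a1 a2 a3 b1 b2 b3) *m Y.
Proof.
apply/matrixP=> i j; have /matrixP/(_ i 0) := hypergeometric_system iota_der (sol j).
rewrite !mxE => ->; apply: eq_bigr => k _; by rewrite !mxE.
Qed.

(** The Wronskian criterion by descent: the relations between the columns form a space stable under
    the derivation, so a nonzero one yields a nonzero relation with constant coefficients. *)
Lemma fundamental_mx_unit : Y \in unitmx.
Proof.
rewrite -unitmx_tr -row_free_unit -kermx_eq0; apply: contraT => /rowV0Pn[v].
rewrite sub_kermx => /eqP vY v0.
pose N (u : 'rV[L]_3) := u *m Y^T = 0.
have NZ a u : N u -> N (a *: u) by rewrite /N -scalemxAl => ->; rewrite scaler0.
have Nd u : N u -> N (map_mx der u).
  move=> Nu; have := congr1 (map_mx der) Nu.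
  rewrite der_mulmx -map_trmx der_fundamental_mx trmx_mul mulmxA Nu mul0mx addr0 /N => ->.
  by apply/matrixP=> i j; rewrite !mxE der0.
have [c [Nc c0 dc _]] := exists_constant_vector (@derB L) (@derM L) NZ Nd vY v0.
have dc0 i : der (c 0 i) = 0 by have /matrixP/(_ 0 i) := dc; rewrite !mxE.
pose c' i := s2val (cid2 (const (dc0 i))).
have c'E i : iota (c' i) = c 0 i by rewrite /c'; case: cid2.
have c'0 : forall i, c' i = 0.
  apply: indep => [i|]; first by rewrite /c'; case: cid2.
  have /matrixP/(_ 0 0) := Nc; rewrite !mxE => e; rewrite -[RHS]e.
  by apply: eq_bigr => i _; rewrite !mxE c'E.
by have /rV0Pn[k] := c0; rewrite -c'E c'0 rmorph0 eqxx.
Qed.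

Lemma fundamental_mx_gen P : diff_subfield P -> (forall a, P (iota a)) ->
  (forall i j, P (Y i j)) -> forall x : L, P x.
Proof.
move=> dP Pi PY x; have : [set: L] x by []; rewrite -gen; apply; split=> // _ [[a _ <-]//|[j _ <-]].
by have := PY 0 j; rewrite mxE.
Qed.

Lemma diffGal_theta (g : diffGal iota) x : g (theta iota x) = theta iota (g x).
Proof. by rewrite /theta rmorphM /= diffGal_base diffGal_der. Qed.

Lemma diffGal_faithful (g : diffGal iota) : (forall j, g (y j) = y j) -> g = 1%g.
Proof.
move=> gy; apply: (diffGal_eq1 fundamental_mx_gen); apply/matrixP=> i j; rewrite !mxE.
by elim: (i : nat) => //= k IH; rewrite diffGal_theta IH.
Qed.
End FundamentalMatrix.

(** * Annihilating polynomials in theta *)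

Section ThetaPolynomials.
Variables (C : fieldType) (E : diffFieldType) (j : {rmorphism {fraction {poly C}} -> E}).
Hypothesis j_der : {morph j : a / der a}.
Local Notation cst c := (j (ratcst c)).

Lemma thetaB x y : theta j (x - y) = theta j x - theta j y.
Proof. by rewrite /theta derB mulrBr. Qed.

Definition theta_poly (P : {poly C}) (x : E) : E :=
  \sum_(i < size P) cst P`_i * iter i (theta j) x.

Lemma theta_poly_widen n (P : {poly C}) x : (size P <= n)%N ->
  theta_poly P x = \sum_(i < n) cst P`_i * iter i (theta j) x.
Proof.
move=> Pn; rewrite /theta_poly (big_ord_widen n (fun i => cst P`_i * iter i (theta j) x) Pn).
rewrite big_mkcond; apply: eq_bigr => i _; case: ltnP => // Pi.
by rewrite nth_default // !rmorph0 mul0r.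
Qed.

Lemma theta_polyC c x : theta_poly c%:P x = cst c * x.
Proof. by rewrite (theta_poly_widen (n := 1) _ (size_polyC_leq1 c)) big_ord1 coefC. Qed.

Lemma iter_thetaB r i x : iter i (theta j) (theta j x - cst r * x) =
  iter i.+1 (theta j) x - cst r * iter i (theta j) x.
Proof.
elim: i => //= i ->; by rewrite thetaB thetaC.
Qed.

Lemma theta_polyM Q r x :
  theta_poly (Q * ('X - r%:P)) x = theta_poly Q (theta j x - cst r * x).
Proof.
rewrite (@theta_poly_widen (size Q).+1); last first.
  have [->|Q0] := eqVneq Q 0; first by rewrite mul0r size_poly0.
  by rewrite size_Mmonic ?monicXsubC // size_XsubC addnS /= addn1.
rewrite /theta_poly [RHS](eq_bigr (fun i : 'I__ => cst Q`_i * iter i.+1 (theta j) x -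
   cst r * cst Q`_i * iter i (theta j) x)); last first.
  by move=> i _; rewrite iter_thetaB mulrBr; congr (_ - _); rewrite mulrCA mulrA.
have cE i : cst (Q * ('X - r%:P))`_i = cst (Q * 'X)`_i - cst r * cst Q`_i.
  have -> : (Q * ('X - r%:P))`_i = (Q * 'X)`_i - r * Q`_i.
    by rewrite mulrBr coefB coefMC [r * _]mulrC.
  by rewrite !rmorphB !rmorphM.
rewrite [LHS](eq_bigr (fun i : 'I__ => cst (Q * 'X)`_i * iter i (theta j) x -
   cst r * cst Q`_i * iter i (theta j) x)); last by move=> i _; rewrite cE mulrBl.
rewrite sumrB [RHS]sumrB.
rewrite big_ord_recl coefMX /= !rmorph0 mul0r add0r; congr (_ - _).
  by apply: eq_bigr => i _; rewrite coefMX.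
by rewrite big_ord_recr /= nth_default // !rmorph0 mulr0 mul0r addr0.
Qed.
End ThetaPolynomials.

Section CommutatorsAndEigenvectors.
Variables (C : fieldType) (L : diffFieldType) (iota : {rmorphism {fraction {poly C}} -> L}).
Hypothesis iota_der : {morph iota : a / der a}.
Hypothesis ch0 : [pchar C] =i pred0.
Hypothesis L_const : forall x : L, der x = 0 -> exists c, x = iota (ratcst c).
Local Notation G := (diffGal iota).
Local Notation cst c := (iota (ratcst c)).
Local Notation th := (theta iota).
Variable l : seq G.
Hypothesis lall : forall g, g \in l.

(** v and g v satisfy the same first-order equation, so their quotient is a constant. *)
Lemma eigenline r (v : L) (g : G) : v != 0 -> th v = cst r * v -> exists c, g v = cst c * v.
Proof.
move=> v0 ev; have /L_const[c e] : der (g v / v) = 0.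
  rewrite der_div //.
  have z0 : iota (ratvar C) != 0 by rewrite fmorph_eq0 ratvar_neq0.
  have dv : der v = (iota (ratvar C))^-1 * (cst r * v) by rewrite -ev /theta mulKf.
  have dgv : der (g v) = (iota (ratvar C))^-1 * (cst r * g v).
    by rewrite -diffGal_der dv 2!rmorphM /= diffGal_base fmorphV /= diffGal_base.
  by rewrite dgv dv; set a := _^-1; apply/eqP; rewrite mulf_eq0; apply/orP; left; apply/eqP; ring.
by exists c; rewrite -e mulfVK.
Qed.

Lemma eigenvector_commutator r (v : L) (g h : G) : th v = cst r * v ->
  (g * h * (h * g)^-1)%g v = v.
Proof.
have comm w : th w = cst r * w -> (g * h)%g w = (h * g)%g w.
  have [->|w0] := eqVneq w 0; first by rewrite !rmorph0.
  move=> ew; have [a ga] := eigenline g w0 ew; have [b hb] := eigenline h w0 ew.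
  have -> : (g * h)%g w = g (h w) by []. have -> : (h * g)%g w = h (g w) by [].
  by rewrite hb ga !rmorphM /= !diffGal_base hb ga mulrCA.
move=> ev; have -> : (g * h * (h * g)^-1)%g v = (g * h)%g ((h * g)^-1%g v) by [].
rewrite comm; last by move: (_^-1)%g => k; rewrite -diffGal_theta ev rmorphM /= diffGal_base.
have -> : (h * g)%g ((h * g)^-1%g v) = (h * g * (h * g)^-1)%g v by [].
by rewrite mulgV.
Qed.

Lemma finite_exponent (k : G) : exists2 n, (0 < n)%N & (k ^+ n = 1)%g.
Proof.
have : ~ injective (fun n => k ^+ n)%g.
  move=> ginj; have := @uniq_leq_size _ [seq (k ^+ n)%g | n <- seq.iota 0 (size l).+1] l.
  rewrite map_inj_uniq ?iota_uniq // size_map size_iota ltnn => h.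
  by suff: false by []; apply: h => // ? _; exact: lall.
move=> ninj; apply: contrapT => no; apply: ninj => i i'.
wlog: i i' / (i <= i')%N => [W|ii e].
  by case: (leqP i i') => [/W//|/ltnW /W h e]; apply/esym/h.
apply/eqP; rewrite eqn_leq ii /= leqNgt; apply/negP => lt; apply: no.
exists (i' - i)%N; first by rewrite subn_gt0.
by apply: (mulgI (k ^+ i)%g); rewrite -expgnDr subnKC // mulg1 -e.
Qed.

(** By induction the commutator k fixes theta w - r w, so v = k w - w satisfies theta v = r v and is
    itself fixed by k. Then k^n w = w + n v, and finite order forces v = 0. *)
Lemma theta_poly_commutator c rs (w : L) (g h : G) : c != 0 ->
  theta_poly iota (c *: \prod_(r <- rs) ('X - r%:P)) w = 0 ->
  (g * h * (h * g)^-1)%g w = w.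
Proof.
have comm r v : th v = cst r * v -> (g * h * (h * g)^-1)%g v = v.
  exact: eigenvector_commutator.
move: (g * h * _)%g comm => k comm c0; elim: rs w => [|r rs IH] w.
  rewrite big_nil alg_polyC theta_polyC => /eqP.
  by rewrite mulf_eq0 !fmorph_eq0 (negbTE c0) /= => /eqP ->; rewrite rmorph0.
rewrite big_cons mulrC scalerAl theta_polyM // => /IH.
pose v := k w - w; rewrite rmorphB /= diffGal_theta rmorphM /= diffGal_base => e.
have ev : th v = cst r * v.
  rewrite /v thetaB; apply/eqP; rewrite -subr_eq0.
  by have := congr1 (fun x => x - (th w - cst r * w)) e; rewrite subrr => <-; apply/eqP; ring.
have kv := comm _ _ ev.
have kn n : (k ^+ n)%g w = w + v *+ n.
  elim: n => [|n IHn]; first by rewrite expg0 mulr0n addr0.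
  rewrite expgS; have -> : (k * k ^+ n)%g w = k ((k ^+ n)%g w) by [].
  by rewrite IHn rmorphD rmorphMn /= kv mulrS addrA /v [w + _]addrC subrK.
have [[//|n] _ kn1] := finite_exponent k.
move: (kn n.+1); rewrite kn1 => /esym/eqP; rewrite -[X in _ == X]addr0.
have -> : (1%g : G) w = w by [].
rewrite (inj_eq (addrI w)) -mulr_natr mulf_eq0 => /orP[|/eqP n0].
  by rewrite subr_eq0 => /eqP.
have : n.+1%:R != 0 :> C := pchar0_natr_neq0 n ch0.
have -> : (n.+1%:R == 0 :> C) = (cst n.+1%:R == 0) by rewrite !fmorph_eq0.
by rewrite !rmorph_nat n0 eqxx.
Qed.
End CommutatorsAndEigenvectors.

Lemma cancel_den (E : fieldType) (a c n : E) : a != 0 -> c != 0 -> a * (n / (a * c)) * c = n.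
Proof. by move=> a0 c0; field; rewrite a0 c0. Qed.

Lemma cancel_den3 (E : fieldType) (d u w n : E) : d != 0 -> d * u * w * (n / d) = u * w * n.
Proof. by move=> d0; field. Qed.

(** * Poles at 1 and the recursion for powers of theta *)

Section Poles.
Variable C : fieldType.
Local Notation P := (fps C).
Local Notation F := (laurent C).

(** The triangular solver applies to b -> (d b) shifted by two, whose leading factor is the constant
    d_0. *)
Lemma fps_inverse (d : P) : d 0%N != 0 -> exists b, d * b = 1.
Proof.
move=> d0; pose D (b : P) : P := Fps (fun n => (d * b) n.+2).
have DD a b : D (a + b) = D a + D b.
  apply: fps_ext => n.
  exact: (congr1 (fun c : P => c n.+2) (mulrDr d a b)).
have lead n (a : P) : (forall i, (i < n.+2)%N -> a i = 0) -> D a n = d 0%N * a n.+2.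
  by move=> /(@fpsM_order _ d a 0 n.+2 (fun i h => False_ind _ (notF h)))[_]; rewrite add0n.
(* Initial values making coefficients 0 and 1 of the product d b equal to 1 and 0, which the shift
   leaves uncontrolled. *)
pose y : P := Fps (fun n => if n is 0 then (d 0%N)^-1 else - d 1%N / d 0%N ^+ 2).
have [|b [by_ Db]] := @exists_tail_solution C D (fun=> d 0%N) 0 DD lead _ y; first by [].
exists b; apply: fps_ext => -[|[|n]].
- by rewrite fpsM big_ord1 by_ //= mulfV // coef1.
- rewrite fpsM !big_ord_recl big_ord0 !by_ //= coef1 /= /bump /= addr0.
  by field.
- by rewrite -[LHS]/(D b n) (Db n (leq0n n)) /= coef1.
Qed.

Lemma fpsXn_mul n (a : P) m : (fpsX C ^+ n * a) m = if (m < n)%N then 0 else a (m - n)%N.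
Proof.
elim: n m => [|n IH] m; first by rewrite expr0 mul1r subn0.
by rewrite exprS -mulrA fpsXM; case: m => // m; rewrite IH ltnS subSS.
Qed.

Lemma fps_unit_factor (b : P) : b != 0 -> exists n u v, b = fpsX C ^+ n * u /\ u * v = 1.
Proof.
move=> /fps_order[n [bn bi]]; pose u : P := Fps (fun m => b (n + m)%N).
have [|v uv] := @fps_inverse u; first by rewrite /= addn0.
exists n, u, v; split=> //; apply: fps_ext => m; rewrite fpsXn_mul.
by case: ltnP => [/bi //|nm] /=; rewrite subnKC.
Qed.

Lemma laurent_pole (x : F) : exists p (a : P), (fpsX C ^+ p)%:F * x = a%:F.
Proof.
have [p [u [v [e uv]]]] := fps_unit_factor (den_neq0 x).
have u0 : (u%:F : F) != 0.
  by rewrite tofrac_eq0; apply: contra_eq_neq uv => ->; rewrite mul0r eq_sym oner_eq0.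
have d0 : ((fpsX C ^+ p)%:F : F) != 0.
  by rewrite tofrac_eq0; apply: contraNneq (den_neq0 x) => h; rewrite e h mul0r.
exists p, (num x * v); rewrite {1}(num_den x) e !tofracM.
apply: (mulIf u0); rewrite -[_ * v%:F * _]mulrA [v%:F * _]mulrC -[u%:F * v%:F]tofracM uv tofrac1 mulr1.
exact: cancel_den.
Qed.

Lemma common_pole n (x : 'I_n -> F) :
  exists p (a : 'I_n -> P), forall i, (fpsX C ^+ p)%:F * x i = (a i)%:F.
Proof.
have /choice[p /choice[a pa]] : forall i, exists p (a : P), (fpsX C ^+ p)%:F * x i = a%:F.
  by move=> i; exact: laurent_pole.
exists (\sum_i p i)%N, (fun i => fpsX C ^+ (\sum_(k | k != i) p k)%N * a i) => i.
by rewrite (bigD1 i) //= addnC exprD !tofracM -mulrA pa.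
Qed.

Lemma common_denominator m n (A : 'M[F]_(m, n)) : exists d : P, d != 0 /\
  exists M : 'M[P]_(m, n), forall i j, d%:F * A i j = (M i j)%:F.
Proof.
exists (\prod_i \prod_j den (A i j)); split.
  by apply/prodf_neq0 => i _; apply/prodf_neq0 => j _; exact: den_neq0.
have /choice[M MA] : forall ij : 'I_m * 'I_n, exists a : P,
    (\prod_i \prod_j den (A i j))%:F * A ij.1 ij.2 = a%:F.
  move=> [i j]; rewrite (bigD1 i) //= (bigD1 j) //=;
  set u := \prod_(_ < _ | _) _; set w := \prod_(_ < _ | _) _.
  exists (u * w * num (A i j)).
  have d0 : ((den (A i j))%:F : F) != 0 by rewrite tofrac_eq0 den_neq0.
  rewrite {2}(num_den (A i j)) !tofracM; exact: cancel_den3.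
by exists (\matrix_(i, j) M (i, j)) => i j; rewrite mxE -(MA (i, j)).
Qed.
End Poles.

Lemma size_addl (R : nzRingType) (p q : {poly R}) n :
  (size p <= n)%N -> (size q <= n)%N -> (size (p + q)%R <= n)%N.
Proof. by move=> pn qn; apply: leq_trans (size_polyD _ _) _; rewrite geq_max pn qn. Qed.

Lemma size_subl (R : nzRingType) (p q : {poly R}) n :
  (size p <= n)%N -> (size q <= n)%N -> (size (p - q)%R <= n)%N.
Proof. by move=> pn qn; apply: size_addl; rewrite ?size_polyN. Qed.

Lemma size_mul_lin (R : nzRingType) (p q : {poly R}) n :
  (size p <= 2)%N -> (size q <= n)%N -> (size (p * q)%R <= n.+1)%N.
Proof.
move=> p2 qn; apply: leq_trans (size_polyMleq _ _) _.
by move: p2 qn; case: (size p) => [|[|[|]]] //; case: (size q) => [|m] //=; lia.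
Qed.

Section PolynomialRecursion.
Variables (C : fieldType) (E : fieldType) (th : E -> E) (e : {rmorphism {poly C} -> E}).
Hypotheses (thD : forall x y, th (x + y) = th x + th y)
  (thM : forall x y, th (x * y) = th x * y + x * th y)
  (the : forall q, th (e q) = e (('X + 1%:P) * q^`())).
Variables E0 E1 E2 : {poly C}.
Hypotheses (sE0 : (size E0 <= 2)%N) (sE1 : (size E1 <= 2)%N) (sE2 : (size E2 <= 2)%N).
Variable p : nat.

(** Here X stands for t = z - 1. Apply theta to the k-th identity and multiply by t: t theta^3 f is
    replaced through the equation, and theta(t^k) = k z t^(k-1). The coefficients become t z a_i' -
    k z a_i + t a_(i-1) - E_i a_2, so each step raises degrees by at most 1. *)
Lemma theta_recursion k : exists a0 a1 a2 : {poly C},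
  [/\ (size a0 <= k + p.+1)%N, (size a1 <= k + p.+1)%N, (size a2 <= k + p.+1)%N
    & forall f, e 'X * th (th (th f)) = - (e E0 * f + e E1 * th f + e E2 * th (th f)) ->
      e 'X^k * iter k th (e 'X^p * f) = e a0 * f + e a1 * th f + e a2 * th (th f)].
Proof.
elim: k => [|k [a0 [a1 [a2 [s0 s1 s2 IH]]]]].
  exists 'X^p, 0, 0; rewrite size_polyXn size_poly0; split=> // f _.
  by rewrite !rmorph0 !mul0r !addr0 rmorph1 mul1r.
pose Z : {poly C} := 'X + 1%:P.
have sZ : (size Z <= 2)%N by rewrite size_XaddC.
have sX : (size ('X : {poly C}) <= 2)%N by rewrite size_polyX.
have sk (a b c : {poly C}) (Ei : {poly C}) : (size a <= k + p.+1)%N -> (size b <= k + p.+1)%N ->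
    (size c <= k + p.+1)%N -> (size Ei <= 2)%N ->
    (size ('X * (Z * a^`()) - k%:R *: (Z * a) + 'X * b - Ei * c)%R <= k.+1 + p.+1)%N.
  move=> sa sb sc sEi; rewrite addSn; apply: size_subl; last exact: size_mul_lin.
  apply: size_addl; last exact: size_mul_lin.
  apply: size_subl; last by apply: leq_trans (size_scale_leq _ _) _; exact: size_mul_lin.
  have [->|a0'] := eqVneq a^`() 0; first by rewrite !mulr0 size_poly0.
  apply: size_mul_lin => //.
  have sa' : (size a^`() < size a)%N.
    by apply: lt_size_deriv; apply: contraNneq a0' => ->; rewrite deriv0.
  case: (k + p.+1)%N sa => [|n] sa; first by move: sa'; rewrite ltnNge (leq_trans sa).
  by apply: size_mul_lin => //; rewrite -ltnS; apply: leq_trans sa' sa.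
exists ('X * (Z * a0^`()) - k%:R *: (Z * a0) + 'X * 0 - E0 * a2),
  ('X * (Z * a1^`()) - k%:R *: (Z * a1) + 'X * a0 - E1 * a2),
  ('X * (Z * a2^`()) - k%:R *: (Z * a2) + 'X * a1 - E2 * a2).
split; try exact: sk; first by apply: sk => //; rewrite size_poly0.
move=> f ef; have H1 := IH f ef; have H2 := congr1 th H1; move: H1 H2 ef.
rewrite !thD !thM !the /= -/Z; move: Z {sZ sk} => Z; move: (iter k th _) (th (iter k th _)) => w w'.
rewrite -!mul_polyC !(rmorphB, rmorphD, rmorphM, rmorphXn, rmorph0) /=.
have : e 'X * e ('X^k)^`() = e k%:R%:P * e 'X ^+ k.
  rewrite -rmorphXn -!rmorphM; congr (e _); rewrite polyC_natr mulr_natl derivXn.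
  by case: (k) => [|k']; rewrite ?mulr0n ?mulr0 // mulrnAr -exprS.
move: (e ('X^k)^`()) (e 'X) (e Z) (e k%:R%:P) => D X z K.
move: (e a0) (e a1) (e a2) (e E0) (e E1) (e E2) (e a0^`()) (e a1^`()) (e a2^`()).
move: (X ^+ k) (th f) (th (th f)) (th (th (th f))) (exprS X k).
move=> Xk f1 f2 f3 XS A0 A1 A2 e0 e1 e2 B0 B1 B2 H4 H1 H2 H3.
rewrite XS; transitivity (X * (z * D * w + Xk * w') - z * (X * D) * w); first by ring.
rewrite H2 H4; transitivity (X * (z * B0 * f + A0 * f1 + (z * B1 * f1 + A1 * f2) + z * B2 * f2)
  + A2 * (X * f3) - z * K * (Xk * w)); first by ring.
by rewrite H1 H3; ring.
Qed.
End PolynomialRecursion.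

Section LocalRegularity.
Variable C : fieldType.
Local Notation F := (laurent C).
Local Notation e := (@FracField.tofrac (fps C) \o @fps_poly C).
Local Notation th := (theta (@kappa C)).

Lemma theta_fps_poly (q : {poly C}) : th (e q) = e (('X + 1%:P) * q^`()).
Proof. by rewrite /= theta_tofrac /fth /fpsZ fps_der_poly -rmorphM. Qed.

Lemma low_coef_vanish (d : fps C) N (q : {poly C}) k (b : fps C) :
  d N != 0 -> (forall i, (i < N)%N -> d i = 0) -> d * fps_poly q = fpsX C ^+ k * b ->
  forall m, (m + N < k)%N -> q`_m = 0.
Proof.
move=> dN di eq m mk; have [->|q0] := eqVneq q 0; first by rewrite coef0.
have [|m0 [qm0 qi]] := @fps_order _ (fps_poly q).
  by apply: contraNneq q0 => h; apply/eqP/fps_poly_inj; rewrite h rmorph0.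
have [_] := fpsM_order di qi; rewrite eq fpsXn_mul; case: ltnP => [_ /esym/eqP|kN _].
  by rewrite mulf_eq0 (negbTE dN) (negbTE qm0).
by apply: (qi m); lia.
Qed.

(** There are 3n linear conditions on 3n + 1 unknowns. *)
Lemma exists_dependence (n : nat) (a : nat -> 'I_3 -> nat -> C) : exists K (c : 'rV[C]_K),
  c != 0 /\ forall i m, (m < n)%N -> \sum_k c 0 k * a k i m = 0.
Proof.
pose M : 'M[C]_((3 * n).+1, 3 * n) :=
  \matrix_(k < (3 * n).+1) mxvec (\matrix_(i < 3, m < n) a k i m).
have : kermx M != 0 by rewrite kermx_eq0 /row_free neq_ltn (leq_ltn_trans (rank_leq_col M)).
move=> /rowV0Pn[c]; rewrite sub_kermx => /eqP cM c0; exists (3 * n).+1, c; split=> // i m mn.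
have /matrixP/(_ 0 (mxvec_index i (Ordinal mn))) := cM; rewrite !mxE => h; rewrite -[RHS]h.
by apply: eq_bigr => k _; rewrite mxE mxvecE mxE.
Qed.

Variables a1 a2 a3 b1 b2 b3 : C.
Variable f : 'I_3 -> F.
Hypothesis f_sol : forall i, hypergeometric_sol (@kappa C) a1 a2 a3 b1 b2 b3 (f i).
Local Notation Phi := (fundamental_mx (@kappa C) f).
Hypothesis Phi_unit : Phi \in unitmx.

Lemma taylor_recursion p : exists a : nat -> 'I_3 -> {poly C},
  forall k, (forall i, (size (a k i) <= k + p.+1)%N) /\
  forall j, e 'X^k * iter k th (e 'X^p * f j) = \sum_i e (a k i) * Phi i j.
Proof.
pose E i : {poly C} := (nth 0 (alpha_coef a1 a2 a3) i) *: ('X + 1%:P)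
  - ((nth 0 (beta_coef b1 b2 b3) i)%:P).
have sE i : (size (E i) <= 2)%N.
  apply: size_subl; last by apply: leq_trans (size_polyC_leq1 _) _.
  by apply: leq_trans (size_scale_leq _ _) _; rewrite size_XaddC.
have eE i : e (E i) = kappa (ratvar C) * kappa (ratcst (nth 0 (alpha_coef a1 a2 a3) i))
    - kappa (ratcst (nth 0 (beta_coef b1 b2 b3) i)).
  rewrite kappa_ratvar !kappa_cst /E -mul_polyC mulrC rmorphB rmorphM; reflexivity.
have sol j : e 'X * th (th (th (f j))) =
    - (e (E 0%N) * f j + e (E 1%N) * th (f j) + e (E 2%N) * th (th (f j))).
  have -> : e 'X = kappa (ratvar C) - 1.
    by rewrite kappa_ratvar fpsZE tofracD tofrac1 addrK.
  have := hypergeometric_theta3 (@kappa_der C) (f_sol j).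
  rewrite !big_ord_recl big_ord0 addr0 addrA -!eE; exact.
have /choice[a aP] : forall k, exists a : 'I_3 -> {poly C},
    (forall i, (size (a i) <= k + p.+1)%N) /\
    forall j, e 'X^k * iter k th (e 'X^p * f j) = \sum_i e (a i) * Phi i j.
  move=> k; have [a0' [a1' [a2' [s0 s1 s2 aE]]]] :=
    @theta_recursion C F th e (thetaD _) (thetaM _) theta_fps_poly
      (E 0%N) (E 1%N) (E 2%N) (sE 0%N) (sE 1%N) (sE 2%N) p k.
  exists (fun i => nth 0 [:: a0'; a1'; a2'] i); split=> [[[|[|[|//]]] i3] //|j].
  by rewrite (aE _ (sol j)) !big_ord_recl big_ord0 addr0 !mxE addrA.
by exists a.
Qed.

(** Inverting the fundamental matrix expresses a_i through the power series theta^k g_j. If d is a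
    common denominator of the inverse matrix, t^k divides d a_i, and N is the order of d,
    independent of k. *)
Lemma taylor_recursion_integral p (g : 'I_3 -> fps C) : (forall j, e 'X^p * f j = (g j)%:F) ->
  exists N, forall k (a : 'I_3 -> {poly C}),
    (forall j, e 'X^k * iter k th (e 'X^p * f j) = \sum_i e (a i) * Phi i j) ->
  forall i m, (m + N < k)%N -> (a i)`_m = 0.
Proof.
move=> gE; have [d [d0 [M dM]]] := common_denominator (invmx Phi).
have [N [dN di]] := fps_order d0; exists N => k a aE i.
have iter_th j : iter k th (e 'X^p * f j) = (iter k (@fth C) (g j))%:F.
  by rewrite gE; elim: (k) => //= k' ->; rewrite theta_tofrac.
apply: (@low_coef_vanish d N (a i) k (\sum_j iter k (@fth C) (g j) * M j i)) => //.
apply/eqP; rewrite -tofrac_eq; apply/eqP.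
rewrite !tofracM tofracXn raddf_sum /=.
rewrite -[(fps_poly (a i))%:F]/(e (a i)).
have -> : e (a i) = \sum_j (\sum_i' e (a i') * Phi i' j) * invmx Phi j i.
  have /matrixP/(_ 0 i) : (\row_i' e (a i')) *m Phi *m invmx Phi = \row_i' e (a i').
    by rewrite mulmxK.
  rewrite !mxE => h; rewrite -[LHS]h; apply: eq_bigr => j _; rewrite mxE.
  by congr (_ * _); apply: eq_bigr => i' _; rewrite mxE.
rewrite !mulr_sumr; apply: eq_bigr => j _.
rewrite -aE iter_th mulrCA dM tofracM mulrA; congr (_ * _ * _).
by rewrite rmorphXn.
Qed.
End LocalRegularity.

Lemma theta_poly_shift (C : fieldType) (E : diffFieldType)
    (j : {rmorphism {fraction {poly C}} -> E}) N K (c : 'rV[C]_K) x :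
  theta_poly j (rVpoly c * 'X^N) x =
  \sum_(k < K) j (ratcst (c 0 k)) * iter (N + k) (theta j) x.
Proof.
rewrite (@theta_poly_widen _ _ _ (N + K)); last first.
  have [->|c0] := eqVneq (rVpoly c) 0; first by rewrite mul0r size_poly0.
  by rewrite size_Mmonic ?monicXn // size_polyXn addnS /= addnC leq_add2l size_poly.
rewrite big_split_ord /= big1 ?add0r => [|i _]; last first.
  by rewrite coefMXn /= ltn_ord !rmorph0 mul0r.
by apply: eq_bigr => i _; rewrite coefMXn /= ltnNge leq_addr addKn coef_rVpoly_ord.
Qed.

Section LocalAnnihilator.
Variable C : fieldType.
Local Notation F := (laurent C).
Local Notation e := (@FracField.tofrac (fps C) \o @fps_poly C).
Local Notation th := (theta (@kappa C)).
Variables a1 a2 a3 b1 b2 b3 : C.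
Variable f : 'I_3 -> F.
Hypothesis f_sol : forall i, hypergeometric_sol (@kappa C) a1 a2 a3 b1 b2 b3 (f i).
Local Notation Phi := (fundamental_mx (@kappa C) f).
Hypothesis Phi_unit : Phi \in unitmx.

(** Dividing a_(N+k) by t^k leaves b_k of degree at most N + p. A relation between the b_k with
    constants c_k gives the polynomial X^N times the sum of the c_k X^k. *)
Lemma exists_annihilator : exists p (P : {poly C}), P != 0 /\
  forall j, theta_poly (@kappa C) P ((kappa (ratvar C) - 1) ^+ p * f j) = 0.
Proof.
have [p [g gE]] := common_pole f.
have eX k : e 'X^k = (fpsX C ^+ k)%:F by rewrite -rmorphXn.
have eX0 k : e 'X^k != 0.
  rewrite eX tofracXn expf_neq0 // tofrac_eq0 -(rmorph0 (@fps_poly C)).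
  by rewrite (inj_eq (@fps_poly_inj C)) polyX_eq0.
have gE' j : e 'X^p * f j = (g j)%:F by rewrite eX.
have [a aP] := taylor_recursion f_sol p.
have [N aN] := taylor_recursion_integral Phi_unit gE'.
have low k i m : (m + N < k)%N -> (a k i)`_m = 0.
  by apply: aN => j; have [_ ->] := aP k.
have [K [c [c0 cE]]] := exists_dependence (N + p.+1) (fun k i m => (a (N + k)%N i)`_(k + m)%N).
exists p, (rVpoly c * 'X^N); split.
  rewrite mulf_neq0 ?expf_neq0 ?polyX_eq0 //; apply: contraNneq c0 => h.
  by rewrite -[c]rVpolyK h linear0.
move=> j; rewrite theta_poly_shift.
have -> : (kappa (ratvar C) - 1) ^+ p = e 'X^p.
  by rewrite kappa_ratvar fpsZE tofracD tofrac1 addrK eX tofracXn.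
pose b (k : nat) i := drop_poly k (a (N + k)%N i).
have bE k i : a (N + k)%N i = b k i * 'X^k.
  rewrite -[LHS](poly_take_drop k) (_ : take_poly k _ = 0) ?add0r //.
  by apply/polyP => m; rewrite coef_take_poly coef0; case: ltnP => // mk; apply: low; lia.
have th_b k : e 'X^N * iter (N + k) th (e 'X^p * f j) = \sum_i e (b k i) * Phi i j.
  apply: (mulfI (eX0 k)); rewrite mulrA -rmorphM -exprD addnC.
  have [_ ->] := aP (N + k)%N; rewrite mulr_sumr; apply: eq_bigr => i _.
  by rewrite bE rmorphM mulrA [e 'X^k * _]mulrC.
have cb i : \sum_(k < K) c 0 k *: b k i = 0.
  apply/polyP => m; rewrite coef_sum coef0.
  transitivity (\sum_k c 0 k * (a (N + k)%N i)`_(k + m)%N).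
    by apply: eq_bigr => k _; rewrite coefZ coef_drop_poly [(m + _)%N]addnC.
  have [/cE->//|mn] := ltnP m (N + p.+1); rewrite big1 // => k _.
  have [sa _] := aP (N + k)%N; rewrite nth_default ?mulr0 //.
  by apply: leq_trans (sa i) _; lia.
apply: (mulfI (eX0 N)); rewrite mulr0 mulr_sumr.
rewrite (eq_bigr (fun k : 'I_K => \sum_i e (c 0 k *: b k i) * Phi i j)); last first.
  move=> k _; rewrite mulrCA th_b mulr_sumr; apply: eq_bigr => i _.
  rewrite mulrA -mul_polyC rmorphM; congr (_ * _ * _); exact: kappa_cst.
rewrite exchange_big big1 // => i _; rewrite -mulr_suml -raddf_sum /= cb.
by rewrite !rmorph0 mul0r.
Qed.
End LocalAnnihilator.

Section AbelianFromEmbedding.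
Variables (C : fieldType) (L : diffFieldType) (iota : {rmorphism {fraction {poly C}} -> L}).
Hypothesis iota_der : {morph iota : a / der a}.
Hypothesis ch0 : [pchar C] =i pred0.
Hypothesis splits : forall P : {poly C}, exists rs, P = lead_coef P *: \prod_(r <- rs) ('X - r%:P).
Hypothesis L_const : forall x : L, der x = 0 -> exists c, x = iota (ratcst c).
Local Notation G := (diffGal iota).
Variable l : seq G.
Hypothesis lall : forall g, g \in l.
Variables a1 a2 a3 b1 b2 b3 : C.
Variable y : 'I_3 -> L.
Hypothesis sol : forall i, hypergeometric_sol iota a1 a2 a3 b1 b2 b3 (y i).
Hypothesis Y_unit : fundamental_mx iota y \in unitmx.
Hypothesis faithful : forall g : G, (forall j, g (y j) = y j) -> g = 1%g.
Variable tau : {rmorphism L -> laurent C}.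
Hypothesis tau_iota : forall a, tau (iota a) = kappa a.
Hypothesis tau_der : {morph tau : u / der u}.

Lemma embedding_theta x : tau (theta iota x) = theta (@kappa C) (tau x).
Proof. by rewrite /theta rmorphM /= tau_iota tau_der. Qed.

Lemma embedding_iter_theta k x : tau (iter k (theta iota) x) = iter k (theta (@kappa C)) (tau x).
Proof. by elim: k => //= k <-; rewrite embedding_theta. Qed.

Lemma embedding_theta_poly P x : tau (theta_poly iota P x) = theta_poly (@kappa C) P (tau x).
Proof.
rewrite /theta_poly rmorph_sum; apply: eq_bigr => i _.
by rewrite rmorphM /= embedding_iter_theta tau_iota.
Qed.

Lemma embedding_sol j : hypergeometric_sol (@kappa C) a1 a2 a3 b1 b2 b3 (tau (y j)).
Proof.
have tA c x : tau (theta_add iota c x) = theta_add (@kappa C) c (tau x).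
  by rewrite /theta_add rmorphD rmorphM /= embedding_theta tau_iota.
have := congr1 tau (sol j).
by rewrite rmorphB rmorphM /= !tA tau_iota rmorph0.
Qed.

Lemma abelian_of_embedding (g h : G) : (g * h = h * g)%g.
Proof.
have PhiE : fundamental_mx (@kappa C) (tau \o y) = map_mx tau (fundamental_mx iota y).
  by apply/matrixP=> i j; rewrite !mxE embedding_iter_theta.
have Phi_unit : fundamental_mx (@kappa C) (tau \o y) \in unitmx by rewrite PhiE map_unitmx.
have [p [P [P0 ann]]] := exists_annihilator embedding_sol Phi_unit.
suff k1 : (g * h * (h * g)^-1 = 1)%g by apply: (mulIg (h * g)^-1%g); rewrite k1 mulgV.
(* u lies in K, so a commutator fixing u y_j also fixes y_j. *)
pose u : L := iota (ratvar C - 1) ^+ p.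
have u0 : u != 0 by rewrite expf_neq0 // fmorph_eq0 ratvar_sub1_neq0.
apply: faithful => j; apply: (mulfI u0).
have Pw : theta_poly iota P (u * y j) = 0.
  apply: (fmorph_inj tau); rewrite embedding_theta_poly rmorph0 rmorphM rmorphXn /= tau_iota.
  by rewrite rmorphB rmorph1; exact: ann.
have [rs PE] := splits P; rewrite PE in Pw; have c0 : lead_coef P != 0 by rewrite lead_coef_eq0.
have := theta_poly_commutator iota_der ch0 L_const lall g h c0 Pw.
by move: (_ * _^-1)%g => k; rewrite rmorphM rmorphXn /= diffGal_base.
Qed.
End AbelianFromEmbedding.

(** * Uncountability of the complex numbers *)

Section Uncountable.
Import Order.TTheory Num.Theory.
Variable R : realType.

(* Cantor's nested intervals: the k-th term of [u] is avoided by keeping an outer third. *)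
Lemma real_uncountable (u : nat -> R) : exists x, forall n, u n != x.
Proof.
pose c (I : R * R) := (I.1 *+ 2 + I.2) / 3%:R; pose d (I : R * R) := (I.1 + I.2 *+ 2) / 3%:R.
pose step (n : nat) I := if u n < d I then (d I, I.2) else (I.1, c I).
pose I := fix I n := if n is k.+1 then step k (I k) else (0, 1) : R * R.
have Ilt n : (I n).1 < (I n).2.
  by elim: n => [|n IH] /=; rewrite ?ltr01 // /step /c /d; case: ifP => _ /=; move: IH; lra.
have Imono n : (I n).1 <= (I n.+1).1 /\ (I n.+1).2 <= (I n).2.
  by have := Ilt n; rewrite /= /step /c /d; case: ifP => _ /=; move=> *; split; lra.
have Ile m n : (m <= n)%N -> (I m).1 <= (I n).1 /\ (I n).2 <= (I m).2.
  move=> /subnKC <-; elim: (n - m)%N => [|k [h1 h2]]; first by rewrite addn0.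
  by have [h3 h4] := Imono (m + k)%N; rewrite addnS; split; [exact: le_trans h3|exact: le_trans h2].
have Icross m n : (I m).1 <= (I n).2.
  have [h1 _] := Ile _ _ (leq_maxl m n); have [_ h2] := Ile _ _ (leq_maxr m n).
  by apply: le_trans h1 _; apply: le_trans h2; exact: ltW.
pose S := range (fun n => (I n).1); pose x := sup S.
have ub n : ubound S (I n).2 by move=> _ [m _ <-].
have x1 n : (I n).1 <= x by apply: ub_le_sup; [exists (I 0%N).2|exists n].
have x2 n : x <= (I n).2 by apply: ge_sup => //; exists (I 0%N).1, 0%N.
exists x => n; apply/eqP => unx; have := x1 n.+1; have := x2 n.+1; have := Ilt n.
rewrite /= /step -unx; case: ifPn => /=; first by move=> *; lra.
by rewrite -leNgt /c /d; move=> *; lra.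
Qed.

(** Otherwise every fibre is finite, and the complex numbers are a countable union of finite
    sets. *)
Lemma complex_large_fibers : large_fibers R[i].
Proof.
move=> f; apply: contrapT => no.
have fib n : countable (f @^-1` [set n]).
  apply/finite_set_countable; apply: contrapT => inf; apply: no; exists n => N.
  have [B BA NB] := infinite_set_fset N inf.
  exists (fun i : 'I_N => nth 0 (finmap.enum_fset B) i) => [i i' /eqP|i].
    rewrite nth_uniq ?finmap.fset_uniq ?(leq_trans (ltn_ord _) NB) // => /eqP; exact: val_inj.
  by apply: (BA); rewrite /=; apply: mem_nth; exact: leq_trans (ltn_ord _) NB.
have : countable [set: R[i]].
  have -> : [set: R[i]] = \bigcup_(n in [set: nat]) (f @^-1` [set n]).
    by apply/seteqP; split=> // x _; exists (f x).
  by apply: bigcup_countable => // *; exact: countableP.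
move=> /countable_injP[g ginj].
pose P n (x : R) := g (x%:C)%C = n.
(* An injection g into the natural numbers is inverted into an enumeration of the reals, with 0 at
   indices outside the image. *)
pose u n := if pselect (exists x, P n x) is left h then projT1 (cid h) else 0.
have [x ux] := real_uncountable u.
have : u (g (x%:C)%C) = x; last by move=> e; have := ux (g (x%:C)%C); rewrite e eqxx.
rewrite /u; case: pselect => [h|[]]; last by exists x.
case: cid => x' /= /ginj; rewrite !inE => h'.
by have := congr1 (@complex.Re R) (h' I I).
Qed.
End Uncountable.

(** * Combination of the local and global arguments *)

Section HypergeometricGaloisGroup.
Variables (C : closedFieldType) (L : diffFieldType) (iota : {rmorphism {fraction {poly C}} -> L}).
Hypothesis Cfib : large_fibers C.
Hypothesis ch0 : [pchar C] =i pred0.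
Variables a1 a2 a3 b1 b2 b3 : C.
Hypothesis pv : picard_vessiot iota 3 (hypergeometric_sol iota a1 a2 a3 b1 b2 b3).
Local Notation G := (diffGal iota).
Variable l : seq G.
Hypothesis lall : forall g, g \in l.
Hypothesis characters : forall chi : G -> C, chi 1%g = 1 ->
  (forall g h, chi (g * h)%g = chi g * chi h) ->
  forall g, chi g ^+ 2 = 1 /\ ((g ^+ 2)%g = 1%g -> chi g = 1).

Theorem hypergeometric_galois_abelian (g h : G) : (g * h = h * g)%g.
Proof.
have [iota_der const [y [sol indep gen]]] := pv.
have L_const := pv_constant ch0 const.
have chK : [pchar {fraction {poly C}}] =i pred0.
  by move=> q; rewrite -(ch0 q) (fmorph_pchar (@ratcst C)).
have chL : [pchar L] =i pred0 by move=> q; rewrite -(chK q) (fmorph_pchar iota).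
have chF : [pchar (laurent C)] =i pred0 by move=> q; rewrite -(chK q) (fmorph_pchar (@kappa C)).
have uY := fundamental_mx_unit iota_der const sol indep.
have dY := der_fundamental_mx iota_der sol.
have Lgen := fundamental_mx_gen gen.
have fixed := fixed_field Cfib chL iota_der (@der_ratcst C) L_const uY dY Lgen.
(* Products and interpolation over the group must meet each element exactly once. *)
have luniq := undup_uniq l.
have lall' k : k \in undup l by rewrite mem_undup.
have faithful := diffGal_faithful gen.
have [x x_inj] := exists_distinct_conjugates chL lall faithful.
have [p pE] := exists_conjugates_poly lall' luniq fixed x.
have interp := exists_interpolation lall' luniq fixed x_inj.
have F_const := @laurent_constant C ch0.
have [[tau [tau_iota tau_der]]|[k k1 inertia]] :=
  embedding_or_inertia lall' luniq iota_der x_inj pE interp chF (@kappa_der C) F_const uY dY.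
  have splits (P : {poly C}) : exists rs, P = lead_coef P *: \prod_(r <- rs) ('X - r%:P).
    by have [rs PE] := closed_field_poly_normal P; exists rs.
  exact: (abelian_of_embedding iota_der ch0 splits L_const lall sol uY faithful tau_iota tau_der).
case: k1.
have [f1 [f2 [sol1 sol2 f_indep]]] := two_power_series_solutions ch0 a1 a2 a3 b1 b2 b3.
pose ff (m : 'I_2) : laurent C := if m == 0 then f1%:F else f2%:F.
pose f : 'M[laurent C]_(3, 2) := \matrix_(i, m) iter i (theta (@kappa C)) (ff m).
have [|B [gB Bf]] := inertia 2%N f.
  apply/matrixP=> i m.
  have ff_sol : hypergeometric_sol (@kappa C) a1 a2 a3 b1 b2 b3 (ff m).
    by rewrite /ff; case: ifP.
  have /matrixP/(_ i 0) := hypergeometric_system (@kappa_der C) ff_sol.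
  by rewrite !mxE => ->; apply: eq_bigr => i' _; rewrite !mxE.
apply: (no_pseudoreflection L_const uY dY Lgen ch0 lall characters _ gB) => v Bv.
have /matrixP/(_ 0 0) := Bf v Bv; rewrite !mxE !big_ord_recl big_ord0 !mxE /= addr0.
rewrite /ff /= [_ * kappa _]mulrC [X in _ + X]mulrC => /f_indep[v0 v1].
by apply/matrixP=> -[[|[|//]] i2] m; rewrite !ord1 mxE; [rewrite -[RHS]v0|rewrite -[RHS]v1];
  congr (v _ _); apply: val_inj.
Qed.
End HypergeometricGaloisGroup.

Local Open Scope ring_scope.

Theorem mainTheorem2 (R : realType) (eps : R[i])
    (heps : 9.-primitive_root eps) (heps9 : eps ^+ 6 + eps ^+ 3 + 1 = 0) :
  ~ exists (a1 a2 a3 b1 b2 b3 : R[i]) (L : diffFieldType)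
      (iota : {rmorphism {fraction {poly R[i]}} -> L}),
    picard_vessiot iota 3 (hypergeometric_sol iota a1 a2 a3 b1 b2 b3) /\
    isomorphic_to (diffGal iota) (H72_SL3 eps).
Proof.
case=> [a1 [a2 [a3 [b1 [b2 [b3 [L [iota [pv iso]]]]]]]]].
have ch0 : [pchar R[i]] =i pred0 := @Num.Theory.pchar_num _.
have three : 3%:R != 0 :> R[i] by rewrite Num.Theory.pnatr_eq0.
have [[l lall] [s [t st]] chars] := hessian_group_facts heps9 three iso.
apply: st.
exact: (@hypergeometric_galois_abelian R[i] L iota (@complex_large_fibers R) ch0
  a1 a2 a3 b1 b2 b3 pv l lall (chars R[i]) t s).
Qed.
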